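(* $$\gamma_1\left(\tfrac13\right)-\gamma_1\left(\tfrac23\right)=-\frac{\pi}{2\sqrt3}\left[2\gamma-\log 3+8\log(2\pi)-12\log\Gamma\left(\tfrac13\right)\right].$$
   Context: For real $u>0$, $\zeta(s,u)$ is the Hurwitz zeta function (the meromorphic continuation in $s$ of $\sum_{n\ge 0}(n+u)^{-s}$). The generalised Stieltjes constants $\gamma_p(u)$, $p\ge 0$, are defined by the Laurent expansion about $s=1$: $\zeta(s,u)=\frac{1}{s-1}+\sum_{p=0}^\infty\frac{(-1)^p}{p!}\gamma_p(u)(s-1)^p$. $\gamma$ is Euler's constant, $\Gamma$ the gamma function and $\log$ the natural logarithm. *)

(* Defs.v *)
From Stdlib Require Import Reals Factorial.
From Coquelicot Require Import Coquelicot.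

Open Scope R_scope.

(* [Rpow_C x s] is x^s = exp (s log x) with the real logarithm of x; this is the
   intended value only for x > 0. *)
Definition Rpow_C (x : R) (s : C) : C :=
  (exp (fst s * ln x) * cos (snd s * ln x),
   exp (fst s * ln x) * sin (snd s * ln x)).

(* Coquelicot has no analytic continuation, so the Hurwitz zeta function is
   specified: for each u > 0 it is holomorphic on the connected set C \ {1} and
   is the sum of its Dirichlet series on Re s > 1.  By the identity theorem this
   determines zeta s u for every u > 0 and s <> 1; zeta 1 u and zeta s u for
   u <= 0 are unconstrained and never used. *)
Definition is_hurwitz_zeta (zeta : C -> R -> C) : Prop :=
  forall u : R, 0 < u ->
    (forall s : C, s <> RtoC 1 ->
       ex_derive (K := C_AbsRing) (V := C_NormedModule)
         (fun z : C => zeta z u) s) /\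
    (forall s : C, 1 < fst s ->
       is_series (K := C_AbsRing) (V := C_NormedModule)
         (fun n : nat => Rpow_C (INR n + u) (Copp s)) (zeta s u)).

(* Laurent expansion on a punctured disc about s = 1:
   zeta(s,u) - 1/(s-1) = sum_p ((-1)^p / p!) gamma_p(u) (s-1)^p. *)
Definition is_stieltjes (zeta : C -> R -> C) (gamma_ : nat -> R -> C) : Prop :=
  forall u : R, 0 < u ->
    exists r : R, 0 < r /\
      forall s : C, s <> RtoC 1 -> Cmod (s - RtoC 1)%C < r ->
        is_pseries (K := C_AbsRing) (V := C_NormedModule)
          (fun p : nat => (RtoC ((-1) ^ p / INR (fact p)) * gamma_ p u)%C)
          (s - RtoC 1)%C
          (zeta s u - / (s - RtoC 1))%C.

(* The limit of H_(n+1) - log (n+1). *)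
Definition euler_gamma : R :=
  real (Lim_seq (fun n : nat =>
    sum_n (fun k : nat => / INR (S k)) n - ln (INR (S n)))).

(* Euler's integral, convergent for x > 0. *)
Definition Gamma (x : R) : R :=
  RInt_gen (fun t : R => Rpower t (x - 1) * exp (- t))
    (at_right 0) (Rbar_locally p_infty).

(* Main.v *)
Require Import Defs.
From Stdlib Require Import Reals.
From Coquelicot Require Import Coquelicot.
From Stdlib Require Import Factorial Lra Lia Psatz.
Open Scope R_scope.

(** Write chi for the odd character mod 3.  On s = 1 + h the difference
    zeta(s,1/3) - zeta(s,2/3) is 3^s L(s,chi), so the left-hand side is, up to
    elementary terms, 3 * sum chi(n) ln n / n.  This sum is read off from the
    asymptotics, as X -> oo, of I(X) = int_0^X A(T) dT/T with
    A(T) = int_0^T sqrt 3 / (2 cosh t + 1) dt, computed in two ways.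
    Expanding the integrand of A in powers of e^(-t) gives
    I(X) = sqrt 3 * sum chi(n) Ein(n X) / n, and Ein(x) = ln x + gamma + o(1).
    On the other hand the integrand is the Poisson kernel
    sin a / (cosh t - cos a) at a = 2 pi / 3; iterating its duplication formula
    in a gives a finite partial-fraction expansion, by which I(X) is approximately
    2 * sum_k [Ti(X/p_k) - Ti(X/q_k)], p_k = 2 pi (k + 1/3), q_k = 2 pi (k + 2/3),
    with Ti the inverse tangent integral.  The inversion formula
    Ti(x) - Ti(1/x) = (pi/2) ln x turns the terms with k small into
    pi * ln (q_k / p_k), and convexity controls the tail.  Finally
    sum_k ln (q_k / p_k) is evaluated by Gauss's limit for Gamma(1/3) and the
    sine product at 1/3. *)

(** * Monotonicity, finite sums and integrals against dt/t *)

(** The zeta values are evaluated at real s = 1 + h with h > 0. There the Dirichlet series for u =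
    1/3 and u = 2/3 are subtracted term by term and the poles 1/h cancel. Comparing the Laurent
    series with pi / sqrt 3 - B h + O(h^2), where B is the sum of [log_term], identifies
    gamma_1(1/3) - gamma_1(2/3) with B. The series over chi converge only conditionally, so limits
    are not interchanged: each approximation is an inequality with an explicit error. Three cut-offs
    occur besides X: J blocks of exponentials, N pole pairs in the head and 2^n pairs in all. They
    are tied together only in the final comparison, X = J = 4^j, N = 2^j, 2^n = 16^j, which makes
    every error O(2^-j). A subsequence suffices because the convergence of the full sum is proved
    separately. The divergent ln X disappears in that comparison: its coefficient is L(1, chi) = pi
    / (3 sqrt 3) on one side and (pi / 3) / sqrt 3 on the other. *)

Lemma nondecreasing_of_derive (f f' : R -> R) (a b : R) :
  a <= b -> (forall c, a <= c <= b -> is_derive f c (f' c)) ->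
  (forall c, a < c < b -> 0 <= f' c) -> f a <= f b.
Proof.
  intros [Hab | ->] Hd Hp; [|lra].
  destruct (MVT_cor2 f f' a b Hab) as [c [Hc Hc']].
  - intros c Hc. apply is_derive_Reals. now apply Hd.
  - specialize (Hp c Hc'). nra.
Qed.

(** Stands in for integrating an inequality between derivatives, with no integrability to check.
    Most elementary estimates below are instances with an explicit comparison function. *)
Lemma increment_le_of_derive (f f' g g' : R -> R) (a b : R) :
  a <= b -> (forall c, a <= c <= b -> is_derive f c (f' c)) ->
  (forall c, a <= c <= b -> is_derive g c (g' c)) ->
  (forall c, a < c < b -> f' c <= g' c) -> f b - f a <= g b - g a.
Proof.
  intros Hab Hf Hg Hp.
  assert (H : g a - f a <= g b - f b); [|lra].
  apply (nondecreasing_of_derive (fun x => g x - f x) (fun x => g' x - f' x)); auto.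
  - intros c Hc. apply (is_derive_minus g f); auto.
  - intros c Hc. specialize (Hp c Hc). lra.
Qed.

Lemma increment_eq_of_derive (f f' g g' : R -> R) (a b : R) :
  a <= b -> (forall c, a <= c <= b -> is_derive f c (f' c)) ->
  (forall c, a <= c <= b -> is_derive g c (g' c)) ->
  (forall c, a < c < b -> f' c = g' c) -> f b - f a = g b - g a.
Proof.
  intros Hab Hf Hg Hp.
  apply Rle_antisym; [apply (increment_le_of_derive f f' g g')
                     |apply (increment_le_of_derive g g' f f')]; auto;
    intros c Hc; rewrite (Hp c Hc); lra.
Qed.

Lemma Rabs_increment_le_of_derive (f f' g g' : R -> R) (a b : R) :
  a <= b -> (forall c, a <= c <= b -> is_derive f c (f' c)) ->
  (forall c, a <= c <= b -> is_derive g c (g' c)) ->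
  (forall c, a < c < b -> Rabs (f' c) <= g' c) -> Rabs (f b - f a) <= g b - g a.
Proof.
  intros Hab Hf Hg Hp. apply Rabs_le. split.
  - assert (H : - f b - - f a <= g b - g a); [|lra].
    apply (increment_le_of_derive (fun x => - f x) (fun x => - f' x) g g'); auto.
    + intros c Hc. apply (is_derive_opp f); auto.
    + intros c Hc. specialize (Hp c Hc). apply Rabs_le_between in Hp. lra.
  - apply (increment_le_of_derive f f' g g'); auto.
    intros c Hc. specialize (Hp c Hc). apply Rabs_le_between in Hp. lra.
Qed.

(** Unlike [sum_n f n], which has n + 1 terms, this sum runs over k < n and may be empty, which
    suits splitting and reindexing; [sum_n_rsum] converts between the two. *)
Fixpoint rsum (f : nat -> R) (n : nat) : R :=
  match n with O => 0 | S m => rsum f m + f m end.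

Lemma rsum_ext f g n : (forall k, (k < n)%nat -> f k = g k) -> rsum f n = rsum g n.
Proof.
  induction n as [|n IH]; intros H; simpl; auto.
  rewrite IH, H; auto.
Qed.

Lemma rsum_le f g n : (forall k, (k < n)%nat -> f k <= g k) -> rsum f n <= rsum g n.
Proof.
  induction n as [|n IH]; intros H; simpl; [lra|].
  apply Rplus_le_compat; auto.
Qed.

Lemma rsum_plus f g n : rsum (fun k => f k + g k) n = rsum f n + rsum g n.
Proof. induction n as [|n IH]; simpl; [ring|rewrite IH; ring]. Qed.

Lemma rsum_minus f g n : rsum (fun k => f k - g k) n = rsum f n - rsum g n.
Proof. induction n as [|n IH]; simpl; [ring|rewrite IH; ring]. Qed.

Lemma rsum_scal c f n : rsum (fun k => c * f k) n = c * rsum f n.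
Proof. induction n as [|n IH]; simpl; [ring|rewrite IH; ring]. Qed.

Lemma rsum_const c n : rsum (fun _ => c) n = INR n * c.
Proof. induction n as [|n IH]; [simpl; ring|]. rewrite S_INR. simpl. rewrite IH. ring. Qed.

Lemma Rabs_rsum_le f g n :
  (forall k, (k < n)%nat -> Rabs (f k) <= g k) -> Rabs (rsum f n) <= rsum g n.
Proof.
  induction n as [|n IH]; intros H; simpl; [rewrite Rabs_R0; lra|].
  apply Rle_trans with (1 := Rabs_triang _ _). apply Rplus_le_compat; auto.
Qed.

Lemma rsum_add f m n : rsum f (m + n) = rsum f m + rsum (fun k => f (m + k)%nat) n.
Proof.
  induction n as [|n IH]; [rewrite Nat.add_0_r; simpl; ring|].
  rewrite Nat.add_succ_r. simpl. rewrite IH. ring.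
Qed.

Lemma rsum_succ_l f n : rsum f (S n) = f O + rsum (fun k => f (S k)) n.
Proof. change (S n) with (1 + n)%nat. rewrite rsum_add. simpl. ring. Qed.

Lemma rsum_rev f n : rsum f n = rsum (fun k => f (n - S k)%nat) n.
Proof.
  induction n as [|n IH]; [reflexivity|].
  rewrite rsum_succ_l with (f := fun k => f (S n - S k)%nat). simpl.
  replace (n - 0)%nat with n by lia. rewrite IH. ring.
Qed.

Lemma rsum_telescope f n : rsum (fun k => f k - f (S k)) n = f O - f n.
Proof. induction n as [|n IH]; simpl; [ring|rewrite IH; ring]. Qed.

Lemma is_derive_rsum (f f' : nat -> R -> R) n x :
  (forall k, (k < n)%nat -> is_derive (f k) x (f' k x)) ->
  is_derive (fun y => rsum (fun k => f k y) n) x (rsum (fun k => f' k x) n).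
Proof.
  induction n as [|n IH]; intros H; simpl.
  - apply (is_derive_const 0).
  - apply (is_derive_plus (fun y => rsum (fun k => f k y) n) (f n)); auto.
Qed.

Lemma sum_n_rsum f n : sum_n f n = rsum f (S n).
Proof.
  induction n as [|n IH].
  - rewrite sum_O. simpl. now rewrite Rplus_0_l.
  - rewrite sum_Sn, IH. reflexivity.
Qed.

(** * Calculus of the integral from 0 to X against dt/t *)

Definition logint (f : R -> R) (X : R) : R := RInt (fun t => f t / t) 0 X.

(** The value 0 and the derivative at 0 make [f t / t] extend continuously to 0, so [logint] is a
    proper integral. Differentiability on the whole line avoids one-sided arguments. *)
Definition log_integrable (f : R -> R) : Prop := f 0 = 0 /\ forall t, ex_derive f t.

(** The continuous extension of [f t / t] to 0. Integrability of the integrand and differentiation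
    of [logint] are obtained through it. *)
Definition slope (f : R -> R) (t : R) : R :=
  if Req_EM_T t 0 then Derive f 0 else f t / t.

Lemma slope_nonzero f t : t <> 0 -> slope f t = f t / t.
Proof. intros Ht. unfold slope. destruct (Req_EM_T t 0); tauto. Qed.

Lemma continuous_slope f t : log_integrable f -> continuous (slope f) t.
Proof.
  intros [H0 Hd]. destruct (Req_EM_T t 0) as [-> | Ht].
  - assert (H := Derive_correct f 0 (Hd 0)). apply is_derive_Reals in H.
    apply continuity_pt_filterlim. intros eps Heps.
    destruct (H eps Heps) as [d Hdel]. exists d. split; [apply cond_pos|].
    intros y [[_ Hy] Hyd]. unfold dist in *; simpl in *. unfold R_dist in *.
    rewrite Rminus_0_r in Hyd.
    rewrite slope_nonzero by auto. unfold slope at 1.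
    destruct (Req_EM_T 0 0); [|tauto].
    specialize (Hdel y (not_eq_sym Hy) Hyd). rewrite Rplus_0_l, H0, Rminus_0_r in Hdel. exact Hdel.
  - apply continuous_ext_loc with (fun u => f u / u).
    + assert (Hp : 0 < Rabs t) by now apply Rabs_pos_lt.
      exists (mkposreal _ Hp). intros y Hy.
      change (Rabs (y - t) < Rabs t) in Hy. symmetry. apply slope_nonzero.
      intros ->. replace (0 - t) with (- t) in Hy by ring. rewrite Rabs_Ropp in Hy. lra.
    + apply (continuous_mult f (fun u => / u)).
      * apply (ex_derive_continuous (V := R_NormedModule) f), Hd.
      * apply continuous_Rinv; auto.
Qed.

Lemma logint_slope f X : 0 <= X -> logint f X = RInt (slope f) 0 X.
Proof.
  intros HX. apply RInt_ext. intros x Hx. rewrite Rmin_left in Hx by lra.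
  rewrite slope_nonzero; lra.
Qed.

Lemma ex_RInt_slope f a b : log_integrable f -> ex_RInt (slope f) a b.
Proof. intros Hf. apply (ex_RInt_continuous (V := R_CompleteNormedModule)). intros z _. now apply continuous_slope. Qed.

Lemma ex_RInt_log f X : 0 <= X -> log_integrable f -> ex_RInt (fun t => f t / t) 0 X.
Proof.
  intros HX Hf. apply ex_RInt_ext with (slope f); [|now apply ex_RInt_slope].
  intros x Hx. rewrite Rmin_left in Hx by lra. apply slope_nonzero. lra.
Qed.

Lemma logint_minus f g X : 0 <= X -> log_integrable f -> log_integrable g ->
  logint (fun t => f t - g t) X = logint f X - logint g X.
Proof.
  intros HX Hf Hg. unfold logint.
  rewrite <- (RInt_minus (fun t => f t / t) (fun t => g t / t)) by now apply ex_RInt_log.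
  apply RInt_ext. intros x Hx. unfold minus, plus, opp; simpl. unfold Rdiv. ring.
Qed.

Lemma logint_plus f g X : 0 <= X -> log_integrable f -> log_integrable g ->
  logint (fun t => f t + g t) X = logint f X + logint g X.
Proof.
  intros HX Hf Hg. unfold logint.
  rewrite <- (RInt_plus (fun t => f t / t) (fun t => g t / t)) by now apply ex_RInt_log.
  apply RInt_ext. intros x Hx. unfold plus; simpl. unfold Rdiv. ring.
Qed.

Lemma logint_scal c f X : 0 <= X -> log_integrable f ->
  logint (fun t => c * f t) X = c * logint f X.
Proof.
  intros HX Hf. unfold logint.
  rewrite <- (RInt_scal (fun t => f t / t)) by now apply ex_RInt_log.
  apply RInt_ext. intros x Hx. unfold scal; simpl. unfold mult; simpl. unfold Rdiv. ring.
Qed.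

Lemma log_integrable_plus f g :
  log_integrable f -> log_integrable g -> log_integrable (fun t => f t + g t).
Proof. intros [H1 H2] [H3 H4]. split; [rewrite H1, H3; ring|]. intros t. now apply (ex_derive_plus f g). Qed.

Lemma log_integrable_minus f g :
  log_integrable f -> log_integrable g -> log_integrable (fun t => f t - g t).
Proof. intros [H1 H2] [H3 H4]. split; [rewrite H1, H3; ring|]. intros t. now apply (ex_derive_minus f g). Qed.

Lemma log_integrable_scal c f : log_integrable f -> log_integrable (fun t => c * f t).
Proof. intros [H1 H2]. split; [rewrite H1; ring|]. intros t. now apply ex_derive_scal. Qed.

Lemma log_integrable_rsum f n :
  (forall k, (k < n)%nat -> log_integrable (f k)) ->
  log_integrable (fun t => rsum (fun k => f k t) n).
Proof.
  induction n as [|n IH]; intros H; simpl.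
  - split; auto. intros t. apply ex_derive_const.
  - apply log_integrable_plus; auto.
Qed.

Lemma logint_rsum f n X : 0 <= X ->
  (forall k, (k < n)%nat -> log_integrable (f k)) ->
  logint (fun t => rsum (fun k => f k t) n) X = rsum (fun k => logint (f k) X) n.
Proof.
  intros HX. induction n as [|n IH]; intros H; simpl.
  - unfold logint. rewrite (RInt_ext _ (fun _ => 0)).
    + rewrite RInt_const. unfold scal; simpl. unfold mult; simpl. ring.
    + intros x _. apply Rmult_0_l.
  - rewrite logint_plus; auto.
    + rewrite IH; auto.
    + apply log_integrable_rsum; auto.
Qed.

Lemma logint_ext f g X : 0 <= X -> (forall t, 0 < t < X -> f t = g t) ->
  logint f X = logint g X.
Proof.
  intros HX H. apply RInt_ext. intros x Hx. rewrite Rmin_left, Rmax_right in Hx by lra.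
  now rewrite H.
Qed.

Lemma logint_le f g X : 0 <= X -> log_integrable f -> log_integrable g ->
  (forall t, 0 < t < X -> f t <= g t) -> logint f X <= logint g X.
Proof.
  intros HX Hf Hg H. apply RInt_le; auto using ex_RInt_log.
  intros x Hx. apply Rmult_le_compat_r; auto. left. apply Rinv_0_lt_compat. lra.
Qed.

Lemma log_integrable_id : log_integrable (fun t => t).
Proof. split; auto. intros t. apply ex_derive_id. Qed.

Lemma logint_id X : 0 <= X -> logint (fun t => t) X = X.
Proof.
  intros HX. unfold logint. rewrite (RInt_ext _ (fun _ => 1)).
  - rewrite RInt_const. unfold scal; simpl. unfold mult; simpl. ring.
  - intros x Hx. rewrite Rmin_left in Hx by lra. apply Rinv_r. lra.
Qed.

(** Since dt/t diverges at 0, a constant bound on [f] would be useless, whereas one proportional to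
    t integrates to c X. The comparison of the kernel with atan is shaped to carry such a factor. *)
Lemma Rabs_logint_le f c X : 0 <= X -> log_integrable f ->
  (forall t, 0 < t < X -> Rabs (f t) <= c * t) -> Rabs (logint f X) <= c * X.
Proof.
  intros HX Hf H. rewrite <- (logint_id X HX) at 2.
  rewrite <- logint_scal by auto using log_integrable_id.
  apply Rabs_le. split.
  - assert (E : - logint (fun t => c * t) X = logint (fun t => - c * t) X).
    { rewrite !logint_scal by auto using log_integrable_id. ring. }
    rewrite E. apply logint_le; auto using log_integrable_scal, log_integrable_id.
    intros t Ht. specialize (H t Ht). apply Rabs_le_between in H. lra.
  - apply logint_le; auto using log_integrable_scal, log_integrable_id.
    intros t Ht. specialize (H t Ht). apply Rabs_le_between in H. lra.
Qed.

Lemma is_derive_logint f X : 0 < X -> log_integrable f -> is_derive (logint f) X (f X / X).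
Proof.
  intros HX Hf. rewrite <- slope_nonzero by lra.
  apply is_derive_ext_loc with (fun x => RInt (slope f) 0 x).
  - exists (mkposreal _ HX). intros y Hy. change (Rabs (y - X) < X) in Hy.
    apply Rabs_lt_between in Hy. symmetry. apply logint_slope. lra.
  - apply (is_derive_RInt (slope f) _ 0).
    + apply filter_forall. intros b. apply (RInt_correct (V := R_CompleteNormedModule)), ex_RInt_slope, Hf.
    + now apply continuous_slope.
Qed.

Lemma log_integrable_comp f c : log_integrable f -> log_integrable (fun t => f (c * t)).
Proof.
  intros [H0 Hd]. split; [now rewrite Rmult_0_r|].
  intros t. apply (ex_derive_comp f (fun t => c * t)); auto.
  auto_derive; auto.
Qed.

(** The measure dt/t is invariant under dilation, so scaling the argument only scales the upper
    limit. *)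
Lemma logint_comp f c X : 0 < c -> 0 <= X -> log_integrable f ->
  logint (fun t => f (c * t)) X = logint f (c * X).
Proof.
  intros Hc HX Hf. rewrite (logint_slope f) by nra.
  assert (H := RInt_comp_lin (slope f) c 0 0 X).
  rewrite Rmult_0_r, !Rplus_0_r in H. rewrite <- H by now apply ex_RInt_slope.
  apply RInt_ext. intros x Hx. rewrite Rmin_left in Hx by lra.
  rewrite slope_nonzero by nra. unfold scal; simpl. unfold mult; simpl.
  rewrite Rplus_0_r. field. lra.
Qed.

(** * The Poisson kernel and its multiplication formula *)

Definition poisson_kernel (a t : R) : R := 2 * sin a / (exp t + exp (- t) - 2 * cos a).

(** This is 2 atan (tanh (T/2) cot (a/2)), the primitive of the kernel in T that vanishes at 0.
    Having it in closed form allows differentiation in the angle as well as in T. *)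
Definition poisson_primitive (a T : R) : R :=
  2 * atan ((exp T - 1) / (exp T + 1) * (cos (a / 2) / sin (a / 2))).

Lemma sin_cos_half a : sin a = 2 * sin (a / 2) * cos (a / 2) /\
  cos a = cos (a / 2) ^ 2 - sin (a / 2) ^ 2 /\ sin (a / 2) ^ 2 + cos (a / 2) ^ 2 = 1.
Proof.
  assert (E : a = 2 * (a / 2)) by field.
  assert (Es := sin_2a (a / 2)). assert (Ec := cos_2a (a / 2)).
  rewrite <- E in Es, Ec. rewrite Es, Ec. repeat split; try ring.
  generalize (sin2_cos2 (a / 2)). unfold Rsqr. intros; nra.
Qed.

Lemma sin_half_pos a : 0 < a < 2 * PI -> 0 < sin (a / 2).
Proof. intros H. apply sin_gt_0; lra. Qed.

Lemma cosh_gt_1 t : t <> 0 -> 2 < exp t + exp (- t).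
Proof.
  intros Ht. assert (H := exp_pos t). rewrite exp_Ropp.
  assert (exp t <> 1) by (intros E; apply Ht; apply exp_inv; now rewrite exp_0).
  apply Rmult_lt_reg_r with (exp t); auto.
  replace ((exp t + / exp t) * exp t) with (exp t * exp t + 1) by (field; lra).
  nra.
Qed.

Lemma poisson_kernel_denominator_pos a t : sin (a / 2) <> 0 -> 0 < exp t + exp (- t) - 2 * cos a.
Proof.
  intros Hs. destruct (sin_cos_half a) as (_ & E & E1). rewrite E.
  assert (0 < sin (a / 2) ^ 2) by (apply pow2_gt_0; auto).
  destruct (Req_EM_T t 0) as [-> | Ht].
  - rewrite Ropp_0, exp_0. lra.
  - generalize (cosh_gt_1 t Ht). lra.
Qed.

Lemma is_derive_poisson_primitive a T : sin (a / 2) <> 0 -> is_derive (poisson_primitive a) T (poisson_kernel a T).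
Proof.
  intros Hs. assert (HD := poisson_kernel_denominator_pos a T Hs). revert HD.
  unfold poisson_primitive, poisson_kernel. destruct (sin_cos_half a) as (E & E2 & E1). rewrite E, E2.
  set (s := sin (a / 2)) in *. set (c := cos (a / 2)) in *.
  rewrite exp_Ropp. assert (He := exp_pos T). intros HD.
  auto_derive; [lra|]. set (e := exp T) in *.
  assert (Hc : c ^ 2 = 1 - s ^ 2) by lra.
  assert (H1 : (e + / e - 2 * (c ^ 2 - s ^ 2)) <> 0) by lra.
  assert (H2 : e * e + 1 - 2 * e * (c ^ 2 - s ^ 2) <> 0).
  { intros E3. apply H1. apply Rmult_eq_reg_l with e; [|lra].
    rewrite Rmult_0_r, <- E3. field. lra. }
  assert (H3 : s ^ 2 * (e + 1) ^ 2 + c ^ 2 * (e - 1) ^ 2 <> 0).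
  { rewrite Hc in H2 |- *. intros E3. apply H2. rewrite <- E3. ring. }
  (* Both sides are brought to this common denominator, which by s^2 + c^2 = 1 equals e times the
     denominator of the kernel. *)
  transitivity (4 * e * c * s / (s ^ 2 * (e + 1) ^ 2 + c ^ 2 * (e - 1) ^ 2)).
  - field. apply and_assoc. split; [|lra]. try (split; [|assumption]). intros E3. apply H3. rewrite <- E3. ring.
  - replace (s ^ 2 * (e + 1) ^ 2 + c ^ 2 * (e - 1) ^ 2)
      with (e * e + 1 - 2 * e * (c ^ 2 - s ^ 2)) in * by (rewrite Hc; ring).
    field. repeat split; try lra; intros E3; apply H2; rewrite <- E3; ring.
Qed.

(** Used to compare the primitive with 2 atan (T/a) through an increment in the angle between the
    two poles of a pair. *)
Lemma is_derive_poisson_primitive_angle a T : sin (a / 2) <> 0 ->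
  is_derive (fun a => poisson_primitive a T) a
    (- ((exp T - exp (- T)) / (exp T + exp (- T) - 2 * cos a))).
Proof.
  intros Hs. assert (HD := poisson_kernel_denominator_pos a T Hs). revert HD.
  unfold poisson_primitive. destruct (sin_cos_half a) as (E & E2 & E1). rewrite E2.
  rewrite exp_Ropp. assert (He := exp_pos T). intros HD.
  auto_derive; [auto|]. unfold Rdiv in *.
  set (s := sin (a * / 2)) in *. set (c := cos (a * / 2)) in *.
  set (e := exp T) in *.
  assert (Hc : c ^ 2 = 1 - s ^ 2) by lra.
  assert (H1 : (e + / e - 2 * (c ^ 2 - s ^ 2)) <> 0) by lra.
  assert (H2 : e * e + 1 - 2 * e * (c ^ 2 - s ^ 2) <> 0).
  { intros E3. apply H1. apply Rmult_eq_reg_l with e; [|lra].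
    rewrite Rmult_0_r, <- E3. field. lra. }
  assert (H3 : s ^ 2 * (e + 1) ^ 2 + c ^ 2 * (e - 1) ^ 2 <> 0).
  { rewrite Hc in H2 |- *. intros E3. apply H2. rewrite <- E3. ring. }
  transitivity (- ((e - 1) * (e + 1) * (s ^ 2 + c ^ 2)) / (s ^ 2 * (e + 1) ^ 2 + c ^ 2 * (e - 1) ^ 2)).
  - field. apply and_assoc. split; [|lra]. try (split; [|assumption]). intros E3. apply H3. rewrite <- E3. ring.
  - rewrite E1.
    replace (s ^ 2 * (e + 1) ^ 2 + c ^ 2 * (e - 1) ^ 2)
      with (e * e + 1 - 2 * e * (c ^ 2 - s ^ 2)) in * by (rewrite Hc; ring).
    field. repeat split; try lra; intros E3; apply H2; rewrite <- E3; ring.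
Qed.

Lemma poisson_primitive_0 a : poisson_primitive a 0 = 0.
Proof.
  unfold poisson_primitive. rewrite exp_0. replace ((1 - 1) / (1 + 1) * (cos (a / 2) / sin (a / 2))) with 0.
  - rewrite atan_0. ring.
  - unfold Rdiv. ring.
Qed.

Lemma log_integrable_poisson_primitive a : sin (a / 2) <> 0 -> log_integrable (poisson_primitive a).
Proof.
  intros Hs. split; [apply poisson_primitive_0|]. intros t. eexists. now apply is_derive_poisson_primitive.
Qed.

(** cot changes sign under a/2 -> PI - a/2. This folds angles above PI back below PI, where they
    become the subtracted terms. *)
Lemma poisson_primitive_reflect a T : poisson_primitive (2 * PI - a) T = - poisson_primitive a T.
Proof.
  unfold poisson_primitive. replace ((2 * PI - a) / 2) with (PI - a / 2) by field.
  rewrite sin_PI_x, Rtrigo_facts.cos_pi_minus.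
  replace (- cos (a / 2) / sin (a / 2)) with (- (cos (a / 2) / sin (a / 2))) by (unfold Rdiv; ring).
  rewrite Ropp_mult_distr_r_reverse, atan_opp. ring.
Qed.

(** Partial fractions applied to cosh t - cos a = 2 (cosh (t/2) - cos (a/2)) (cosh (t/2) + cos
    (a/2)), with sin a = 2 sin (a/2) cos (a/2). For t <> 0 no denominator vanishes, whatever the
    angle. *)
Lemma poisson_kernel_duplication a t : t <> 0 ->
  2 * poisson_kernel a t = poisson_kernel (a / 2) (t / 2) + poisson_kernel (a / 2 + PI) (t / 2).
Proof.
  intros Ht. unfold poisson_kernel. rewrite neg_sin, neg_cos.
  destruct (sin_cos_half a) as (E & E2 & E1).
  assert (HE : exp t = exp (t / 2) ^ 2).
  { replace t with (t / 2 + t / 2) at 1 by field. rewrite exp_plus. ring. }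
  assert (H1 := cosh_gt_1 (t / 2) ltac:(lra)). assert (H2 := cosh_gt_1 t Ht).
  rewrite !exp_Ropp in *. assert (He := exp_pos (t / 2)).
  rewrite E, E2, HE in *.
  assert (Hc := COS_bound (a / 2)).
  set (e := exp (t / 2)) in *. set (s := sin (a / 2)) in *. set (c := cos (a / 2)) in *.
  assert (Hd1 : e * e + 1 - 2 * c * e <> 0).
  { apply Rgt_not_eq. replace (e * e + 1 - 2 * c * e) with ((e + / e - 2 * c) * e) by (field; lra).
    apply Rmult_gt_0_compat; lra. }
  assert (Hd2 : e * e + 1 + 2 * c * e <> 0).
  { apply Rgt_not_eq. replace (e * e + 1 + 2 * c * e) with ((e + / e + 2 * c) * e) by (field; lra).
    apply Rmult_gt_0_compat; lra. }
  replace (c ^ 2 - s ^ 2) with (2 * c ^ 2 - 1) by lra.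
  assert (Hd3 : e ^ 2 + / e ^ 2 - 2 * (2 * c ^ 2 - 1) =
    (e * e + 1 - 2 * c * e) * (e * e + 1 + 2 * c * e) / e ^ 2) by (field; lra).
  rewrite Hd3. field. repeat split; try lra; intros Z;
    (apply Hd2; rewrite <- Z; ring) || (apply Hd1; rewrite <- Z; ring).
Qed.

(** The angle of index k at level n splits into the angles of index k and 2^n + k at level n + 1:
    adding PI after halving amounts to adding 2 PI 2^n before dividing by 2^(n+1). *)
Lemma poisson_kernel_multiplication a t n : t <> 0 ->
  2 ^ n * poisson_kernel a t = rsum (fun k => poisson_kernel ((a + 2 * PI * INR k) / 2 ^ n) (t / 2 ^ n)) (2 ^ n).
Proof.
  intros Ht. induction n as [|n IH].
  - simpl. rewrite Rmult_0_r, Rplus_0_r, !Rdiv_1_r. ring.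
  - assert (Hn : 0 < 2 ^ n) by (apply pow_lt; lra).
    replace (2 ^ S n * poisson_kernel a t) with (2 * (2 ^ n * poisson_kernel a t)) by (simpl; ring).
    rewrite IH, <- rsum_scal.
    replace (2 ^ S n)%nat with (2 ^ n + 2 ^ n)%nat by (simpl; lia).
    rewrite rsum_add, <- rsum_plus. apply rsum_ext. intros k _.
    rewrite poisson_kernel_duplication.
    + replace (INR (2 ^ n + k)) with (2 ^ n + INR k) by (rewrite plus_INR, pow_INR; reflexivity).
      replace (t / 2 ^ S n) with (t / 2 ^ n / 2) by (simpl; field; lra).
      f_equal; apply (f_equal (fun a => poisson_kernel a (t / 2 ^ n / 2))); simpl; field; lra.
    + apply Rmult_integral_contrapositive. split; auto. apply Rinv_neq_0_compat. lra.
Qed.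

(** With [pole2], the poles i y, y > 0, of the kernel at a = 2 PI / 3: on the imaginary axis cosh
    becomes cos, and these are the solutions of cos y = -1/2. *)
Definition pole1 (k : nat) : R := 2 * PI * (INR k + 1 / 3).
Definition pole2 (k : nat) : R := 2 * PI * (INR k + 2 / 3).

Lemma pole1_pos k : 0 < pole1 k.
Proof. unfold pole1. generalize PI_RGT_0 (pos_INR k). nra. Qed.

Lemma pole_lt k : pole1 k < pole2 k.
Proof. unfold pole1, pole2. generalize PI_RGT_0. nra. Qed.

Lemma pole2_lt k n : (k < n)%nat -> pole2 k / (2 * INR n) < PI.
Proof.
  intros H. assert (Hn : INR k + 1 <= INR n) by (rewrite <- S_INR; now apply le_INR).
  assert (Hk := pos_INR k). assert (HP := PI_RGT_0).
  apply Rmult_lt_reg_r with (2 * INR n); [lra|].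
  unfold Rdiv. rewrite Rmult_assoc, Rinv_l, Rmult_1_r by lra.
  unfold pole2. nra.
Qed.

Lemma pole1_half_pos k n : (k < n)%nat -> 0 < pole1 k / (2 * INR n).
Proof.
  intros H. assert (0 < INR n) by (apply lt_0_INR; lia).
  apply Rdiv_lt_0_compat; [apply pole1_pos|lra].
Qed.

Lemma pole_half_lt k n : (k < n)%nat -> pole1 k / (2 * INR n) < pole2 k / (2 * INR n).
Proof.
  intros H. assert (0 < INR n) by (apply lt_0_INR; lia).
  apply Rmult_lt_compat_r; [apply Rinv_0_lt_compat; lra|apply pole_lt].
Qed.

(** Integrated multiplication formula at level n + 1. Of its 2 * 2^n angles the lower half gives the
    [pole1] terms; the upper half, read backwards, consists of 2 PI minus the [pole2] angles and
    changes sign by reflection. *)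
Lemma poisson_primitive_multiplication n T : 0 <= T ->
  poisson_primitive (2 * PI / 3) T = rsum (fun k =>
    poisson_primitive (pole1 k / (2 * INR (2 ^ n))) (T / (2 * INR (2 ^ n))) -
    poisson_primitive (pole2 k / (2 * INR (2 ^ n))) (T / (2 * INR (2 ^ n)))) (2 ^ n).
Proof.
  intros HT. set (h := (2 ^ n)%nat). assert (Hh : (1 <= h)%nat) by (apply Nat.neq_0_lt_0, Nat.pow_nonzero; lia).
  assert (HM : 2 ^ S n = 2 * INR h) by (unfold h; rewrite pow_INR; reflexivity).
  assert (Hh0 : 1 <= INR h) by (apply (le_INR 1); lia).
  set (M := 2 * INR h) in *. assert (HP := PI_RGT_0).
  set (al := fun k => (2 * PI / 3 + 2 * PI * INR k) / M).
  assert (Hal : forall k, (k < h + h)%nat -> 0 < al k < 2 * PI).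
  { intros k Hk. assert (INR k + 1 <= M).
    { unfold M. replace (2 * INR h) with (INR h + INR h) by ring. rewrite <- S_INR, <- plus_INR. apply le_INR. lia. }
    assert (H0 := pos_INR k). unfold al. split.
    - apply Rdiv_lt_0_compat; [nra|unfold M; lra].
    - apply Rmult_lt_reg_r with M; [unfold M; lra|].
      unfold Rdiv at 1. rewrite Rmult_assoc, Rinv_l, Rmult_1_r by (unfold M; lra). nra. }
  assert (Hd : forall k, (k < h + h)%nat -> forall c,
     is_derive (fun t => poisson_primitive (al k) (t / M)) c (/ M * poisson_kernel (al k) (c / M))).
  { intros k Hk c. apply (is_derive_comp (poisson_primitive (al k)) (fun t => t / M)).
    - apply is_derive_poisson_primitive. apply Rgt_not_eq, sin_half_pos, Hal, Hk.
    - auto_derive; [auto|]. unfold Rdiv. ring. }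
  assert (E : poisson_primitive (2 * PI / 3) T = rsum (fun k => poisson_primitive (al k) (T / M)) (h + h)).
  { assert (E := increment_eq_of_derive (poisson_primitive (2 * PI / 3)) (poisson_kernel (2 * PI / 3))
      (fun t => rsum (fun k => poisson_primitive (al k) (t / M)) (h + h))
      (fun t => rsum (fun k => / M * poisson_kernel (al k) (t / M)) (h + h)) 0 T HT).
    rewrite poisson_primitive_0 in E. rewrite (rsum_ext (fun k => poisson_primitive (al k) (0 / M)) (fun _ => 0) (h + h)) in E.
    - rewrite rsum_const, Rmult_0_r, !Rminus_0_r in E. apply E.
      + intros c _. apply is_derive_poisson_primitive. apply Rgt_not_eq, sin_half_pos. lra.
      + intros c _. apply (is_derive_rsum (fun k t => poisson_primitive (al k) (t / M))
          (fun k t => / M * poisson_kernel (al k) (t / M))). intros k Hk. now apply Hd.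
      (* The derivatives are compared on the open interval only, so c <> 0 as the multiplication
         formula for the kernel requires. *)
      + intros c Hc. rewrite rsum_scal. apply Rmult_eq_reg_l with M; [|unfold M; lra].
        rewrite <- Rmult_assoc, Rinv_r, Rmult_1_l by (unfold M; lra).
        rewrite <- HM. rewrite poisson_kernel_multiplication by lra.
        replace (2 ^ S n)%nat with (h + h)%nat by (unfold h; simpl; lia).
        apply rsum_ext. intros k _. unfold al. now rewrite HM.
    - intros k _. unfold Rdiv. rewrite Rmult_0_l. apply poisson_primitive_0. }
  rewrite E, rsum_add, (rsum_rev (fun k => poisson_primitive (al (h + k)%nat) (T / M))), <- rsum_plus.
  apply rsum_ext. intros k Hk. unfold Rminus. f_equal.
  - f_equal. unfold al, pole1, Rdiv. ring.
  - rewrite <- poisson_primitive_reflect. f_equal. unfold al, pole2.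
    rewrite plus_INR, minus_INR, S_INR by lia. unfold M. field. lra.
Qed.

(** * Comparison with the inverse tangent integral *)

(** Each bound comes from the previous one by integrating from 0. The lower chain starts from cosh
    >= 1, the upper one from exp t + exp (- t) <= 4 on [0, 1], which is e <= 3. *)
Lemma cosh_sinh_bounds T : 0 <= T <= 1 ->
  2 * T <= exp T - exp (- T) <= 2 * T + 2 * T ^ 3 /\
  2 + T ^ 2 <= exp T + exp (- T) <= 2 + T ^ 2 + T ^ 4 / 6.
Proof.
  assert (Dsh : forall c, is_derive (fun t => exp t - exp (- t)) c (exp c + exp (- c))) by (intros c; auto_derive; [auto|ring]).
  assert (Dch : forall c, is_derive (fun t => exp t + exp (- t)) c (exp c - exp (- c))) by (intros c; auto_derive; [auto|ring]).
  assert (L1 : forall t, 0 <= t -> 2 <= exp t + exp (- t)).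
  { intros t Ht. destruct (Req_EM_T t 0) as [-> | E].
    - rewrite Ropp_0, exp_0. lra.
    - generalize (cosh_gt_1 t E). lra. }
  assert (L2 : forall t, 0 <= t -> 2 * t <= exp t - exp (- t)).
  { intros t Ht. assert (H := increment_le_of_derive (fun t => 2 * t) (fun _ => 2) _ _ 0 t Ht
      ltac:(intros; auto_derive; [auto|ring]) (fun c _ => Dsh c) ltac:(intros c Hc; apply L1; lra)).
    cbv beta in H. rewrite Ropp_0, exp_0 in H. lra. }
  assert (L3 : forall t, 0 <= t -> 2 + t ^ 2 <= exp t + exp (- t)).
  { intros t Ht. assert (H := increment_le_of_derive (fun t => t ^ 2) (fun t => 2 * t) _ _ 0 t Ht
      ltac:(intros; auto_derive; [auto|ring]) (fun c _ => Dch c) ltac:(intros c Hc; apply L2; lra)).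
    cbv beta in H. rewrite Ropp_0, exp_0 in H. lra. }
  assert (U1 : forall t, 0 <= t <= 1 -> exp t + exp (- t) <= 4).
  { intros t Ht. assert (exp t <= exp 1).
    { destruct (proj2 Ht) as [H | ->]; [left; now apply exp_increasing|lra]. }
    assert (exp (- t) <= 1).
    { rewrite <- exp_0. destruct (proj1 Ht) as [H1 | <-]; [left; apply exp_increasing; lra|rewrite Ropp_0; lra]. }
    generalize exp_le_3. lra. }
  assert (U2 : forall t, 0 <= t <= 1 -> exp t - exp (- t) <= 4 * t).
  { intros t Ht. assert (H := increment_le_of_derive _ _ (fun t => 4 * t) (fun _ => 4) 0 t (proj1 Ht)
      (fun c _ => Dsh c) ltac:(intros; auto_derive; [auto|ring]) ltac:(intros c Hc; apply U1; lra)).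
    cbv beta in H. rewrite Ropp_0, exp_0 in H. lra. }
  assert (U3 : forall t, 0 <= t <= 1 -> exp t + exp (- t) <= 2 + 2 * t ^ 2).
  { intros t Ht. assert (H := increment_le_of_derive _ _ (fun t => 2 * t ^ 2) (fun t => 4 * t) 0 t (proj1 Ht)
      (fun c _ => Dch c) ltac:(intros; auto_derive; [auto|ring]) ltac:(intros c Hc; apply U2; lra)).
    cbv beta in H. rewrite Ropp_0, exp_0 in H. lra. }
  assert (U4 : forall t, 0 <= t <= 1 -> exp t - exp (- t) <= 2 * t + 2 / 3 * t ^ 3).
  { intros t Ht. assert (H := increment_le_of_derive _ _ (fun t => 2 * t + 2 / 3 * t ^ 3) (fun t => 2 + 2 * t ^ 2) 0 t (proj1 Ht)
      (fun c _ => Dsh c) ltac:(intros; auto_derive; [auto|field]) ltac:(intros c Hc; apply U3; lra)).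
    cbv beta in H. rewrite Ropp_0, exp_0 in H. lra. }
  assert (U5 : forall t, 0 <= t <= 1 -> exp t + exp (- t) <= 2 + t ^ 2 + t ^ 4 / 6).
  { intros t Ht. assert (H := increment_le_of_derive _ _ (fun t => t ^ 2 + t ^ 4 / 6) (fun t => 2 * t + 2 / 3 * t ^ 3) 0 t (proj1 Ht)
      (fun c _ => Dch c) ltac:(intros; auto_derive; [auto|field]) ltac:(intros c Hc; apply U4; lra)).
    cbv beta in H. rewrite Ropp_0, exp_0 in H. lra. }
  intros HT. assert (0 <= T ^ 3) by (apply pow_le; lra).
  split; split; auto.
  - apply L2; lra.
  - specialize (U4 T HT). lra.
  - apply L3; lra.
Qed.

Lemma cos_taylor_bounds a : 0 <= a -> 1 - a ^ 2 / 2 <= cos a <= 1 - a ^ 2 / 2 + a ^ 4 / 24.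
Proof.
  assert (L1 : forall t, 0 <= t -> sin t <= t).
  { intros t Ht. assert (H := increment_le_of_derive sin cos (fun t => t) (fun _ => 1) 0 t Ht
      (fun c _ => is_derive_sin c) ltac:(intros; auto_derive; [auto|ring]) ltac:(intros c Hc; apply COS_bound)).
    cbv beta in H. rewrite sin_0 in H. lra. }
  assert (L2 : forall t, 0 <= t -> 1 - t ^ 2 / 2 <= cos t).
  { intros t Ht. assert (H := increment_le_of_derive (fun t => - t ^ 2 / 2) (fun t => - t) cos (fun t => - sin t) 0 t Ht
      ltac:(intros; auto_derive; [auto|field]) (fun c _ => is_derive_cos c) ltac:(intros c Hc; generalize (L1 c); lra)).
    cbv beta in H. rewrite cos_0 in H. lra. }
  assert (L3 : forall t, 0 <= t -> t - t ^ 3 / 6 <= sin t).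
  { intros t Ht. assert (H := increment_le_of_derive (fun t => t - t ^ 3 / 6) (fun t => 1 - t ^ 2 / 2) sin cos 0 t Ht
      ltac:(intros; auto_derive; [auto|field]) (fun c _ => is_derive_sin c) ltac:(intros c Hc; apply L2; lra)).
    cbv beta in H. rewrite sin_0 in H. lra. }
  intros Ha. split; [now apply L2|].
  assert (H := increment_le_of_derive cos (fun t => - sin t) (fun t => - t ^ 2 / 2 + t ^ 4 / 24) (fun t => - (t - t ^ 3 / 6)) 0 a Ha
    (fun c _ => is_derive_cos c) ltac:(intros; auto_derive; [auto|field]) ltac:(intros c Hc; generalize (L3 c); lra)).
  cbv beta in H. rewrite cos_0 in H. lra.
Qed.

(** The quartic bound makes cos (8/5) negative, so 8/5 lies beyond PI / 2. This precision keeps 1 -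
    a^2 / 12 above 1/7 for a < PI, which the bound PI <= 4 would not. *)
Lemma PI_lt_16_5 : PI < 16 / 5.
Proof.
  assert (H := cos_taylor_bounds (8 / 5) ltac:(lra)).
  destruct (Rlt_or_le (PI / 2) (8 / 5)) as [L | L]; [lra|].
  assert (0 <= cos (8 / 5)) by (apply cos_ge_0; lra). lra.
Qed.

(** With W = T^2 + a^2 and D the denominator of the first fraction, the combined numerator is at
    most 3 T W^2 while D W >= W^2 / 7; hence 21 T. The bound is uniform as a -> 0, where both
    fractions are large. *)
Lemma poisson_primitive_angle_derivative_bound a T : 0 < a < PI -> 0 < T <= 1 ->
  Rabs (- ((exp T - exp (- T)) / (exp T + exp (- T) - 2 * cos a)) + 2 * T / (T ^ 2 + a ^ 2)) <= 21 * T.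
Proof.
  intros Ha HT. destruct (cosh_sinh_bounds T ltac:(lra)) as [Hs Hc].
  assert (Hcos := cos_taylor_bounds a ltac:(lra)). assert (HP := PI_lt_16_5).
  set (sh := exp T - exp (- T)) in *. set (ch := exp T + exp (- T)) in *.
  set (W := T ^ 2 + a ^ 2).
  assert (HT2 : 0 < T ^ 2) by (apply pow_lt; lra). assert (Ha2 : 0 < a ^ 2) by (apply pow_lt; lra).
  assert (Ha2' : a ^ 2 <= 256 / 25) by nra.
  assert (HD : W / 7 <= ch - 2 * cos a).
  { unfold W. assert (a ^ 4 = a ^ 2 * a ^ 2) by ring. nra. }
  assert (HW : 0 < W) by (unfold W; lra).
  set (D := ch - 2 * cos a) in *.
  assert (HDW : Rabs (D - W) <= W ^ 2 / 6).
  { assert (a ^ 4 = a ^ 2 * a ^ 2) by ring. assert (T ^ 4 = T ^ 2 * T ^ 2) by ring.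
    apply Rabs_le. unfold D, W. split; nra. }
  assert (HsT : 0 <= sh - 2 * T <= 2 * T * W).
  { assert (T ^ 3 = T * T ^ 2) by ring. unfold W. split; nra. }
  replace (- (sh / D) + 2 * T / W) with ((2 * T * (D - W) - (sh - 2 * T) * W) * / (D * W)) by (field; lra).
  rewrite Rabs_mult, (Rabs_right (/ (D * W))).
  2: { left. apply Rinv_0_lt_compat. nra. }
  apply Rmult_le_reg_r with (D * W); [nra|].
  rewrite Rmult_assoc, Rinv_l, Rmult_1_r by nra.
  assert (Rabs (2 * T * (D - W) - (sh - 2 * T) * W) <= 3 * T * W ^ 2).
  { apply Rabs_le_between in HDW. apply Rabs_le.
    assert (0 <= (sh - 2 * T) * W <= 2 * T * W ^ 2) by (split; nra).
    assert (- (T * W ^ 2 / 3) <= 2 * T * (D - W) <= T * W ^ 2 / 3) by (split; nra).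
    assert (0 < T * W ^ 2) by (apply Rmult_lt_0_compat; nra). split; nra. }
  assert (T * W * (W / 7) <= T * W * D) by (apply Rmult_le_compat_l; nra).
  nra.
Qed.

(** The fraction added in the previous bound is minus the derivative of 2 atan (T/a) in a. A bound
    at each angle would be of order T, too large once 2^n terms are added; the increment over a pair
    gains the factor b - a, itself of order 2^-n. *)
Lemma poisson_primitive_atan_lipschitz a b T : 0 < a <= b -> b < PI -> 0 < T <= 1 ->
  Rabs ((poisson_primitive b T - 2 * atan (T / b)) - (poisson_primitive a T - 2 * atan (T / a))) <= 21 * T * (b - a).
Proof.
  intros Hab Hb HT.
  replace (21 * T * (b - a)) with (21 * T * b - 21 * T * a) by ring.
  apply (Rabs_increment_le_of_derive (fun a => poisson_primitive a T - 2 * atan (T / a))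
    (fun a => - ((exp T - exp (- T)) / (exp T + exp (- T) - 2 * cos a)) + 2 * T / (T ^ 2 + a ^ 2))
    (fun a => 21 * T * a) (fun _ => 21 * T)); [lra| | |].
  - intros c Hc.
    replace (- ((exp T - exp (- T)) / (exp T + exp (- T) - 2 * cos c)) + 2 * T / (T ^ 2 + c ^ 2))
      with (- ((exp T - exp (- T)) / (exp T + exp (- T) - 2 * cos c)) - (- (2 * T / (T ^ 2 + c ^ 2)))) by ring.
    apply (is_derive_minus (fun a => poisson_primitive a T) (fun a => 2 * atan (T / a))).
    + apply is_derive_poisson_primitive_angle. apply Rgt_not_eq, sin_half_pos. lra.
    + auto_derive; [lra|]. field. nra.
  - intros c Hc. auto_derive; [auto|ring].
  - intros c Hc. apply poisson_primitive_angle_derivative_bound; lra.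
Qed.

(** * The inverse tangent integral: inversion, head and tail of the sum over poles *)

Definition Ti (x : R) : R := logint atan x.

Lemma log_integrable_atan : log_integrable atan.
Proof. split; [apply atan_0|]. intros t. eexists. apply is_derive_atan. Qed.

Lemma log_integrable_atan_div p : log_integrable (fun t => atan (t / p)).
Proof.
  destruct (log_integrable_comp atan (/ p) log_integrable_atan) as [H1 H2].
  split.
  - unfold Rdiv. rewrite Rmult_0_l. apply atan_0.
  - intros t. apply ex_derive_ext with (fun t => atan (/ p * t)); auto.
    intros u. f_equal. unfold Rdiv. ring.
Qed.

Lemma logint_atan_div p X : 0 < p -> 0 <= X -> logint (fun t => atan (t / p)) X = Ti (X / p).
Proof.
  intros Hp HX. unfold Ti. replace (X / p) with (/ p * X) by (unfold Rdiv; ring).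
  rewrite <- logint_comp; auto using log_integrable_atan, Rinv_0_lt_compat.
  apply logint_ext; auto. intros t _. f_equal. unfold Rdiv. ring.
Qed.

Lemma atan_nonneg x : 0 <= x -> 0 <= atan x.
Proof. intros [H | <-]; [left; rewrite <- atan_0; now apply atan_increasing|rewrite atan_0; lra]. Qed.

Lemma atan_le_id x : 0 <= x -> atan x <= x.
Proof.
  intros Hx. assert (H := increment_le_of_derive atan (fun t => / (1 + t ^ 2)) (fun t => t) (fun _ => 1) 0 x Hx).
  rewrite atan_0 in H. assert (E : atan x - 0 <= x - 0); [|lra]. apply H.
  - intros c _. apply is_derive_Reals, derivable_pt_lim_atan.
  - intros c _. auto_derive; [auto|ring].
  - intros c Hc. rewrite <- Rinv_1. apply Rinv_le_contravar; nra.
Qed.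

Lemma Ti_increment x y : 0 < x <= y -> 0 <= Ti y - Ti x <= y - x.
Proof.
  intros Hxy.
  assert (HD : forall c, x <= c <= y -> is_derive Ti c (atan c / c))
    by (intros c Hc; apply is_derive_logint; [lra|apply log_integrable_atan]).
  split.
  - assert (H := nondecreasing_of_derive Ti _ x y ltac:(lra) HD).
    assert (Ti x <= Ti y); [|lra]. apply H. intros c Hc.
    apply Rdiv_le_0_compat; [apply atan_nonneg; lra|lra].
  - apply (increment_le_of_derive Ti _ (fun t => t) (fun _ => 1) x y ltac:(lra) HD).
    + intros c _. auto_derive; [auto|ring].
    + intros c Hc. apply Rle_div_l; [lra|]. rewrite Rmult_1_l. apply atan_le_id. lra.
Qed.

Lemma Ti_bounds x : 0 <= x -> 0 <= Ti x <= x.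
Proof.
  intros Hx. split.
  - rewrite <- (Rmult_0_l x). unfold Ti.
    rewrite <- (logint_id x Hx) at 1. rewrite <- logint_scal by auto using log_integrable_id.
    apply logint_le; auto using log_integrable_scal, log_integrable_id, log_integrable_atan.
    intros t Ht. rewrite Rmult_0_l. apply atan_nonneg. lra.
  - rewrite <- (logint_id x Hx) at 2. unfold Ti.
    apply logint_le; auto using log_integrable_id, log_integrable_atan.
    intros t Ht. apply atan_le_id. lra.
Qed.

(** By atan c + atan (1/c) = PI / 2 both sides have derivative (PI / 2) / c, and both vanish at
    1. *)
Lemma Ti_inversion x : 0 < x -> Ti x - Ti (/ x) = PI / 2 * ln x.
Proof.
  assert (HD : forall c, 0 < c -> is_derive (fun x => Ti x - Ti (/ x)) c (PI / 2 / c)).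
  { intros c Hc.
    replace (PI / 2 / c) with (atan c / c - (- / c ^ 2) * (atan (/ c) / / c))
      by (rewrite atan_inv by auto; field; lra).
    apply (is_derive_minus Ti (fun x => Ti (/ x))).
    - apply is_derive_logint; auto using log_integrable_atan.
    - apply (is_derive_comp Ti (fun x => / x)).
      + apply is_derive_logint; auto using log_integrable_atan, Rinv_0_lt_compat.
      + auto_derive; [lra|]. field. lra. }
  assert (HL : forall c, 0 < c -> is_derive (fun x => PI / 2 * ln x) c (PI / 2 / c)).
  { intros c Hc. auto_derive; [auto|]. field. lra. }
  intros Hx. destruct (Rle_or_lt 1 x) as [L | L].
  - assert (H := increment_eq_of_derive _ _ _ _ 1 x L (fun c Hc => HD c ltac:(lra)) (fun c Hc => HL c ltac:(lra)) ltac:(reflexivity)).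
    cbv beta in H. rewrite Rinv_1, ln_1 in H. lra.
  - assert (H := increment_eq_of_derive _ _ _ _ x 1 (Rlt_le _ _ L) (fun c Hc => HD c ltac:(lra)) (fun c Hc => HL c ltac:(lra)) ltac:(reflexivity)).
    cbv beta in H. rewrite Rinv_1, ln_1 in H. lra.
Qed.

(** [X <= INR (2 ^ n)] puts the rescaled variable t / (2 * 2^n) in (0, 1], where the comparison with
    atan applies. The 2^n pairs contribute (7 PI / 2) t / 2^n in all, and PI <= 4 gives 14. *)
Lemma logint_poisson_primitive_approx n X : 0 <= X <= INR (2 ^ n) ->
  Rabs (logint (poisson_primitive (2 * PI / 3)) X -
        rsum (fun k => 2 * (Ti (X / pole1 k) - Ti (X / pole2 k))) (2 ^ n)) <= 14 * X / INR (2 ^ n).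
Proof.
  intros HX. set (h := (2 ^ n)%nat) in *. assert (HP := PI_RGT_0).
  assert (Hh0 : (1 <= h)%nat) by (apply Nat.neq_0_lt_0, Nat.pow_nonzero; lia).
  assert (Hh : 1 <= INR h) by (apply (le_INR 1); lia).
  assert (Hpi : log_integrable (poisson_primitive (2 * PI / 3))).
  { apply log_integrable_poisson_primitive, Rgt_not_eq, sin_half_pos. lra. }
  assert (Hk : forall k, log_integrable (fun t => 2 * (atan (t / pole1 k) - atan (t / pole2 k)))).
  { intros k. apply log_integrable_scal, log_integrable_minus; apply log_integrable_atan_div. }
  rewrite <- (rsum_ext (fun k => logint (fun t => 2 * (atan (t / pole1 k) - atan (t / pole2 k))) X)).
  2: { intros k _. assert (H1 := pole1_pos k). assert (H2 := pole_lt k).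
       rewrite (logint_scal 2 (fun t => atan (t / pole1 k) - atan (t / pole2 k)))
         by (try apply log_integrable_minus; try apply log_integrable_atan_div; lra).
       rewrite logint_minus by (try apply log_integrable_atan_div; lra).
       rewrite !logint_atan_div by lra. reflexivity. }
  rewrite <- logint_rsum, <- logint_minus by (auto using log_integrable_rsum; lra).
  replace (14 * X / INR h) with (14 / INR h * X) by (unfold Rdiv; ring).
  apply Rabs_logint_le; [lra|auto using log_integrable_minus, log_integrable_rsum|].
  intros t Ht. rewrite (poisson_primitive_multiplication n) by lra. fold h. rewrite <- rsum_minus.
  apply Rle_trans with (rsum (fun k => 21 * (t / (2 * INR h)) * (pole2 k / (2 * INR h) - pole1 k / (2 * INR h))) h).
  - apply Rabs_rsum_le. intros k Hkh.
    assert (H1 := pole1_half_pos k h Hkh). assert (H2 := pole_half_lt k h Hkh). assert (H3 := pole2_lt k h Hkh).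
    assert (HT : 0 < t / (2 * INR h) <= 1).
    { split; [apply Rdiv_lt_0_compat; lra|]. apply Rle_div_l; lra. }
    assert (H := poisson_primitive_atan_lipschitz _ _ _ (conj H1 (Rlt_le _ _ H2)) H3 HT).
    assert (E : forall p, 0 < p -> t / (2 * INR h) / (p / (2 * INR h)) = t / p) by (intros p Hp; field; lra).
    rewrite !E in H by (generalize (pole1_pos k) (pole_lt k); lra).
    rewrite <- Rabs_Ropp. eapply Rle_trans; [|exact H]. right. f_equal. ring.
  - rewrite (rsum_ext _ (fun _ => 21 * (t / (2 * INR h)) * (2 * PI / 3 / (2 * INR h)))).
    + rewrite rsum_const.
      replace (INR h * (21 * (t / (2 * INR h)) * (2 * PI / 3 / (2 * INR h)))) with (7 / 2 * PI * (t / INR h)) by (field; lra).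
      replace (14 / INR h * t) with (14 * (t / INR h)) by (field; lra).
      assert (0 < t / INR h) by (apply Rdiv_lt_0_compat; lra).
      generalize PI_4. nra.
    + intros k _. unfold pole1, pole2. field. lra.
Qed.

(** Inversion turns Ti (X/p) into a logarithm plus Ti (p/X). Within a pair ln X cancels, and the two
    remainders differ by at most (q_k - p_k) / X <= 3 / X. *)
Lemma Ti_head X N : 0 < X ->
  Rabs (rsum (fun k => 2 * (Ti (X / pole1 k) - Ti (X / pole2 k))) N -
        PI * rsum (fun k => ln (pole2 k) - ln (pole1 k)) N) <= 6 * INR N / X.
Proof.
  intros HX. rewrite <- rsum_scal, <- rsum_minus.
  replace (6 * INR N / X) with (INR N * (6 / X)) by (unfold Rdiv; ring).
  rewrite <- rsum_const. apply Rabs_rsum_le. intros k _.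
  assert (H1 := pole1_pos k). assert (H2 := pole_lt k).
  assert (E : forall p, 0 < p -> Ti (X / p) = PI / 2 * (ln X - ln p) + Ti (p / X)).
  { intros p Hp. rewrite <- ln_div by lra. rewrite <- Ti_inversion by (apply Rdiv_lt_0_compat; lra).
    replace (/ (X / p)) with (p / X) by (field; lra). ring. }
  rewrite !E by lra.
  match goal with |- Rabs ?x <= _ => replace x with (- (2 * (Ti (pole2 k / X) - Ti (pole1 k / X)))) by field end.
  assert (Hi : 0 < pole1 k / X <= pole2 k / X).
  { split; [apply Rdiv_lt_0_compat; lra|]. apply Rmult_le_compat_r; [left; now apply Rinv_0_lt_compat|lra]. }
  assert (H := Ti_increment _ _ Hi).
  assert (E2 : pole2 k / X - pole1 k / X = 2 * PI / 3 / X) by (unfold pole1, pole2; field; lra).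
  rewrite E2 in H. rewrite Rabs_Ropp, Rabs_right by lra.
  assert (HP := PI_4). assert (2 * PI / 3 / X <= 3 / X).
  { apply Rmult_le_compat_r; [left; now apply Rinv_0_lt_compat|lra]. }
  unfold Rdiv in *. lra.
Qed.

(** Convexity of y -> Ti (X/y), whose derivative - atan (X/y) / y is increasing, phrased as
    decrements over steps of equal length. *)
Lemma Ti_div_convex X h x y : 0 < X -> 0 < h -> 0 < x <= y ->
  Ti (X / y) - Ti (X / (y + h)) <= Ti (X / x) - Ti (X / (x + h)).
Proof.
  intros HX Hh Hxy.
  assert (HD : forall c, 0 < c -> is_derive (fun y => Ti (X / y)) c (- (atan (X / c) / c))).
  { intros c Hc. replace (- (atan (X / c) / c)) with ((- X / c ^ 2) * (atan (X / c) / (X / c))) by (field; lra).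
    apply (is_derive_comp Ti (fun y => X / y)).
    - apply is_derive_logint; auto using log_integrable_atan, Rdiv_lt_0_compat.
    - auto_derive; [lra|]. field. lra. }
  assert (HDh : forall c, 0 < c -> is_derive (fun y => Ti (X / (y + h))) c (- (atan (X / (c + h)) / (c + h)))).
  { intros c Hc. replace (- (atan (X / (c + h)) / (c + h))) with (1 * - (atan (X / (c + h)) / (c + h))) by ring.
    apply (is_derive_comp (fun y => Ti (X / y)) (fun y => y + h)).
    - apply HD. lra.
    - auto_derive; [auto|ring]. }
  assert (H := increment_le_of_derive (fun y => Ti (X / y)) _ (fun y => Ti (X / (y + h))) _ x y (proj2 Hxy)
    (fun c Hc => HD c ltac:(lra)) (fun c Hc => HDh c ltac:(lra))).
  cbv beta in H. assert (E : Ti (X / y) - Ti (X / x) <= Ti (X / (y + h)) - Ti (X / (x + h))); [|lra].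
  apply H. intros c Hc. apply Ropp_le_contravar.
  apply Rmult_le_compat.
  - apply atan_nonneg. left. apply Rdiv_lt_0_compat; lra.
  - left. apply Rinv_0_lt_compat. lra.
  - left. apply atan_increasing. apply Rmult_lt_compat_l; auto. apply Rinv_lt_contravar; nra.
  - left. apply Rinv_lt_contravar; nra.
Qed.

Lemma ln_le_sub_1 x : 0 < x -> ln x <= x - 1.
Proof.
  intros Hx. destruct (Req_EM_T (ln x) 0) as [E | E].
  - assert (x = 1) by (apply ln_inv; try lra; now rewrite ln_1). lra.
  - generalize (exp_ineq1 (ln x) E). rewrite exp_ln; lra.
Qed.

(** Three steps of length 2 PI / 3 make one period 2 PI. Convexity encloses three times each pair
    between decrements over whole periods, which telescope. The near end is evaluated by inversion,
    the far end costs at most X / h, and 2 / N absorbs the replacement of the end poles by 2 PI N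
    inside the logarithm. *)
Lemma Ti_tail X N h : 0 < X -> (1 <= N <= h)%nat ->
  Rabs (rsum (fun k => 2 * (Ti (X / pole1 (N + k)) - Ti (X / pole2 (N + k)))) (h - N) -
        PI / 3 * (ln X - ln (2 * PI * INR N))) <= X / INR h + 2 / INR N + 6 * INR N / X.
Proof.
  intros HX HN. set (m := (h - N)%nat).
  set (r := fun y => Ti (X / y)).
  assert (HP := PI_RGT_0). assert (HP4 := PI_4). assert (HP3 : 3 < PI) by (generalize PI2_3_2; lra).
  assert (HNr : 1 <= INR N) by (apply (le_INR 1); lia).
  assert (HNh : INR N <= INR h) by (apply le_INR; lia).
  set (d := 2 * PI / 3).
  (* The pair is the first third of the period that starts at [pole1 (N + k)], so it has the largest
     of the three decrements. *)
  assert (Hlow : rsum (fun k => r (pole1 (N + k)) - r (pole1 (N + S k))) m <=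
                 rsum (fun k => 3 * (r (pole1 (N + k)) - r (pole2 (N + k)))) m).
  { apply rsum_le. intros k _. assert (H1 := pole1_pos (N + k)).
    assert (Hd := fun x y => Ti_div_convex X d x y HX ltac:(unfold d; lra)).
    assert (A1 := Hd (pole1 (N + k)) (pole1 (N + k) + d) ltac:(unfold d; lra)).
    assert (A2 := Hd (pole1 (N + k)) (pole1 (N + k) + d + d) ltac:(unfold d; lra)).
    replace (pole1 (N + k) + d + d + d) with (pole1 (N + S k)) in *
      by (unfold pole1, d; rewrite Nat.add_succ_r, S_INR; field).
    replace (pole1 (N + k) + d) with (pole2 (N + k)) in * by (unfold pole1, pole2, d; field).
    unfold r. lra. }
  (* The pair is also the last third of the period that ends at [pole2 (N + k)]; N >= 1 keeps the
     left end of that period positive. *)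
  assert (Hup : rsum (fun k => 3 * (r (pole1 (N + k)) - r (pole2 (N + k)))) m <=
                 rsum (fun k => r (pole2 (N + k) - 2 * PI) - r (pole2 (N + S k) - 2 * PI)) m).
  { apply rsum_le. intros k _.
    assert (HNk : 1 <= INR (N + k)) by (apply (le_INR 1); lia).
    set (q := pole2 (N + k) - 2 * PI).
    assert (Hq : 0 < q) by (unfold q, pole2; nra).
    assert (Hd := fun x y => Ti_div_convex X d x y HX ltac:(unfold d; lra)).
    assert (A1 := Hd q (q + d) ltac:(unfold d; lra)).
    assert (A2 := Hd (q + d) (q + d + d) ltac:(unfold d; lra)).
    replace (pole2 (N + S k) - 2 * PI) with (q + d + d + d)
      by (unfold q, pole2, d; rewrite Nat.add_succ_r, S_INR; field).
    replace (pole2 (N + k)) with (q + d + d + d) by (unfold q, d; field).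
    replace (pole1 (N + k)) with (q + d + d) by (unfold q, d, pole1, pole2; field).
    unfold r. lra. }
  rewrite (rsum_telescope (fun k => r (pole1 (N + k)))) in Hlow.
  rewrite (rsum_telescope (fun k => r (pole2 (N + k) - 2 * PI))) in Hup.
  rewrite rsum_scal in Hlow, Hup. rewrite rsum_scal. fold (r (pole1 (N + 0))).
  change (rsum (fun k => Ti (X / pole1 (N + k)) - Ti (X / pole2 (N + k))) m)
    with (rsum (fun k => r (pole1 (N + k)) - r (pole2 (N + k))) m).
  set (s := rsum (fun k => r (pole1 (N + k)) - r (pole2 (N + k))) m) in *.
  rewrite Nat.add_0_r in Hlow, Hup.
  replace (N + m)%nat with h in Hlow, Hup by (unfold m; lia).
  assert (E : forall p, 0 < p -> r p = PI / 2 * (ln X - ln p) + Ti (p / X)).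
  { intros p Hp. unfold r. rewrite <- ln_div by lra. rewrite <- Ti_inversion by (apply Rdiv_lt_0_compat; lra).
    replace (/ (X / p)) with (p / X) by (field; lra). ring. }
  assert (B1 : r (pole1 h) <= X / INR h).
  { apply Rle_trans with (X / pole1 h).
    - apply Ti_bounds. left. apply Rdiv_lt_0_compat; [lra|apply pole1_pos].
    - apply Rmult_le_compat_l; [lra|]. apply Rinv_le_contravar; [lra|]. unfold pole1. nra. }
  assert (B2 : 0 <= r (pole2 h - 2 * PI)).
  { apply Ti_bounds. apply Rdiv_le_0_compat; [lra|]. unfold pole2. nra. }
  assert (HlN : 0 < 2 * PI * INR N) by nra.
  assert (B3 : ln (pole1 N) <= ln (2 * PI * INR N) + 1 / INR N).
  { assert (H := ln_le_sub_1 (pole1 N / (2 * PI * INR N)) ltac:(apply Rdiv_lt_0_compat; [apply pole1_pos|lra])).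
    rewrite ln_div in H by (try apply pole1_pos; lra).
    replace (pole1 N / (2 * PI * INR N) - 1) with (1 / INR N / 3) in H by (unfold pole1; field; lra).
    assert (0 < 1 / INR N) by (apply Rdiv_lt_0_compat; lra). lra. }
  assert (Hq : 0 < pole2 N - 2 * PI) by (unfold pole2; nra).
  assert (B4 : ln (2 * PI * INR N) <= ln (pole2 N - 2 * PI) + 1 / INR N).
  { assert (H := ln_le_sub_1 (2 * PI * INR N / (pole2 N - 2 * PI)) ltac:(apply Rdiv_lt_0_compat; lra)).
    rewrite ln_div in H by lra.
    assert (2 * PI * INR N / (pole2 N - 2 * PI) - 1 <= 1 / INR N); [|lra].
    replace (2 * PI * INR N / (pole2 N - 2 * PI) - 1) with (1 / (3 * INR N - 1)).
    - apply Rmult_le_compat_l; [lra|]. apply Rinv_le_contravar; lra.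
    - unfold pole2. field. split; nra. }
  assert (B5 : 0 <= Ti (pole1 N / X)).
  { apply Ti_bounds. apply Rdiv_le_0_compat; [left; apply pole1_pos|lra]. }
  assert (B6 : Ti ((pole2 N - 2 * PI) / X) <= 8 * (INR N / X)).
  { apply Rle_trans with ((pole2 N - 2 * PI) / X).
    - apply Ti_bounds. apply Rdiv_le_0_compat; lra.
    - replace (8 * (INR N / X)) with (8 * INR N / X) by (unfold Rdiv; ring).
      apply Rmult_le_compat_r; [left; now apply Rinv_0_lt_compat|]. unfold pole2. nra. }
  rewrite E in Hlow by apply pole1_pos. rewrite (E (pole2 N - 2 * PI)) in Hup by auto.
  assert (H1 : 0 < INR N / X) by (apply Rdiv_lt_0_compat; lra).
  assert (H2 : 0 < X / INR h) by (apply Rdiv_lt_0_compat; lra).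
  assert (H3 : 0 < 1 / INR N) by (apply Rdiv_lt_0_compat; lra).
  replace (2 / INR N) with (2 * (1 / INR N)) by (unfold Rdiv; ring).
  replace (6 * INR N / X) with (6 * (INR N / X)) by (unfold Rdiv; ring).
  apply Rabs_le. split; nra.
Qed.

(** The error is small in the regime 1 << N << X << 2^n: X decides where inversion is effective and
    N where convexity takes over. *)
Lemma logint_poisson_primitive_asymptotic n X N : 0 < X <= INR (2 ^ n) -> (1 <= N <= 2 ^ n)%nat ->
  Rabs (logint (poisson_primitive (2 * PI / 3)) X -
        (PI * rsum (fun k => ln (pole2 k) - ln (pole1 k)) N + PI / 3 * (ln X - ln (2 * PI * INR N))))
  <= 15 * (X / INR (2 ^ n)) + 2 / INR N + 12 * (INR N / X).
Proof.
  intros HX HN.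
  assert (H1 := logint_poisson_primitive_approx n X ltac:(lra)).
  assert (H2 := Ti_head X N (proj1 HX)). assert (H3 := Ti_tail X N (2 ^ n) (proj1 HX) HN).
  assert (Es := rsum_add (fun k => 2 * (Ti (X / pole1 k) - Ti (X / pole2 k))) N (2 ^ n - N)).
  replace (N + (2 ^ n - N))%nat with (2 ^ n)%nat in Es by lia. rewrite Es in H1.
  apply Rabs_le_between in H1, H2, H3. apply Rabs_le. unfold Rdiv in *. lra.
Qed.

(** * The exponential integral and Euler's constant *)

Lemma logint_mul_derive h h' X : 0 <= X ->
  (forall t, is_derive h t (h' t)) -> (forall t, continuous h' t) ->
  logint (fun t => t * h' t) X = h X - h 0.
Proof.
  intros HX Hd Hc. unfold logint.
  rewrite (RInt_ext _ h').
  - apply is_RInt_unique. apply (is_RInt_derive h h'); auto.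
  - intros x Hx. rewrite Rmin_left in Hx by lra.
    unfold Rdiv. rewrite (Rmult_comm x), Rmult_assoc, Rinv_r, Rmult_1_r; lra.
Qed.

Definition Ein (x : R) : R := logint (fun t => 1 - exp (- t)) x.

Lemma log_integrable_Ein : log_integrable (fun t => 1 - exp (- t)).
Proof. split; [rewrite Ropp_0, exp_0; ring|]. intros t. auto_derive. auto. Qed.

Lemma exp_ge_1_add x : 1 + x <= exp x.
Proof.
  destruct (Req_EM_T x 0) as [-> | H]; [rewrite exp_0; lra|left; now apply exp_ineq1].
Qed.

Lemma exp_neg_bounds x : 0 <= x -> 0 < exp (- x) <= 1.
Proof.
  intros Hx. split; [apply exp_pos|]. rewrite exp_Ropp, <- Rinv_1.
  apply Rinv_le_contravar; [lra|]. generalize (exp_ge_1_add x). lra.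
Qed.

Lemma geometric_rsum y n : (1 - y) * rsum (fun k => y ^ k) n = 1 - y ^ n.
Proof. induction n as [|n IH]; simpl; [ring|]. rewrite Rmult_plus_distr_l, IH. ring. Qed.

Lemma exp_pow x n : exp x ^ n = exp (INR n * x).
Proof.
  induction n as [|n IH]; [simpl; now rewrite Rmult_0_l, exp_0|].
  rewrite S_INR. simpl. rewrite IH, <- exp_plus. f_equal. ring.
Qed.

Lemma bernoulli_inequality x n : 0 <= x <= 1 -> 1 - INR n * x <= (1 - x) ^ n.
Proof.
  intros Hx. induction n as [|n IH]; [simpl; lra|].
  rewrite S_INR. simpl. assert (0 <= INR n * x) by (generalize (pos_INR n); nra).
  apply Rle_trans with ((1 - x) * (1 - INR n * x)); nra.
Qed.

(** With y = t/n, the lower bound is 1 - y <= exp (- y). For the upper one, (1 - y)^n (1 + y)^n = (1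
    - y^2)^n >= 1 - n y^2 by Bernoulli, while (1 + y)^n <= exp t. *)
Lemma exp_pow_approx t n : (0 < n)%nat -> 0 <= t <= INR n ->
  0 <= exp (- t) - (1 - t / INR n) ^ n <= t ^ 2 * exp (- t) / INR n.
Proof.
  intros Hn Ht. assert (H0 : 0 < INR n) by now apply lt_0_INR.
  assert (Hy : 0 <= t / INR n <= 1).
  { split; [apply Rdiv_le_0_compat; lra|]. apply Rle_div_l; lra. }
  set (y := t / INR n) in *. assert (E : t = INR n * y) by (unfold y; field; lra).
  assert (H1 : (1 - y) ^ n <= exp (- t)).
  { replace (- t) with (INR n * - y) by lra. rewrite <- exp_pow.
    apply pow_incr. generalize (exp_ge_1_add (- y)). lra. }
  split; [lra|].
  assert (H2 : exp (- t) * (1 - t ^ 2 / INR n) <= (1 - y) ^ n); [|unfold Rdiv in *; lra].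
  apply Rle_trans with (exp (- t) * (1 - y ^ 2) ^ n).
  - apply Rmult_le_compat_l; [left; apply exp_pos|].
    replace (t ^ 2 / INR n) with (INR n * y ^ 2) by (rewrite E; field; lra).
    apply bernoulli_inequality. nra.
  - replace (1 - y ^ 2) with ((1 - y) * (1 + y)) by ring. rewrite Rpow_mult_distr.
    rewrite Rmult_comm, Rmult_assoc. rewrite <- (Rmult_1_r ((1 - y) ^ n)) at 2.
    apply Rmult_le_compat_l; [apply pow_le; lra|].
    apply Rle_trans with (exp t * exp (- t)).
    + apply Rmult_le_compat_r; [left; apply exp_pos|].
      rewrite E at 1. rewrite <- exp_pow. apply pow_incr. generalize (exp_ge_1_add y). lra.
    + rewrite <- exp_plus, Rplus_opp_r, exp_0. lra.
Qed.

(** By a geometric sum in 1 - t/n, with primitive [h], the harmonic sum is the integral of 1 - (1 -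
    t/n)^n against dt/t over [0, n]. The integrand differs from that of [Ein] by at most t exp (- t)
    / n, whose integral is at most 1/n. *)
Lemma Ein_harmonic n : (0 < n)%nat -> Rabs (Ein (INR n) - rsum (fun k => / INR (S k)) n) <= / INR n.
Proof.
  intros Hn. assert (H0 : 0 < INR n) by now apply lt_0_INR.
  set (h := fun x => rsum (fun k => - ((1 - x / INR n) ^ S k / INR (S k))) n).
  set (h' := fun x => rsum (fun k => / INR n * (1 - x / INR n) ^ k) n).
  assert (Hh : forall t, is_derive h t (h' t)).
  { intros t. apply (is_derive_rsum (fun k x => - ((1 - x / INR n) ^ S k / INR (S k))) (fun k x => / INR n * (1 - x / INR n) ^ k)).
    intros k _. assert (Hk : 0 < INR (S k)) by (apply lt_0_INR; lia).
    auto_derive; [auto|].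
    change (match k with 0%nat => 1 | S _ => INR k + 1 end) with (INR (S k)).
    simpl pred. change (1 + - (t * / INR n)) with (1 - t / INR n).
    generalize ((1 - t / INR n) ^ k). intros z. field. lra. }
  assert (Hc : forall t, continuous h' t).
  { intros t. apply (ex_derive_continuous (V := R_NormedModule) h'). eexists.
    apply (is_derive_rsum (fun k x => / INR n * (1 - x / INR n) ^ k) (fun k x => / INR n * (INR k * - / INR n * (1 - x / INR n) ^ pred k))).
    intros k _. auto_derive; [auto|]. change (1 + - (t * / INR n)) with (1 - t / INR n).
    generalize ((1 - t / INR n) ^ pred k). intros z. ring. }
  assert (E : rsum (fun k => / INR (S k)) n = logint (fun t => 1 - (1 - t / INR n) ^ n) (INR n)).
  { rewrite (logint_ext _ (fun t => t * h' t)).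
    - rewrite (logint_mul_derive h h') by (auto; lra). unfold h. rewrite <- rsum_minus.
      apply rsum_ext. intros k _. unfold Rdiv. rewrite Rinv_r, Rmult_0_l, Rminus_0_r, pow1 by lra.
      simpl pow. ring.
    - lra.
    - intros t Ht. unfold h'. rewrite rsum_scal.
      rewrite <- (geometric_rsum (1 - t / INR n)).
      change (rsum (pow (1 - t / INR n)) n) with (rsum (fun k => (1 - t / INR n) ^ k) n).
      field. lra. }
  assert (L1 : log_integrable (fun t => 1 - (1 - t / INR n) ^ n)).
  { split; [unfold Rdiv; rewrite Rmult_0_l, Rminus_0_r, pow1; ring|]. intros t. auto_derive. auto. }
  assert (L2 : log_integrable (fun t => t * (t * exp (- t)))).
  { split; [ring|]. intros t. auto_derive. auto. }
  rewrite E. unfold Ein. rewrite <- logint_minus by (auto using log_integrable_Ein; lra).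
  assert (B : logint (fun t => / INR n * (t * (t * exp (- t)))) (INR n) <= / INR n).
  { rewrite logint_scal by (auto; lra).
    rewrite (logint_mul_derive (fun t => - (1 + t) * exp (- t)) (fun t => t * exp (- t))); [|lra| |].
    - rewrite Ropp_0, exp_0. assert (0 < (1 + INR n) * exp (- INR n)).
      { apply Rmult_lt_0_compat; [lra|apply exp_pos]. }
      assert (0 < / INR n) by now apply Rinv_0_lt_compat. nra.
    - intros t. auto_derive; [auto|ring].
    - intros t. apply (ex_derive_continuous (V := R_NormedModule) (fun t => t * exp (- t))). auto_derive. auto. }
  assert (P : forall t, 0 < t < INR n -> 0 <= (1 - (1 - t / INR n) ^ n) - (1 - exp (- t)) <= / INR n * (t * (t * exp (- t)))).
  { intros t Ht. assert (H := exp_pow_approx t n Hn ltac:(lra)). split; [lra|].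
    replace (/ INR n * (t * (t * exp (- t)))) with (t ^ 2 * exp (- t) / INR n) by (unfold Rdiv; ring). lra. }
  apply Rabs_le. split.
  - apply Rle_trans with (- logint (fun t => / INR n * (t * (t * exp (- t)))) (INR n)); [lra|].
    replace (- logint (fun t => / INR n * (t * (t * exp (- t)))) (INR n))
      with (logint (fun t => -1 * (/ INR n * (t * (t * exp (- t))))) (INR n))
      by (rewrite (logint_scal (-1)) by (auto using log_integrable_scal; lra); ring).
    apply logint_le; [lra|auto using log_integrable_scal|auto using log_integrable_minus, log_integrable_Ein|].
    intros t Ht. specialize (P t Ht). lra.
  - apply Rle_trans with 0; [|left; now apply Rinv_0_lt_compat].
    apply Rle_trans with (logint (fun t => 0 * t) (INR n));
      [|rewrite logint_scal by (auto using log_integrable_id; lra); lra].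
    apply logint_le; [lra|auto using log_integrable_minus, log_integrable_Ein|auto using log_integrable_scal, log_integrable_id|].
    intros t Ht. specialize (P t Ht). lra.
Qed.

(** [Ein - ln] has derivative - exp (- c) / c, which for c >= 1 lies between - exp (- c) and 0. *)
Lemma Ein_sub_ln_increment x y : 1 <= x <= y ->
  0 <= (Ein x - ln x) - (Ein y - ln y) <= exp (- x).
Proof.
  intros Hxy.
  assert (D : forall c, x <= c <= y -> is_derive (fun x => Ein x - ln x) c (- (exp (- c) / c))).
  { intros c Hc. replace (- (exp (- c) / c)) with ((1 - exp (- c)) / c - / c) by (field; lra).
    apply (is_derive_minus Ein ln).
    - apply (is_derive_logint (fun t => 1 - exp (- t))); [lra|apply log_integrable_Ein].
    - apply is_derive_Reals, derivable_pt_lim_ln. lra. }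
  assert (Q : forall c, x < c < y -> 0 <= exp (- c) / c <= exp (- c)).
  { intros c Hc. assert (He := exp_pos (- c)). split; [apply Rdiv_le_0_compat; lra|].
    apply Rle_div_l; [lra|]. nra. }
  split.
  - assert (H := increment_le_of_derive _ _ (fun _ => 0) (fun _ => 0) x y (proj2 Hxy) D
      ltac:(intros; auto_derive; [auto|ring]) ltac:(intros c Hc; specialize (Q c Hc); lra)).
    cbv beta in H. lra.
  - assert (H := increment_le_of_derive (fun x => exp (- x)) (fun x => - exp (- x)) _ _ x y (proj2 Hxy)
      ltac:(intros; auto_derive; [auto|ring]) D ltac:(intros c Hc; specialize (Q c Hc); lra)).
    cbv beta in H. generalize (exp_pos (- y)). lra.
Qed.

Lemma is_lim_seq_inv_INR_S : is_lim_seq (fun n => / INR (S n)) 0.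
Proof.
  apply (is_lim_seq_incr_1 (fun n => / INR n)).
  replace (Finite 0) with (Rbar_inv p_infty) by reflexivity.
  apply is_lim_seq_inv; [apply is_lim_seq_INR|discriminate].
Qed.

(** [Ein - ln] decreases to a finite limit, and [Ein_harmonic] identifies that limit along the
    integers with the one in [euler_gamma], which is thereby a genuine limit and not a default
    value. *)
Lemma Ein_asymptotic x : 1 <= x -> 0 <= Ein x - ln x - euler_gamma <= exp (- x).
Proof.
  set (w := fun n => Ein (INR (S n)) - ln (INR (S n))).
  assert (HS : forall n, 1 <= INR (S n)) by (intros n; apply (le_INR 1); lia).
  assert (Hw : ex_finite_lim_seq w).
  { apply ex_finite_lim_seq_decr with (M := Ein 1 - ln 1 - 1).
    - intros n. unfold w. assert (H := Ein_sub_ln_increment (INR (S n)) (INR (S (S n)))).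
      rewrite (S_INR (S n)) in *. specialize (HS n). lra.
    - intros n. assert (H := Ein_sub_ln_increment 1 (INR (S n)) (conj (Rle_refl 1) (HS n))).
      assert (H1 := exp_neg_bounds 1 ltac:(lra)). unfold w. lra. }
  destruct Hw as [g Hg].
  assert (Eg : euler_gamma = g).
  { unfold euler_gamma. rewrite (is_lim_seq_unique _ g); [reflexivity|].
    apply is_lim_seq_le_le with (u := fun n => w n - / INR (S n)) (w := fun n => w n + / INR (S n)).
    - intros n. rewrite sum_n_rsum. assert (H := Ein_harmonic (S n) ltac:(lia)).
      apply Rabs_le_between in H. unfold w. lra.
    - replace (Finite g) with (Finite (g - 0)) by (f_equal; ring).
      apply is_lim_seq_minus'; [exact Hg|apply is_lim_seq_inv_INR_S].
    - replace (Finite g) with (Finite (g + 0)) by (f_equal; ring).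
      apply is_lim_seq_plus'; [exact Hg|apply is_lim_seq_inv_INR_S]. }
  intros Hx. rewrite Eg.
  assert (HN : exists N, forall n, (N <= n)%nat -> x <= INR (S n)).
  { destruct (nfloor_ex x ltac:(lra)) as [m Hm]. exists m. intros n Hn.
    rewrite S_INR. apply le_INR in Hn. lra. }
  destruct HN as [N HN].
  assert (B : forall n, (N <= n)%nat -> Ein x - ln x - exp (- x) <= w n <= Ein x - ln x).
  { intros n Hn. assert (H := Ein_sub_ln_increment x (INR (S n)) (conj Hx (HN n Hn))). unfold w. lra. }
  assert (U : Rbar_le g (Ein x - ln x)).
  { apply (is_lim_seq_le_loc w (fun _ => Ein x - ln x)); auto using is_lim_seq_const.
    exists N. intros n Hn. apply B, Hn. }
  assert (L : Rbar_le (Ein x - ln x - exp (- x)) g).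
  { apply (is_lim_seq_le_loc (fun _ => Ein x - ln x - exp (- x)) w); auto using is_lim_seq_const.
    exists N. intros n Hn. apply B, Hn. }
  simpl in U, L. lra.
Qed.

(** * Expansion in exponentials *)

(** With [nat2], the integers on which chi takes the values 1 and -1. *)
Definition nat1 (k : nat) : R := 3 * INR k + 1.
Definition nat2 (k : nat) : R := 3 * INR k + 2.

Lemma nat1_ge_1 k : 1 <= nat1 k.
Proof. unfold nat1. generalize (pos_INR k). lra. Qed.

Lemma nat2_ge_1 k : 1 <= nat2 k.
Proof. unfold nat2. generalize (pos_INR k). lra. Qed.

Lemma sqrt3_bounds : 3 / 2 < sqrt 3 < 2 /\ sqrt 3 * sqrt 3 = 3.
Proof.
  assert (H := sqrt_sqrt 3 ltac:(lra)). assert (H0 := sqrt_lt_R0 3 ltac:(lra)).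
  split; auto. split; nra.
Qed.

Lemma sin_cos_2PI3 : sin (2 * PI / 3) = sqrt 3 / 2 /\ cos (2 * PI / 3) = -1 / 2.
Proof.
  destruct (sin_cos_half (2 * PI / 3)) as (E1 & E2 & E3).
  replace (2 * PI / 3 / 2) with (PI / 3) in * by field.
  rewrite sin_PI3 in *. rewrite cos_PI3 in *. rewrite E1, E2. split; [field|].
  generalize (proj2 sqrt3_bounds). intros. nra.
Qed.

(** With q = exp (- t) the left-hand quotient is 1 / (1/q + 1 + q), which for q <> 1 is (q - q^2) /
    (1 - q^3). Each block of three powers multiplies the remainder by q^3. The exact remainder gives
    sign and size at once, and holds at t = 0 as well. *)
Lemma poisson_kernel_2PI3_expansion J t :
  poisson_kernel (2 * PI / 3) t / sqrt 3 - rsum (fun k => exp (- (nat1 k * t)) - exp (- (nat2 k * t))) J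
  = exp (- (3 * INR J * t)) / (exp t + exp (- t) + 1).
Proof.
  destruct sqrt3_bounds as [Hs _]. destruct sin_cos_2PI3 as [E1 E2].
  assert (Hp := exp_pos t). assert (Hp' := exp_pos (- t)).
  assert (HD : exp t + exp (- t) + 1 <> 0) by lra.
  induction J as [|J IH].
  - simpl. unfold poisson_kernel. rewrite E1, E2. replace (- (3 * 0 * t)) with 0 by ring.
    rewrite exp_0. field. lra.
  - simpl rsum. rewrite S_INR.
    replace (- (3 * (INR J + 1) * t)) with (- (3 * INR J * t) + - t + - t + - t) by ring.
    replace (- (nat1 J * t)) with (- (3 * INR J * t) + - t) by (unfold nat1; ring).
    replace (- (nat2 J * t)) with (- (3 * INR J * t) + - t + - t) by (unfold nat2; ring).
    rewrite !exp_plus. set (r := rsum _ J) in *. set (w := exp (- (3 * INR J * t))) in *.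
    replace (poisson_kernel (2 * PI / 3) t / sqrt 3) with (w / (exp t + exp (- t) + 1) + r) by lra.
    rewrite exp_Ropp in *. field. split; nra.
Qed.

Lemma poisson_kernel_2PI3_expansion_bounds J t :
  0 <= poisson_kernel (2 * PI / 3) t / sqrt 3 - rsum (fun k => exp (- (nat1 k * t)) - exp (- (nat2 k * t))) J
    <= exp (- (3 * INR J * t)) / 3.
Proof.
  rewrite poisson_kernel_2PI3_expansion. assert (H := exp_pos (- (3 * INR J * t))).
  assert (2 <= exp t + exp (- t)).
  { destruct (Req_EM_T t 0) as [-> | Ht]; [rewrite Ropp_0, exp_0; lra|].
    generalize (cosh_gt_1 t Ht). lra. }
  split; [apply Rdiv_le_0_compat; lra|].
  apply Rmult_le_compat_l; [lra|]. apply Rinv_le_contravar; lra.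
Qed.

Definition exp_partial (J : nat) (T : R) : R :=
  rsum (fun k => / nat1 k * (1 - exp (- (nat1 k * T))) - / nat2 k * (1 - exp (- (nat2 k * T)))) J.

(** The factor 1 - exp (- 3 J T) is kept because it vanishes at T = 0: the error has to be
    integrated once more against dt/t. *)
Lemma poisson_primitive_2PI3_expansion J T : (0 < J)%nat -> 0 <= T ->
  0 <= poisson_primitive (2 * PI / 3) T / sqrt 3 - exp_partial J T <= / (9 * INR J) * (1 - exp (- (3 * INR J * T))).
Proof.
  intros HJ HT. assert (HJ0 : 0 < INR J) by now apply lt_0_INR. destruct sqrt3_bounds as [Hs _].
  assert (HP := PI_RGT_0).
  assert (D : forall c, is_derive (fun T => poisson_primitive (2 * PI / 3) T / sqrt 3 - exp_partial J T) c
    (poisson_kernel (2 * PI / 3) c / sqrt 3 - rsum (fun k => exp (- (nat1 k * c)) - exp (- (nat2 k * c))) J)).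
  { intros c. apply (is_derive_minus (fun T => poisson_primitive (2 * PI / 3) T / sqrt 3) (exp_partial J)).
    - unfold Rdiv. rewrite (Rmult_comm (poisson_kernel _ _)).
      apply is_derive_ext with (fun T => / sqrt 3 * poisson_primitive (2 * PI * / 3) T); [intros; apply Rmult_comm|].
      apply is_derive_scal. apply is_derive_poisson_primitive. apply Rgt_not_eq, sin_half_pos. lra.
    - unfold exp_partial.
      apply (is_derive_rsum (fun k T => / nat1 k * (1 - exp (- (nat1 k * T))) - / nat2 k * (1 - exp (- (nat2 k * T))))
        (fun k c => exp (- (nat1 k * c)) - exp (- (nat2 k * c)))).
      intros k _. assert (H1 := nat1_ge_1 k). assert (H2 := nat2_ge_1 k).
      auto_derive; [auto|]. field. lra. }
  assert (E0 : poisson_primitive (2 * PI / 3) 0 / sqrt 3 - exp_partial J 0 = 0).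
  { unfold exp_partial. rewrite (rsum_ext _ (fun _ => 0)).
    - rewrite rsum_const, poisson_primitive_0. field. lra.
    - intros k _. rewrite !Rmult_0_r, Ropp_0, exp_0. ring. }
  split.
  - rewrite <- E0.
    apply (nondecreasing_of_derive (fun T => poisson_primitive (2 * PI / 3) T / sqrt 3 - exp_partial J T) _ 0 T HT (fun c _ => D c)).
    intros c _. apply poisson_kernel_2PI3_expansion_bounds.
  - assert (H := increment_le_of_derive _ _ (fun T => / (9 * INR J) * (1 - exp (- (3 * INR J * T))))
      (fun T => exp (- (3 * INR J * T)) / 3) 0 T HT (fun c _ => D c)).
    cbv beta in H. rewrite E0, Rmult_0_r, Ropp_0, exp_0 in H.
    rewrite !Rminus_0_r, Rminus_diag, Rmult_0_r, Rminus_0_r in H. apply H.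
    + intros c _. auto_derive; [auto|]. field. lra.
    + intros c _. apply poisson_kernel_2PI3_expansion_bounds.
Qed.

(** As tanh (T/2) tends to 1 the value tends to 2 atan (1 / sqrt 3) = PI / 3, and atan is
    1-Lipschitz. *)
Lemma poisson_primitive_2PI3_limit T : 0 <= T -> Rabs (poisson_primitive (2 * PI / 3) T - PI / 3) <= 4 * exp (- T).
Proof.
  intros HT. destruct sqrt3_bounds as [Hs Hs2].
  assert (HeT : 1 <= exp T) by (generalize (exp_ge_1_add T); lra).
  unfold poisson_primitive. replace (2 * PI / 3 / 2) with (PI / 3) by field.
  rewrite sin_PI3, cos_PI3.
  replace (PI / 3) with (2 * atan (1 / sqrt 3)).
  2: { rewrite <- tan_PI6, atan_tan; generalize PI_RGT_0; lra. }
  set (b := 1 / sqrt 3). set (a := (exp T - 1) / (exp T + 1) * (1 / 2 / (sqrt 3 / 2))).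
  assert (Hba : b - a = 2 / (exp T + 1) / sqrt 3) by (unfold a, b; field; lra).
  assert (Hb1 : 2 / (exp T + 1) / sqrt 3 <= 2 * exp (- T)).
  { apply Rle_div_l; [lra|]. apply Rle_div_l; [lra|]. rewrite exp_Ropp.
    apply Rle_trans with (2 * / exp T * 1 * exp T); [right; field; lra|].
    apply Rmult_le_compat; try lra; [|assert (0 < / exp T) by (apply Rinv_0_lt_compat; lra); nra].
    assert (0 < / exp T) by (apply Rinv_0_lt_compat; lra). nra. }
  assert (Hb2 : 0 <= 2 / (exp T + 1) / sqrt 3).
  { apply Rdiv_le_0_compat; [|lra]. apply Rdiv_le_0_compat; lra. }
  assert (H := increment_le_of_derive atan (fun t => / (1 + t ^ 2)) (fun t => t) (fun _ => 1) a b ltac:(lra)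
    ltac:(intros c _; apply is_derive_Reals, derivable_pt_lim_atan) ltac:(intros; auto_derive; [auto|ring])).
  cbv beta in H. assert (H1 : atan b - atan a <= b - a).
  { apply H. intros c Hc. rewrite <- Rinv_1. apply Rinv_le_contravar; nra. }
  assert (H2 : atan a <= atan b).
  { assert (Hle : a <= b) by lra. destruct Hle as [Hlt | ->]; [left; now apply atan_increasing|lra]. }
  apply Rabs_le. lra.
Qed.

Definition chi_inv_sum (J : nat) : R := rsum (fun k => / nat1 k - / nat2 k) J.
Definition chi_log_sum (J : nat) : R := rsum (fun k => ln (nat1 k) / nat1 k - ln (nat2 k) / nat2 k) J.

(** The value L(1, chi) = PI / (3 sqrt 3), read off from the expansion of the primitive at a large
    T. *)
Lemma chi_inv_sum_approx J : (0 < J)%nat -> Rabs (chi_inv_sum J - PI / (3 * sqrt 3)) <= 2 / INR J.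
Proof.
  intros HJ. assert (HJ1 : 1 <= INR J) by (apply (le_INR 1); lia). destruct sqrt3_bounds as [Hs _].
  (* Quadratic in J, so that the J neglected pairs of exponentials, of size at most 2 exp (- T) <= 1
     / (3 J^2) each, add up to O(1/J). *)
  set (T := 6 * INR J ^ 2). assert (HT : 0 <= T) by (unfold T; nra).
  assert (He : exp (- T) <= / (6 * INR J * INR J)).
  { rewrite exp_Ropp. apply Rinv_le_contravar; [nra|]. generalize (exp_ge_1_add T). unfold T. lra. }
  assert (He0 := exp_pos (- T)).
  assert (H1 := poisson_primitive_2PI3_expansion J T HJ HT). assert (H2 := poisson_primitive_2PI3_limit T HT).
  assert (H3 : Rabs (chi_inv_sum J - exp_partial J T) <= INR J * (2 * exp (- T))).
  { unfold chi_inv_sum, exp_partial. rewrite <- rsum_minus, <- rsum_const.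
    apply Rabs_rsum_le. intros k _.
    assert (B : forall n, 1 <= n -> 0 <= / n * exp (- (n * T)) <= exp (- T)).
    { intros n Hn. assert (0 < / n <= 1).
      { split; [apply Rinv_0_lt_compat; lra|]. rewrite <- Rinv_1. apply Rinv_le_contravar; lra. }
      assert (0 < exp (- (n * T)) <= exp (- T)).
      { split; [apply exp_pos|]. destruct (Req_EM_T (n * T) T) as [-> | Z]; [lra|].
        left. apply exp_increasing. assert (T <= n * T) by nra. lra. }
      split; nra. }
    assert (B1 := B _ (nat1_ge_1 k)). assert (B2 := B _ (nat2_ge_1 k)).
    apply Rabs_le. lra. }
  assert (H4 : / (9 * INR J) * (1 - exp (- (3 * INR J * T))) <= / INR J / 9).
  { replace (/ INR J / 9) with (/ (9 * INR J) * 1) by (field; lra).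
    apply Rmult_le_compat_l; [left; apply Rinv_0_lt_compat; lra|]. generalize (exp_pos (- (3 * INR J * T))). lra. }
  assert (H5 : INR J * (2 * exp (- T)) <= / INR J / 3).
  { replace (/ INR J / 3) with (INR J * (2 * / (6 * INR J * INR J))) by (field; lra).
    apply Rmult_le_compat_l; [lra|]. lra. }
  assert (H6 : 4 * exp (- T) <= / INR J * (2 / 3)).
  { apply Rle_trans with (4 * / (6 * INR J * INR J)); [lra|].
    replace (4 * / (6 * INR J * INR J)) with (/ INR J * (2 / 3) * / INR J) by (field; lra).
    rewrite <- (Rmult_1_r (/ INR J * (2 / 3))) at 2.
    assert (0 < / INR J <= 1).
    { split; [apply Rinv_0_lt_compat; lra|]. rewrite <- Rinv_1. apply Rinv_le_contravar; lra. }
    apply Rmult_le_compat_l; nra. }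
  assert (H7 : Rabs (poisson_primitive (2 * PI / 3) T / sqrt 3 - PI / (3 * sqrt 3)) <= / INR J * (2 / 3)).
  { replace (poisson_primitive (2 * PI / 3) T / sqrt 3 - PI / (3 * sqrt 3))
      with ((poisson_primitive (2 * PI / 3) T - PI / 3) * / sqrt 3) by (field; lra).
    rewrite Rabs_mult, (Rabs_right (/ sqrt 3)) by (left; apply Rinv_0_lt_compat; lra).
    assert (0 < / sqrt 3 <= 1).
    { split; [apply Rinv_0_lt_compat; lra|]. rewrite <- Rinv_1. apply Rinv_le_contravar; lra. }
    assert (0 <= Rabs (poisson_primitive (2 * PI / 3) T - PI / 3)) by apply Rabs_pos. nra. }
  assert (0 < / INR J) by (apply Rinv_0_lt_compat; lra).
  apply Rabs_le_between in H3, H7. apply Rabs_le. unfold Rdiv in *. lra.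
Qed.

(** A crude bound from 0 <= [Ein 1] <= 1; it serves to estimate |euler_gamma + ln X| by 1 + ln X. *)
Lemma euler_gamma_bounds : -1 <= euler_gamma <= 1.
Proof.
  assert (H := Ein_asymptotic 1 ltac:(lra)). rewrite ln_1 in H.
  assert (He := exp_neg_bounds 1 ltac:(lra)).
  assert (B : 0 <= Ein 1 <= 1).
  { unfold Ein. split.
    - apply Rle_trans with (logint (fun t => 0 * t) 1).
      + rewrite logint_scal by (auto using log_integrable_id; lra). lra.
      + apply logint_le; [lra|auto using log_integrable_scal, log_integrable_id|apply log_integrable_Ein|].
        intros t Ht. generalize (exp_neg_bounds t). lra.
    - rewrite <- (logint_id 1) at 2 by lra.
      apply logint_le; [lra|apply log_integrable_Ein|apply log_integrable_id|].
      intros t Ht. generalize (exp_ge_1_add (- t)). lra. }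
  lra.
Qed.

Lemma logint_one_sub_exp c X : 0 < c -> 0 <= X -> logint (fun t => 1 - exp (- (c * t))) X = Ein (c * X).
Proof. intros Hc HX. apply (logint_comp (fun t => 1 - exp (- t))); auto using log_integrable_Ein. Qed.

Lemma log_integrable_one_sub_exp c : log_integrable (fun t => 1 - exp (- (c * t))).
Proof. apply (log_integrable_comp (fun t => 1 - exp (- t))), log_integrable_Ein. Qed.

(** The three errors, in order: truncation, which integrates to Ein (3 J X) / (9 J); the replacement
    of each Ein (n X) by ln n + ln X + gamma; and the replacement of [chi_inv_sum J] by its
    limit. *)
Lemma logint_poisson_primitive_expansion J X : (0 < J)%nat -> 1 <= X ->
  Rabs (logint (poisson_primitive (2 * PI / 3)) X / sqrt 3 - (chi_log_sum J + (euler_gamma + ln X) * (PI / (3 * sqrt 3))))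
  <= (ln (3 * INR J * X) + 2) / (9 * INR J) + 2 * INR J * exp (- X) + (1 + ln X) * (2 / INR J).
Proof.
  intros HJ HX. assert (HJ1 : 1 <= INR J) by (apply (le_INR 1); lia). destruct sqrt3_bounds as [Hs _].
  assert (HP := PI_RGT_0). assert (Hg := euler_gamma_bounds).
  assert (HlX : 0 <= ln X) by (rewrite <- ln_1; destruct HX as [HX | <-]; [left; apply ln_increasing; lra|lra]).
  assert (Lp : log_integrable (poisson_primitive (2 * PI / 3))) by (apply log_integrable_poisson_primitive, Rgt_not_eq, sin_half_pos; lra).
  assert (Lk : forall k, log_integrable (fun T => / nat1 k * (1 - exp (- (nat1 k * T))) - / nat2 k * (1 - exp (- (nat2 k * T))))).
  { intros k. apply log_integrable_minus; apply log_integrable_scal, log_integrable_one_sub_exp. }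
  assert (Le : log_integrable (exp_partial J)) by (apply (log_integrable_rsum (fun k T => / nat1 k * (1 - exp (- (nat1 k * T))) - / nat2 k * (1 - exp (- (nat2 k * T))))); auto).
  assert (Ls : log_integrable (fun T => / sqrt 3 * poisson_primitive (2 * PI / 3) T)) by now apply log_integrable_scal.
  assert (H1 : 0 <= logint (poisson_primitive (2 * PI / 3)) X / sqrt 3 - logint (exp_partial J) X <= (ln (3 * INR J * X) + 2) / (9 * INR J)).
  { replace (logint (poisson_primitive (2 * PI / 3)) X / sqrt 3) with (logint (fun T => / sqrt 3 * poisson_primitive (2 * PI / 3) T) X)
      by (rewrite logint_scal by (auto; lra); unfold Rdiv; ring).
    rewrite <- logint_minus by (auto; lra). split.
    - apply Rle_trans with (logint (fun t => 0 * t) X).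
      + rewrite logint_scal by (auto using log_integrable_id; lra). lra.
      + apply logint_le; [lra|auto using log_integrable_scal, log_integrable_id|auto using log_integrable_minus|].
        intros t Ht. assert (H := poisson_primitive_2PI3_expansion J t HJ ltac:(lra)). unfold Rdiv in *. lra.
    - apply Rle_trans with (logint (fun t => / (9 * INR J) * (1 - exp (- (3 * INR J * t)))) X).
      + apply logint_le; [lra|auto using log_integrable_minus|apply log_integrable_scal, log_integrable_one_sub_exp|].
        intros t Ht. assert (H := poisson_primitive_2PI3_expansion J t HJ ltac:(lra)). unfold Rdiv in *. lra.
      + rewrite logint_scal by (try apply log_integrable_one_sub_exp; lra).
        rewrite logint_one_sub_exp by lra. unfold Rdiv. rewrite Rmult_comm.
        apply Rmult_le_compat_r; [left; apply Rinv_0_lt_compat; lra|].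
        assert (HZ : 1 <= 3 * INR J * X) by nra.
        assert (H := Ein_asymptotic _ HZ). assert (He := exp_neg_bounds (3 * INR J * X) ltac:(lra)). lra. }
  assert (E1 : logint (exp_partial J) X = rsum (fun k => / nat1 k * Ein (nat1 k * X) - / nat2 k * Ein (nat2 k * X)) J).
  { unfold exp_partial.
    rewrite (logint_rsum (fun k T => / nat1 k * (1 - exp (- (nat1 k * T))) - / nat2 k * (1 - exp (- (nat2 k * T))))) by (auto; lra).
    apply rsum_ext. intros k _. assert (A1 := nat1_ge_1 k). assert (A2 := nat2_ge_1 k).
    rewrite (logint_minus (fun T => / nat1 k * (1 - exp (- (nat1 k * T)))) (fun T => / nat2 k * (1 - exp (- (nat2 k * T)))))
      by (try apply log_integrable_scal, log_integrable_one_sub_exp; lra).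
    rewrite !logint_scal by (try apply log_integrable_one_sub_exp; lra).
    rewrite !logint_one_sub_exp by lra. reflexivity. }
  assert (H2 : Rabs (logint (exp_partial J) X - (chi_log_sum J + (euler_gamma + ln X) * chi_inv_sum J)) <= INR J * (2 * exp (- X))).
  { rewrite E1. unfold chi_log_sum, chi_inv_sum. rewrite <- rsum_scal, <- rsum_plus, <- rsum_minus, <- rsum_const.
    apply Rabs_rsum_le. intros k _.
    assert (B : forall n, 1 <= n -> 0 <= / n * Ein (n * X) - (ln n / n + (euler_gamma + ln X) * / n) <= exp (- X)).
    { intros n Hn. assert (HnX : 1 <= n * X) by nra. assert (H := Ein_asymptotic _ HnX).
      rewrite ln_mult in H by lra.
      replace (/ n * Ein (n * X) - (ln n / n + (euler_gamma + ln X) * / n))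
        with (/ n * (Ein (n * X) - (ln n + ln X) - euler_gamma)) by (unfold Rdiv; ring).
      assert (0 < / n <= 1).
      { split; [apply Rinv_0_lt_compat; lra|]. rewrite <- Rinv_1. apply Rinv_le_contravar; lra. }
      assert (exp (- (n * X)) <= exp (- X)).
      { destruct (Req_EM_T (n * X) X) as [-> | Z]; [lra|].
        left. apply exp_increasing. assert (X <= n * X) by nra. lra. }
      generalize (exp_pos (- (n * X))). intros. split; nra. }
    assert (B1 := B _ (nat1_ge_1 k)). assert (B2 := B _ (nat2_ge_1 k)).
    apply Rabs_le. lra. }
  assert (H3 : Rabs ((euler_gamma + ln X) * chi_inv_sum J - (euler_gamma + ln X) * (PI / (3 * sqrt 3))) <= (1 + ln X) * (2 / INR J)).
  { rewrite <- Rmult_minus_distr_l, Rabs_mult. apply Rmult_le_compat; try apply Rabs_pos.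
    - apply Rabs_le. lra.
    - now apply chi_inv_sum_approx. }
  apply Rabs_le_between in H2, H3. apply Rabs_le. lra.
Qed.

(** Equates the two evaluations of I(X) / sqrt 3. The ln X terms have equal coefficients and cancel;
    ln N = ln (2^j) remains, to be balanced by the growth of the sum of logarithms. *)
Lemma chi_log_sum_approx j :
  Rabs (chi_log_sum (4 ^ j) + euler_gamma * (PI / (3 * sqrt 3)) -
        PI / sqrt 3 * (rsum (fun k => ln (INR k + 2 / 3) - ln (INR k + 1 / 3)) (2 ^ j) -
                       1 / 3 * ln (2 * PI * 2 ^ j))) <= 50 / 2 ^ j.
Proof.
  set (x := 2 ^ j). assert (Hx : 1 <= x) by (apply pow_R1_Rle; lra).
  assert (EX : 4 ^ j = x * x) by (unfold x; rewrite <- Rpow_mult_distr; f_equal; ring).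
  assert (EN : INR (2 ^ j) = x) by (rewrite pow_INR; reflexivity).
  assert (EJ : INR (4 ^ j) = x * x).
  { rewrite pow_INR, <- EX. f_equal. simpl. ring. }
  assert (EH : INR (2 ^ (4 * j)) = x * x * (x * x)).
  { rewrite pow_INR, pow_mult, <- EX, <- Rpow_mult_distr. f_equal. simpl. ring. }
  assert (HN : (1 <= 2 ^ j)%nat) by (apply Nat.neq_0_lt_0, Nat.pow_nonzero; lia).
  assert (HNH : (2 ^ j <= 2 ^ (4 * j))%nat) by (apply Nat.pow_le_mono_r; lia).
  assert (HJ : (0 < 4 ^ j)%nat) by (apply Nat.neq_0_lt_0, Nat.pow_nonzero; lia).
  assert (Hxx : 1 <= x * x) by nra. assert (HP := PI_RGT_0).
  destruct sqrt3_bounds as [Hs _].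
  (* With x = 2^j: X = x^2, N = x and x^4 pole pairs here, J = x^2 blocks in [A2]. The ratios N/X
     and X / 2^n and the quotient ln X / J are then all O(1/x). *)
  assert (A1 := logint_poisson_primitive_asymptotic (4 * j) (x * x) (2 ^ j)
    ltac:(rewrite EH; split; nra) (conj HN HNH)).
  assert (A2 := logint_poisson_primitive_expansion (4 ^ j) (x * x) HJ Hxx).
  rewrite EH, EN in A1. rewrite EJ in A2.
  rewrite (rsum_ext _ (fun k => ln (INR k + 2 / 3) - ln (INR k + 1 / 3))) in A1.
  2: { intros k _. unfold pole1, pole2. assert (Hk := pos_INR k). rewrite !(ln_mult (2 * PI)) by lra. ring. }
  set (L := logint (poisson_primitive (2 * PI / 3)) (x * x)) in *.
  set (s := rsum _ (2 ^ j)) in *.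
  assert (Hi : 0 < / x <= 1).
  { split; [apply Rinv_0_lt_compat; lra|]. rewrite <- Rinv_1. apply Rinv_le_contravar; lra. }
  assert (Exx : / (x * x) = / x * / x) by (rewrite Rinv_mult; ring).
  assert (B1 : 15 * (x * x / (x * x * (x * x))) + 2 / x + 12 * (x / (x * x)) <= 29 * / x).
  { replace (x * x / (x * x * (x * x))) with (/ x * / x) by (field; lra).
    replace (x / (x * x)) with (/ x) by (field; lra). unfold Rdiv. nra. }
  assert (Hlx : 0 <= ln x <= x - 1).
  { split; [|apply ln_le_sub_1; lra]. rewrite <- ln_1. destruct Hx as [Hx | <-]; [left; apply ln_increasing; lra|lra]. }
  assert (Elx : ln (x * x) = 2 * ln x) by (rewrite ln_mult by lra; ring).
  assert (B2 : (ln (3 * (x * x) * (x * x)) + 2) / (9 * (x * x)) <= / x).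
  { rewrite !ln_mult by nra. assert (H3 := ln_le_sub_1 3 ltac:(lra)).
    apply Rle_div_l; [nra|]. replace (/ x * (9 * (x * x))) with (9 * x) by (field; lra). nra. }
  assert (B3 : 2 * (x * x) * exp (- (x * x)) <= 8 * / x).
  { assert (He : (x * x / 2) ^ 2 <= exp (x * x)).
    { replace (x * x) with (INR 2 * (x * x / 2)) at 2 by (simpl; field).
      rewrite <- exp_pow. apply pow_incr. generalize (exp_ge_1_add (x * x / 2)). nra. }
    rewrite exp_Ropp. apply Rle_trans with (2 * (x * x) * / ((x * x / 2) ^ 2)).
    - apply Rmult_le_compat_l; [nra|]. apply Rinv_le_contravar; [nra|auto].
    - replace (2 * (x * x) * / ((x * x / 2) ^ 2)) with (8 * (/ x * / x)) by (field; lra). nra. }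
  assert (B4 : (1 + ln (x * x)) * (2 / (x * x)) <= 4 * / x).
  { apply Rle_trans with (2 * x * (2 / (x * x))).
    - apply Rmult_le_compat_r; [|lra]. apply Rdiv_le_0_compat; nra.
    - right. field. lra. }
  assert (A3 : Rabs (L / sqrt 3 - (PI * s + PI / 3 * (ln (x * x) - ln (2 * PI * x))) / sqrt 3) <= 29 * / x).
  { replace (L / sqrt 3 - (PI * s + PI / 3 * (ln (x * x) - ln (2 * PI * x))) / sqrt 3)
      with ((L - (PI * s + PI / 3 * (ln (x * x) - ln (2 * PI * x)))) * / sqrt 3) by (field; lra).
    rewrite Rabs_mult, (Rabs_right (/ sqrt 3)) by (left; apply Rinv_0_lt_compat; lra).
    assert (0 < / sqrt 3 <= 1).
    { split; [apply Rinv_0_lt_compat; lra|]. rewrite <- Rinv_1. apply Rinv_le_contravar; lra. }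
    assert (Hp := Rabs_pos (L - (PI * s + PI / 3 * (ln (x * x) - ln (2 * PI * x))))). nra. }
  replace (50 / x) with (50 * / x) by (unfold Rdiv; ring).
  match goal with |- Rabs ?y <= _ => replace y with
    ((L / sqrt 3 - (PI * s + PI / 3 * (ln (x * x) - ln (2 * PI * x))) / sqrt 3) -
     (L / sqrt 3 - (chi_log_sum (4 ^ j) + (euler_gamma + ln (x * x)) * (PI / (3 * sqrt 3))))) by (field; lra) end.
  apply Rabs_le_between in A2, A3. apply Rabs_le. lra.
Qed.

(** * Gauss's limit for the gamma function *)

(** For nonnegative [f] the integral is monotone in both endpoints, so the supremum along
    [1/(m+1), m+1] is also the limit over the product filter. Besides convergence, this lets a
    single sequence represent the improper integral. *)
Lemma is_RInt_gen_nonneg_bounded (f : R -> R) (K : R) :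
  (forall t, 0 < t -> 0 <= f t) -> (forall t, 0 < t -> continuous f t) ->
  (forall a b, 0 < a <= b -> RInt f a b <= K) ->
  exists L, is_RInt_gen f (at_right 0) (Rbar_locally p_infty) L /\
    is_lim_seq (fun m => RInt f (/ INR (S m)) (INR (S m))) L.
Proof.
  intros Hf Hc HK.
  assert (Hex : forall a b, 0 < a <= b -> ex_RInt f a b).
  { intros a b Hab. apply (ex_RInt_continuous (V := R_CompleteNormedModule)).
    intros z Hz. rewrite Rmin_left in Hz by lra. apply Hc. lra. }
  assert (Hmono : forall a b a' b', 0 < a' <= a -> a <= b -> b <= b' -> RInt f a b <= RInt f a' b').
  { intros a b a' b' Ha Hab Hb.
    rewrite <- (RInt_Chasles f a' a b') by (apply Hex; lra).
    rewrite <- (RInt_Chasles f a b b') by (apply Hex; lra).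
    unfold plus; simpl.
    assert (0 <= RInt f a' a) by (apply RInt_ge_0; [lra|apply Hex; lra|intros; apply Hf; lra]).
    assert (0 <= RInt f b b') by (apply RInt_ge_0; [lra|apply Hex; lra|intros; apply Hf; lra]).
    lra. }
  assert (HS : forall m, 1 <= INR (S m)) by (intros m; apply (le_INR 1); lia).
  assert (HI : forall m, 0 < / INR (S m) <= 1).
  { intros m. specialize (HS m). split; [apply Rinv_0_lt_compat; lra|].
    rewrite <- Rinv_1. apply Rinv_le_contravar; lra. }
  set (u := fun m => RInt f (/ INR (S m)) (INR (S m))).
  assert (Hu : forall m n, (m <= n)%nat -> u m <= u n).
  { intros m n Hmn. specialize (HS m) as H1. specialize (HI m) as H2. specialize (HI n) as H3.
    assert (INR (S m) <= INR (S n)) by (apply le_INR; lia).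
    apply Hmono; try lra. split; [lra|]. apply Rinv_le_contravar; lra. }
  destruct (ex_finite_lim_seq_incr u K) as [L HL].
  - intros n. apply Hu. lia.
  - intros n. apply HK. specialize (HS n). specialize (HI n). lra.
  - assert (HuL : forall m, u m <= L).
    { intros m. assert (H : Rbar_le (u m) L).
      { apply (is_lim_seq_le_loc (fun _ => u m) u); auto using is_lim_seq_const.
        exists m. intros n Hn. now apply Hu. }
      exact H. }
    assert (Hle : forall a b, 0 < a <= b -> RInt f a b <= L).
    { intros a b Hab. destruct (nfloor_ex (/ a + b)) as [m Hm].
      { assert (0 < / a) by (apply Rinv_0_lt_compat; lra). lra. }
      apply Rle_trans with (u m); auto.
      assert (Ha : 0 < / a) by (apply Rinv_0_lt_compat; lra).
      rewrite <- S_INR in Hm. apply Hmono; try lra.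
      split; [apply HI|]. rewrite <- (Rinv_inv a). apply Rinv_le_contravar; lra. }
    exists L. split; auto.
    intros P [eps HP].
    assert (HN : exists N, L - eps < u N).
    { apply is_lim_seq_spec in HL. destruct (HL eps) as [N HN]. exists N.
      specialize (HN N ltac:(lia)). apply Rabs_lt_between in HN. lra. }
    destruct HN as [N HN].
    apply (Filter_prod _ _ _ (fun a => 0 < a < / INR (S N)) (fun b => INR (S N) < b)).
    + exists (mkposreal _ (proj1 (HI N))). intros y Hy Hy0.
      change (Rabs (y - 0) < / INR (S N)) in Hy. apply Rabs_lt_between in Hy. lra.
    + exists (INR (S N)). auto.
    + intros a b Ha Hb. specialize (HS N) as H1. specialize (HI N) as H2.
      exists (RInt f a b). split.
      * apply (RInt_correct (V := R_CompleteNormedModule)). apply Hex. simpl. lra.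
      * apply HP. change (Rabs (RInt f a b - L) < eps).
        assert (L1 := Hle a b ltac:(lra)).
        assert (L2 : u N <= RInt f a b) by (apply Hmono; lra).
        apply Rabs_lt_between. generalize (cond_pos eps). lra.
Qed.

Definition gamma_integrand (x t : R) : R := Rpower t (x - 1) * exp (- t).

Lemma continuous_gamma_integrand x t : 0 < t -> continuous (gamma_integrand x) t.
Proof.
  intros Ht. apply (ex_derive_continuous (V := R_NormedModule) (gamma_integrand x)).
  unfold gamma_integrand, Rpower. auto_derive. auto.
Qed.

Lemma ex_RInt_gamma_integrand x a b : 0 < a <= b -> ex_RInt (gamma_integrand x) a b.
Proof.
  intros Hab. apply (ex_RInt_continuous (V := R_CompleteNormedModule)).
  intros z Hz. rewrite Rmin_left in Hz by lra. apply continuous_gamma_integrand. lra.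
Qed.

Lemma RInt_gamma_integrand_lin x y c d a b : 0 < a <= b ->
  RInt (fun t => c * gamma_integrand x t + d * gamma_integrand y t) a b = c * RInt (gamma_integrand x) a b + d * RInt (gamma_integrand y) a b.
Proof.
  intros Hab. apply is_RInt_unique.
  apply (is_RInt_plus (V := R_NormedModule) (fun t => c * gamma_integrand x t) (fun t => d * gamma_integrand y t));
    apply (is_RInt_scal (V := R_NormedModule)), (RInt_correct (V := R_CompleteNormedModule));
    now apply ex_RInt_gamma_integrand.
Qed.

Lemma gamma_integrand_recurrence x a b : 0 < a <= b ->
  RInt (gamma_integrand (x + 1)) a b =
  x * RInt (gamma_integrand x) a b - (Rpower b x * exp (- b) - Rpower a x * exp (- a)).
Proof.
  intros Hab.
  assert (H : RInt (fun t => x * gamma_integrand x t + -1 * gamma_integrand (x + 1) t) a b = Rpower b x * exp (- b) - Rpower a x * exp (- a)).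
  { apply is_RInt_unique.
    apply (is_RInt_derive (V := R_CompleteNormedModule) (fun t => Rpower t x * exp (- t))
      (fun t => x * gamma_integrand x t + -1 * gamma_integrand (x + 1) t)).
    - intros t Ht. rewrite Rmin_left in Ht by lra. unfold gamma_integrand, Rpower.
      replace ((x - 1) * ln t) with (x * ln t - ln t) by ring.
      replace ((x + 1 - 1) * ln t) with (x * ln t) by ring.
      unfold Rminus. rewrite exp_plus, exp_Ropp, exp_ln by lra.
      auto_derive; [lra|]. field. lra.
    - intros t Ht. rewrite Rmin_left in Ht by lra.
      apply (continuous_plus (fun t => x * gamma_integrand x t) (fun t => -1 * gamma_integrand (x + 1) t));
      apply (continuous_scal_r (V := R_NormedModule)), continuous_gamma_integrand; lra. }
  rewrite RInt_gamma_integrand_lin in H by auto. lra.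
Qed.

(** The concave function u^x lies below its tangent at 1. Two tangent bounds for exp, weighted by x
    and 1 - x, are added so that the terms in ln u cancel. *)
Lemma Rpower_bernoulli u x : 0 < u -> 0 <= x <= 1 -> Rpower u x <= 1 + x * (u - 1).
Proof.
  intros Hu Hx. unfold Rpower. set (l := ln u).
  assert (E : u = exp l) by (unfold l; rewrite exp_ln; lra). rewrite E.
  assert (H1 := exp_ge_1_add ((1 - x) * l)). assert (H2 := exp_ge_1_add (- (x * l))).
  assert (Hp := exp_pos (x * l)).
  assert (E1 : exp l = exp (x * l) * exp ((1 - x) * l)) by (rewrite <- exp_plus; f_equal; ring).
  assert (E2 : 1 = exp (x * l) * exp (- (x * l))) by (rewrite <- exp_plus, Rplus_opp_r, exp_0; ring).
  assert (A1 : exp (x * l) * (1 + (1 - x) * l) <= exp l) by (rewrite E1; apply Rmult_le_compat_l; lra).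
  assert (A2 : exp (x * l) * (1 - x * l) <= 1) by (rewrite E2 at 2; apply Rmult_le_compat_l; lra).
  assert (A3 : x * (exp (x * l) * (1 + (1 - x) * l)) <= x * exp l) by (apply Rmult_le_compat_l; lra).
  assert (A4 : (1 - x) * (exp (x * l) * (1 - x * l)) <= (1 - x) * 1) by (apply Rmult_le_compat_l; lra).
  lra.
Qed.

Lemma Rpower_bernoulli_neg u x : 0 < u -> x <= 1 -> 1 + (x - 1) * (u - 1) <= Rpower u (x - 1).
Proof.
  intros Hu Hx. unfold Rpower.
  assert (H := exp_ge_1_add ((x - 1) * ln u)). assert (H1 := ln_le_sub_1 u Hu). nra.
Qed.

(** Integration by parts removes the singular exponent x - 1. Then t^x <= 1 + t bounds the new
    integral by 2 and the boundary term at b by 1. *)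
Lemma RInt_gamma_integrand_bound x a b : 0 < x <= 1 -> 0 < a <= b -> RInt (gamma_integrand x) a b <= 3 / x.
Proof.
  intros Hx Hab. assert (H := gamma_integrand_recurrence x a b Hab).
  assert (HB : forall t, 0 < t -> Rpower t x <= 1 + t).
  { intros t Ht. assert (HR := Rpower_bernoulli t x Ht ltac:(lra)). nra. }
  assert (H1 : RInt (gamma_integrand (x + 1)) a b <= 2).
  { apply Rle_trans with (- (2 + b) * exp (- b) - - (2 + a) * exp (- a)).
    - assert (Hi : is_RInt (fun t => (1 + t) * exp (- t)) a b (- (2 + b) * exp (- b) - - (2 + a) * exp (- a))).
      { apply (is_RInt_derive (V := R_CompleteNormedModule) (fun t => - (2 + t) * exp (- t))).
        - intros t _. auto_derive; [auto|ring].
        - intros t _. apply (ex_derive_continuous (V := R_NormedModule) (fun t => (1 + t) * exp (- t))). auto_derive. auto. }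
      rewrite <- (is_RInt_unique _ _ _ _ Hi). apply RInt_le; [lra|now apply ex_RInt_gamma_integrand|eexists; exact Hi|].
      intros t Ht. unfold gamma_integrand. replace (x + 1 - 1) with x by ring.
      apply Rmult_le_compat_r; [left; apply exp_pos|]. apply HB. lra.
    - assert (0 < (2 + b) * exp (- b)) by (apply Rmult_lt_0_compat; [lra|apply exp_pos]).
      assert ((2 + a) * exp (- a) <= 2); [|lra].
      rewrite exp_Ropp. apply Rle_div_l; [apply exp_pos|]. generalize (exp_ge_1_add a). lra. }
  assert (H2 : Rpower b x * exp (- b) <= 1).
  { rewrite exp_Ropp. apply Rle_div_l; [apply exp_pos|]. assert (H3 := HB b ltac:(lra)).
    generalize (exp_ge_1_add b). lra. }
  assert (H3 : 0 < Rpower a x * exp (- a)) by (apply Rmult_lt_0_compat; apply exp_pos).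
  apply Rle_div_r; lra.
Qed.

(** Euler's integral truncated along one fixed sequence of intervals. Arguments above 1 are treated
    as limits of [gamma_seq] through the recurrence, so [Gamma] itself is evaluated only on (0,
    1]. *)
Definition gamma_seq (x : R) (m : nat) : R := RInt (gamma_integrand x) (/ INR (S m)) (INR (S m)).

Lemma gamma_seq_endpoints m : 0 < / INR (S m) <= INR (S m).
Proof.
  assert (H : 1 <= INR (S m)) by (apply (le_INR 1); lia).
  split; [apply Rinv_0_lt_compat; lra|]. apply Rle_trans with 1; auto.
  rewrite <- Rinv_1. apply Rinv_le_contravar; lra.
Qed.

Lemma is_lim_seq_gamma_seq x : 0 < x <= 1 -> is_lim_seq (gamma_seq x) (Gamma x).
Proof.
  intros Hx. destruct (is_RInt_gen_nonneg_bounded (gamma_integrand x) (3 / x)) as [L [H1 H2]].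
  - intros t _. left. apply Rmult_lt_0_compat; apply exp_pos.
  - apply continuous_gamma_integrand.
  - intros a b Hab. now apply RInt_gamma_integrand_bound.
  - replace (Gamma x) with L; [exact H2|]. symmetry. apply is_RInt_gen_unique. exact H1.
Qed.

Lemma is_lim_seq_boundary x : 0 < x ->
  is_lim_seq (fun m => Rpower (INR (S m)) x * exp (- INR (S m)) -
                       Rpower (/ INR (S m)) x * exp (- / INR (S m))) 0.
Proof.
  intros Hx. replace (Finite 0) with (Finite (0 - 0)) by (f_equal; ring).
  apply is_lim_seq_minus'.
  (* From ln (b / (2 x)) <= b / (2 x) - 1 one gets b^x exp (- b) <= C exp (- b / 2). *)
  - set (C := exp (x * (ln (2 * x) - 1))).
    apply is_lim_seq_le_le with (u := fun _ => 0) (w := fun m => 2 * C * / INR (S m)).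
    + intros m. assert (Hm : 0 < INR (S m)) by (apply lt_0_INR; lia). set (b := INR (S m)) in *.
      split; [left; apply Rmult_lt_0_compat; apply exp_pos|].
      assert (H := ln_le_sub_1 (b / (2 * x)) ltac:(apply Rdiv_lt_0_compat; lra)).
      rewrite ln_div in H by lra.
      unfold Rpower. rewrite <- exp_plus.
      assert (H1 : x * ln b + - b <= x * (ln (2 * x) - 1) + - (b / 2)).
      { apply Rmult_le_compat_l with (r := x) in H; [|lra].
        replace (x * (b / (2 * x) - 1)) with (b / 2 - x) in H by (field; lra). lra. }
      apply Rle_trans with (exp (x * (ln (2 * x) - 1) + - (b / 2))).
      { destruct H1 as [H1 | ->]; [left; now apply exp_increasing|lra]. }
      rewrite exp_plus. fold C. assert (0 < C) by apply exp_pos.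
      rewrite (Rmult_comm 2), Rmult_assoc. apply Rmult_le_compat_l; [lra|].
      replace (2 * / b) with (/ (b / 2)) by (field; lra).
      rewrite exp_Ropp. apply Rinv_le_contravar; [lra|]. generalize (exp_ge_1_add (b / 2)). lra.
    + apply is_lim_seq_const.
    + replace (Finite 0) with (Rbar_mult (2 * C) 0) by (simpl; f_equal; ring).
      apply is_lim_seq_scal_l, is_lim_seq_inv_INR_S.
  - apply is_lim_seq_le_le with (u := fun _ => 0) (w := fun m => exp (- (x * ln (INR (S m))))).
    + intros m. assert (Hm : 0 < INR (S m)) by (apply lt_0_INR; lia).
      split; [left; apply Rmult_lt_0_compat; apply exp_pos|].
      unfold Rpower. rewrite ln_Rinv by auto. rewrite Ropp_mult_distr_r.
      rewrite <- (Rmult_1_r (exp (x * - ln (INR (S m))))) at 2.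
      apply Rmult_le_compat_l; [left; apply exp_pos|].
      apply exp_neg_bounds. left. now apply Rinv_0_lt_compat.
    + apply is_lim_seq_const.
    + apply is_lim_comp_seq with (x := m_infty); [apply is_lim_exp_m|now exists O|].
      apply is_lim_seq_ext with (fun m => - x * ln (INR (S m))); [intros; ring|].
      replace m_infty with (Rbar_mult (- x) p_infty).
      2: { apply is_Rbar_mult_unique, is_Rbar_mult_sym, is_Rbar_mult_p_infty_neg. simpl. lra. }
      apply is_lim_seq_scal_l.
      apply is_lim_comp_seq with (x := p_infty); [apply is_lim_ln_p|now exists O|].
      apply (is_lim_seq_incr_1 INR), is_lim_seq_INR.
Qed.

Lemma is_lim_seq_gamma_seq_succ (x l : R) : 0 < x -> is_lim_seq (gamma_seq x) l -> is_lim_seq (gamma_seq (x + 1)) (x * l).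
Proof.
  intros Hx Hl.
  apply is_lim_seq_ext with (fun m => x * gamma_seq x m - (Rpower (INR (S m)) x * exp (- INR (S m)) -
                       Rpower (/ INR (S m)) x * exp (- / INR (S m)))).
  - intros m. symmetry. apply gamma_integrand_recurrence, gamma_seq_endpoints.
  - replace (Finite (x * l)) with (Finite (x * l - 0)) by (f_equal; ring).
    apply is_lim_seq_minus'; [|now apply is_lim_seq_boundary].
    apply (is_lim_seq_scal_l (gamma_seq x) x l Hl).
Qed.

Lemma is_lim_seq_gamma_seq_1 : is_lim_seq (gamma_seq 1) 1.
Proof.
  apply is_lim_seq_ext with (fun m => exp (- / INR (S m)) - exp (- INR (S m))).
  - intros m. symmetry. apply is_RInt_unique.
    replace (exp (- / INR (S m)) - exp (- INR (S m))) with (- exp (- INR (S m)) - - exp (- / INR (S m))) by ring.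
    apply is_RInt_ext with (fun t => exp (- t)).
    + intros t Ht. rewrite Rmin_left in Ht by apply gamma_seq_endpoints.
      generalize (gamma_seq_endpoints m). intros.
      unfold gamma_integrand. rewrite Rminus_diag, Rpower_O by lra. symmetry. apply Rmult_1_l.
    + apply (is_RInt_derive (V := R_CompleteNormedModule) (fun t => - exp (- t))).
      * intros t _. auto_derive; [auto|ring].
      * intros t _. apply (ex_derive_continuous (V := R_NormedModule) (fun t => exp (- t))). auto_derive. auto.
  - apply is_lim_seq_le_le with (u := fun m => 1 - / INR (S m) - / INR (S m)) (w := fun _ => 1).
    + intros m. assert (Hm : 0 < INR (S m)) by (apply lt_0_INR; lia).
      assert (H1 := exp_neg_bounds (/ INR (S m)) ltac:(left; now apply Rinv_0_lt_compat)).
      assert (H2 := exp_ge_1_add (- / INR (S m))). assert (H3 := exp_pos (- INR (S m))).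
      assert (H4 : exp (- INR (S m)) <= / INR (S m)).
      { rewrite exp_Ropp. apply Rinv_le_contravar; auto. generalize (exp_ge_1_add (INR (S m))). lra. }
      lra.
    + replace (Finite 1) with (Finite (1 - 0 - 0)) by (f_equal; ring).
      apply is_lim_seq_minus'; [|apply is_lim_seq_inv_INR_S].
      apply is_lim_seq_minus'; [apply is_lim_seq_const|apply is_lim_seq_inv_INR_S].
    + apply is_lim_seq_const.
Qed.

Lemma is_lim_seq_gamma_seq_fact n : is_lim_seq (gamma_seq (INR n + 1)) (INR (fact n)).
Proof.
  induction n as [|n IH].
  - simpl. rewrite Rplus_0_l. apply is_lim_seq_gamma_seq_1.
  - assert (H := is_lim_seq_gamma_seq_succ (INR n + 1) (INR (fact n)) ltac:(generalize (pos_INR n); lra) IH).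
    rewrite <- S_INR in H. rewrite fact_simpl, mult_INR. exact H.
Qed.

Fixpoint rising (x : R) (n : nat) : R :=
  match n with O => 1 | S m => rising x m * (INR m + x) end.

Lemma rising_pos x n : 0 < x -> 0 < rising x n.
Proof.
  intros Hx. induction n as [|n IH]; simpl; [lra|].
  apply Rmult_lt_0_compat; auto. generalize (pos_INR n). lra.
Qed.

Lemma ln_rising x n : 0 < x -> ln (rising x n) = rsum (fun k => ln (INR k + x)) n.
Proof.
  intros Hx. induction n as [|n IH]; simpl; [apply ln_1|].
  rewrite ln_mult, IH; auto using rising_pos. generalize (pos_INR n). lra.
Qed.

Lemma is_lim_seq_gamma_seq_rising x n : 0 < x <= 1 ->
  is_lim_seq (gamma_seq (INR n + x)) (rising x n * Gamma x).
Proof.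
  intros Hx. induction n as [|n IH].
  - simpl. rewrite Rplus_0_l, Rmult_1_l. now apply is_lim_seq_gamma_seq.
  - rewrite S_INR. replace (INR n + 1 + x) with (INR n + x + 1) by ring.
    simpl rising. replace (rising x n * (INR n + x) * Gamma x) with ((INR n + x) * (rising x n * Gamma x)) by ring.
    apply is_lim_seq_gamma_seq_succ; auto. generalize (pos_INR n). lra.
Qed.

(* Wendel's inequalities, from the tangent lines of t^x and t^(x-1) at the
   points where the error terms cancel. *)
Lemma rising_Gamma_bounds x n : 0 < x < 1 ->
  Rpower (INR n + 2) (x - 1) * INR (fact (S n)) <= rising x (S n) * Gamma x
  <= Rpower (INR n + 1) x * INR (fact n).
Proof.
  intros Hx. assert (Hn := pos_INR n).
  assert (HG := is_lim_seq_gamma_seq_rising x (S n) ltac:(lra)).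
  assert (F0 := is_lim_seq_gamma_seq_fact n). assert (F1 := is_lim_seq_gamma_seq_fact (S n)).
  assert (F2 := is_lim_seq_gamma_seq_fact (S (S n))).
  assert (S1 : forall c t, 0 < c -> 0 < t -> forall y, Rpower t y = Rpower c y * Rpower (t / c) y).
  { intros c t Hc Ht y. rewrite Rpower_mult_distr; auto using Rdiv_lt_0_compat.
    f_equal. field. lra. }
  assert (S2 : forall t y z, Rpower t (y + z) = Rpower t y * Rpower t z) by (intros; apply Rpower_plus).
  split.
  - set (c := INR n + 2). assert (Hc : 0 < c) by (unfold c; lra).
    set (K := Rpower c (x - 1)). assert (HK : 0 < K) by apply exp_pos.
    assert (L : is_lim_seq (fun m => K * (2 - x) * gamma_seq (INR (S n) + 1) m + K * (x - 1) / c * gamma_seq (INR (S (S n)) + 1) m)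
      (K * (2 - x) * INR (fact (S n)) + K * (x - 1) / c * INR (fact (S (S n))))).
    { apply is_lim_seq_plus'; [apply (is_lim_seq_scal_l _ _ _ F1)|apply (is_lim_seq_scal_l _ _ _ F2)]. }
    assert (E : K * (2 - x) * INR (fact (S n)) + K * (x - 1) / c * INR (fact (S (S n))) = K * INR (fact (S n))).
    { rewrite (fact_simpl (S n)), mult_INR. replace (INR (S (S n))) with c by (unfold c; rewrite !S_INR; ring). field. lra. }
    rewrite E in L.
    refine (is_lim_seq_le _ _ (K * INR (fact (S n))) (rising x (S n) * Gamma x) _ L HG).
    intros m. unfold gamma_seq. rewrite <- RInt_gamma_integrand_lin by apply gamma_seq_endpoints.
    assert (He := gamma_seq_endpoints m).
    apply RInt_le; [lra| |now apply ex_RInt_gamma_integrand|].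
    { apply (ex_RInt_plus (V := R_NormedModule) (fun t => K * (2 - x) * gamma_integrand (INR (S n) + 1) t));
        apply (ex_RInt_scal (V := R_NormedModule)); now apply ex_RInt_gamma_integrand. }
    intros t Ht. assert (Ht0 : 0 < t) by lra. unfold gamma_integrand.
    replace (INR (S n) + 1 - 1) with (INR n + 1) by (rewrite S_INR; ring).
    replace (INR (S (S n)) + 1 - 1) with (INR n + 1 + 1) by (rewrite !S_INR; ring).
    replace (INR (S n) + x - 1) with (INR n + 1 + (x - 1)) by (rewrite !S_INR; ring).
    rewrite !(S2 t (INR n + 1)). rewrite Rpower_1 by auto.
    rewrite (S1 c t Hc Ht0 (x - 1)). fold K.
    assert (HB := Rpower_bernoulli_neg (t / c) x ltac:(now apply Rdiv_lt_0_compat) ltac:(lra)).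
    set (w := Rpower t (INR n + 1)). assert (Hw : 0 < w) by apply exp_pos.
    assert (H0 := exp_pos (- t)).
    replace (K * (2 - x) * (w * exp (- t)) + K * (x - 1) / c * (w * t * exp (- t)))
      with (w * exp (- t) * K * (1 + (x - 1) * (t / c - 1))) by (field; lra).
    replace (w * (K * Rpower (t / c) (x - 1)) * exp (- t)) with (w * exp (- t) * K * Rpower (t / c) (x - 1)) by ring.
    apply Rmult_le_compat_l; auto. left. repeat apply Rmult_lt_0_compat; auto.
  - set (c := INR n + 1). assert (Hc : 0 < c) by (unfold c; lra).
    set (K := Rpower c x). assert (HK : 0 < K) by apply exp_pos.
    assert (L : is_lim_seq (fun m => K * (1 - x) * gamma_seq (INR n + 1) m + K * x / c * gamma_seq (INR (S n) + 1) m)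
      (K * (1 - x) * INR (fact n) + K * x / c * INR (fact (S n)))).
    { apply is_lim_seq_plus'; [apply (is_lim_seq_scal_l _ _ _ F0)|apply (is_lim_seq_scal_l _ _ _ F1)]. }
    assert (E : K * (1 - x) * INR (fact n) + K * x / c * INR (fact (S n)) = K * INR (fact n)).
    { rewrite (fact_simpl n), mult_INR. replace (INR (S n)) with c by (unfold c; rewrite !S_INR; ring). field. lra. }
    rewrite E in L.
    refine (is_lim_seq_le _ _ (rising x (S n) * Gamma x) (K * INR (fact n)) _ HG L).
    intros m. unfold gamma_seq. rewrite <- RInt_gamma_integrand_lin by apply gamma_seq_endpoints.
    assert (He := gamma_seq_endpoints m).
    apply RInt_le; [lra|now apply ex_RInt_gamma_integrand| |].
    { apply (ex_RInt_plus (V := R_NormedModule) (fun t => K * (1 - x) * gamma_integrand (INR n + 1) t));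
        apply (ex_RInt_scal (V := R_NormedModule)); now apply ex_RInt_gamma_integrand. }
    intros t Ht. assert (Ht0 : 0 < t) by lra. unfold gamma_integrand.
    replace (INR n + 1 - 1) with (INR n) by ring.
    replace (INR (S n) + 1 - 1) with (INR n + 1) by (rewrite !S_INR; ring).
    replace (INR (S n) + x - 1) with (INR n + x) by (rewrite !S_INR; ring).
    rewrite !(S2 t (INR n)). rewrite Rpower_1 by auto.
    rewrite (S1 c t Hc Ht0 x). fold K.
    assert (HB := Rpower_bernoulli (t / c) x ltac:(now apply Rdiv_lt_0_compat) ltac:(lra)).
    set (w := Rpower t (INR n)). assert (Hw : 0 < w) by apply exp_pos.
    assert (H0 := exp_pos (- t)).
    replace (K * (1 - x) * (w * exp (- t)) + K * x / c * (w * t * exp (- t)))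
      with (w * exp (- t) * K * (1 + x * (t / c - 1))) by (field; lra).
    replace (w * (K * Rpower (t / c) x) * exp (- t)) with (w * exp (- t) * K * Rpower (t / c) x) by ring.
    apply Rmult_le_compat_l; auto. left. repeat apply Rmult_lt_0_compat; auto.
Qed.

(** Logarithm of [rising_Gamma_bounds], whose lower bound also yields [Gamma x] > 0. The upper bound
    there is exactly the 0 here; the lower one costs (1 - x) ln (1 + 1/n) <= 1/n. *)
Lemma ln_Gamma_approx x n : 0 < x < 1 -> (0 < n)%nat ->
  0 <= ln (INR (fact n)) - (1 - x) * ln (INR n) - rsum (fun k => ln (INR k + x)) n - ln (Gamma x) <= / INR n.
Proof.
  intros Hx Hn. destruct n as [|n]; [lia|]. assert (H := rising_Gamma_bounds x n Hx).
  assert (Hp := pos_INR n).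
  assert (HF : 0 < INR (fact (S n))) by apply INR_fact_lt_0.
  assert (HF0 : 0 < INR (fact n)) by apply INR_fact_lt_0.
  assert (HR := rising_pos x (S n) (proj1 Hx)).
  assert (HG : 0 < rising x (S n) * Gamma x).
  { apply Rlt_le_trans with (2 := proj1 H). apply Rmult_lt_0_compat; auto. apply exp_pos. }
  assert (HGx : 0 < Gamma x).
  { apply Rmult_lt_reg_l with (rising x (S n)); auto. now rewrite Rmult_0_r. }
  destruct H as [H1 H2].
  assert (L1 : ln (Rpower (INR n + 2) (x - 1) * INR (fact (S n))) <= ln (rising x (S n) * Gamma x)).
  { destruct H1 as [H1 | ->]; [left; apply ln_increasing; auto; apply Rmult_lt_0_compat; auto; apply exp_pos|lra]. }
  assert (L2 : ln (rising x (S n) * Gamma x) <= ln (Rpower (INR n + 1) x * INR (fact n))).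
  { destruct H2 as [H2 | ->]; [left; now apply ln_increasing|lra]. }
  rewrite !ln_mult in L1, L2 by (auto; apply exp_pos).
  unfold Rpower in L1, L2. rewrite !ln_exp in L1, L2. rewrite ln_rising in L1, L2 by lra.
  assert (EF : ln (INR (fact (S n))) = ln (INR n + 1) + ln (INR (fact n))).
  { rewrite fact_simpl, mult_INR, S_INR. apply ln_mult; lra. }
  assert (L3 : ln (INR n + 2) <= ln (INR n + 1) + / (INR n + 1)).
  { assert (HL := ln_le_sub_1 ((INR n + 2) / (INR n + 1)) ltac:(apply Rdiv_lt_0_compat; lra)).
    rewrite ln_div in HL by lra.
    replace ((INR n + 2) / (INR n + 1) - 1) with (/ (INR n + 1)) in HL by (field; lra). lra. }
  rewrite S_INR. split; [lra|].
  assert (0 < / (INR n + 1)) by (apply Rinv_0_lt_compat; lra). nra.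
Qed.

(** * The sine product *)

(** Wallis-type integrals, the classical route to Euler's sine product: the ratio to the case x = 0
    tends to 1, and each step of the recurrence divides it by one factor 1 - x^2 / k^2. *)
Definition wint (x : R) (n : nat) : R := RInt (fun t => cos (2 * x * t) * cos t ^ n) 0 (PI / 2).

Lemma ex_RInt_wint x n : ex_RInt (fun t => cos (2 * x * t) * cos t ^ n) 0 (PI / 2).
Proof.
  apply (ex_RInt_continuous (V := R_CompleteNormedModule)). intros z _.
  apply (ex_derive_continuous (V := R_NormedModule) (fun t => cos (2 * x * t) * cos t ^ n)).
  auto_derive. auto.
Qed.

(* Integration by parts twice, through y'' = n (n - 1) y_(n-2) - n^2 y for y = cos^n. *)
Lemma wint_recurrence x n :
  (INR (n + 2) ^ 2 - 4 * x ^ 2) * wint x (n + 2) = INR (n + 2) * INR (n + 1) * wint x n.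
Proof.
  set (F := fun t => cos (2 * x * t) * (- INR (n + 2) * cos t ^ (n + 1) * sin t)
                     + 2 * x * sin (2 * x * t) * cos t ^ (n + 2)).
  set (f := fun t => INR (n + 2) * INR (n + 1) * (cos (2 * x * t) * cos t ^ n) +
                     - (INR (n + 2) ^ 2 - 4 * x ^ 2) * (cos (2 * x * t) * cos t ^ (n + 2))).
  assert (H : is_RInt f 0 (PI / 2) (F (PI / 2) - F 0)).
  { apply (is_RInt_derive (V := R_CompleteNormedModule) F f).
    - intros t _. unfold F, f.
      replace (n + 1)%nat with (S n) by lia. replace (n + 2)%nat with (S (S n)) by lia.
      auto_derive; [auto|]. rewrite !S_INR. simpl pred.
      set (c := cos t). set (s := sin t). assert (Hs : s * s = 1 - c * c).
      { unfold s, c. generalize (sin2_cos2 t). unfold Rsqr. lra. }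
      change (match n with 0%nat => 1 | S _ => INR n + 1 end) with (INR (S n)). rewrite S_INR.
      simpl pow. generalize (c ^ n). intros z.
      set (C := cos (2 * x * t)). set (S := sin (2 * x * t)). set (N := INR n).
      transitivity (C * (N + 2) * (N + 1) * z * (s * s) - C * (N + 2) * z * c * c + 4 * x ^ 2 * C * z * c * c).
      + ring.
      + rewrite Hs. ring.
    - intros t _. apply (ex_derive_continuous (V := R_NormedModule) f). unfold f. auto_derive. auto. }
  assert (H2 : is_RInt f 0 (PI / 2) (INR (n + 2) * INR (n + 1) * wint x n + - (INR (n + 2) ^ 2 - 4 * x ^ 2) * wint x (n + 2))).
  { apply (is_RInt_plus (V := R_NormedModule) (fun t => INR (n + 2) * INR (n + 1) * (cos (2 * x * t) * cos t ^ n))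
      (fun t => - (INR (n + 2) ^ 2 - 4 * x ^ 2) * (cos (2 * x * t) * cos t ^ (n + 2))));
    apply (is_RInt_scal (V := R_NormedModule)), (RInt_correct (V := R_CompleteNormedModule)), ex_RInt_wint. }
  assert (E := is_RInt_unique _ _ _ _ H). rewrite (is_RInt_unique _ _ _ _ H2) in E.
  unfold F in E. rewrite cos_PI2, sin_0, Rmult_0_r, sin_0 in E.
  rewrite !pow_i in E by lia. lra.
Qed.

Lemma wint_even_ratio x m :
  (INR (S m) ^ 2 - x ^ 2) * wint x (2 * S m) = INR (S m) * (INR m + 1 / 2) * wint x (2 * m).
Proof.
  assert (H := wint_recurrence x (2 * m)).
  replace (2 * m + 2)%nat with (2 * S m)%nat in H by lia.
  rewrite plus_INR, !mult_INR in H. simpl (INR 2) in H. simpl (INR 1) in H. rewrite !S_INR in *. lra.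
Qed.

Lemma wint_0_0 : wint 0 (2 * 0) = PI / 2.
Proof.
  unfold wint. simpl. rewrite (RInt_ext _ (fun _ => 1)).
  - rewrite RInt_const. change ((PI / 2 - 0) * 1 = PI / 2). ring.
  - intros t _. replace (2 * 0 * t) with 0 by ring. rewrite cos_0. apply Rmult_1_r.
Qed.

Lemma wint_0_pos m : 0 < wint 0 (2 * m).
Proof.
  induction m as [|m IH].
  - rewrite wint_0_0. generalize PI_RGT_0. lra.
  - assert (H := wint_even_ratio 0 m).
    assert (Hm := pos_INR m). rewrite S_INR in H.
    apply Rmult_lt_reg_l with ((INR m + 1) ^ 2 - 0 ^ 2); [nra|].
    rewrite Rmult_0_r, H. apply Rmult_lt_0_compat; auto. nra.
Qed.

(** The inequality t <= tan t, in a form that survives at PI / 2. *)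
Lemma mul_cos_le_sin t : 0 <= t <= PI / 2 -> 0 <= t * cos t <= sin t.
Proof.
  intros Ht. split.
  - apply Rmult_le_pos; [lra|]. apply cos_ge_0; generalize PI_RGT_0; lra.
  - assert (H := nondecreasing_of_derive (fun t => sin t - t * cos t) (fun t => t * sin t) 0 t (proj1 Ht)
      ltac:(intros; auto_derive; [auto|ring])).
    cbv beta in H. rewrite sin_0, Rmult_0_l, Rminus_0_r in H.
    assert (0 <= sin t - t * cos t); [|lra]. apply H.
    intros c Hc. apply Rmult_le_pos; [lra|]. apply sin_ge_0; generalize PI_RGT_0; lra.
Qed.

(** Above, cos <= 1. Below, cos y >= 1 - y^2 / 2 together with t^2 cos^2 t <= 1 - cos^2 t turns the
    loss into 2 x^2 times the difference of [wint 0] at 2m and 2m + 2, which the recurrence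
    evaluates exactly. *)
Lemma wint_ratio_bounds x m : 0 < x < 1 ->
  wint 0 (2 * S m) * (1 - 2 * x ^ 2 / (2 * INR m + 1)) <= wint x (2 * S m) <= wint 0 (2 * S m).
Proof.
  intros Hx. assert (HP := PI_RGT_0). assert (Hm := pos_INR m).
  assert (HC : forall t, 0 < t < PI / 2 -> 0 <= cos t) by (intros t Ht; apply cos_ge_0; lra).
  assert (E0 : forall t, cos (2 * 0 * t) = 1) by (intros t; replace (2 * 0 * t) with 0 by ring; apply cos_0).
  split.
  - assert (HI : is_RInt (fun t => (1 + 2 * x ^ 2) * (cos (2 * 0 * t) * cos t ^ (2 * S m)) +
        - (2 * x ^ 2) * (cos (2 * 0 * t) * cos t ^ (2 * m))) 0 (PI / 2)
        ((1 + 2 * x ^ 2) * wint 0 (2 * S m) + - (2 * x ^ 2) * wint 0 (2 * m))).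
    { apply (is_RInt_plus (V := R_NormedModule) (fun t => (1 + 2 * x ^ 2) * (cos (2 * 0 * t) * cos t ^ (2 * S m)))
        (fun t => - (2 * x ^ 2) * (cos (2 * 0 * t) * cos t ^ (2 * m))));
      apply (is_RInt_scal (V := R_NormedModule)), (RInt_correct (V := R_CompleteNormedModule)), ex_RInt_wint. }
    replace (wint 0 (2 * S m) * (1 - 2 * x ^ 2 / (2 * INR m + 1)))
      with ((1 + 2 * x ^ 2) * wint 0 (2 * S m) + - (2 * x ^ 2) * wint 0 (2 * m)).
    + rewrite <- (is_RInt_unique _ _ _ _ HI). apply RInt_le; [lra|eexists; exact HI|apply ex_RInt_wint|].
      intros t Ht. rewrite !E0. assert (Hc := HC t Ht).
      assert (B := proj1 (cos_taylor_bounds (2 * x * t) ltac:(nra))).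
      assert (B2 := mul_cos_le_sin t ltac:(lra)).
      assert (Hs : sin t ^ 2 = 1 - cos t ^ 2) by (generalize (sin2_cos2 t); unfold Rsqr; lra).
      assert (B3 : t ^ 2 * cos t ^ 2 <= 1 - cos t ^ 2) by (rewrite <- Hs, <- Rpow_mult_distr; apply pow_incr; lra).
      replace (2 * S m)%nat with (2 * m + 2)%nat by lia. rewrite pow_add.
      assert (Hz : 0 <= cos t ^ (2 * m)) by (apply pow_le; auto).
      set (z := cos t ^ (2 * m)) in *. set (c2 := cos t ^ 2) in *.
      assert (Hc2 : 0 <= c2) by (unfold c2; apply pow_le; auto).
      apply Rle_trans with ((1 - (2 * x * t) ^ 2 / 2) * (z * c2)).
      * replace ((1 + 2 * x ^ 2) * (1 * (z * c2)) + - (2 * x ^ 2) * (1 * z)) with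
          ((c2 - 2 * x ^ 2 * (1 - c2)) * z) by ring.
        replace ((1 - (2 * x * t) ^ 2 / 2) * (z * c2)) with ((c2 - 2 * x ^ 2 * (t ^ 2 * c2)) * z) by field.
        apply Rmult_le_compat_r; auto. assert (0 <= x ^ 2) by (apply pow_le; lra). nra.
      * apply Rmult_le_compat_r; auto. apply Rmult_le_pos; auto.
    + assert (H := wint_even_ratio 0 m). rewrite S_INR in H.
      assert (E : wint 0 (2 * m) = wint 0 (2 * S m) * (INR m + 1) / (INR m + 1 / 2)).
      { apply Rmult_eq_reg_l with ((INR m + 1) * (INR m + 1 / 2)); [|nra]. rewrite <- H. field. lra. }
      rewrite E. field. lra.
  - apply RInt_le; [lra|apply ex_RInt_wint|apply ex_RInt_wint|].
    intros t Ht. apply Rmult_le_compat_r; [apply pow_le; auto|]. rewrite E0. apply COS_bound.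
Qed.

Lemma wint_product x m : 0 < x < 1 ->
  wint x (2 * m) / wint 0 (2 * m) > 0 /\
  ln (wint x (2 * m) / wint 0 (2 * m)) =
    ln (sin (PI * x) / (PI * x)) - rsum (fun k => ln (1 - x ^ 2 / INR (S k) ^ 2)) m.
Proof.
  intros Hx. assert (HP := PI_RGT_0).
  assert (Hs : 0 < sin (PI * x)) by (apply sin_gt_0; nra).
  induction m as [|m [IHp IH]].
  - assert (E : wint x (2 * 0) = sin (PI * x) / (2 * x)).
    { unfold wint. simpl. apply is_RInt_unique.
      replace (sin (PI * x) / (2 * x)) with (sin (2 * x * (PI / 2)) / (2 * x) - sin (2 * x * 0) / (2 * x)).
      2: { rewrite Rmult_0_r, sin_0. replace (2 * x * (PI / 2)) with (PI * x) by field. field. lra. }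
      apply (is_RInt_derive (V := R_CompleteNormedModule) (fun t => sin (2 * x * t) / (2 * x))).
      - intros t _. auto_derive; [auto|]. field. lra.
      - intros t _. apply (ex_derive_continuous (V := R_NormedModule) (fun t => cos (2 * x * t) * 1)). auto_derive. auto. }
    assert (E0 : wint 0 (2 * 0) = PI / 2).
    { apply wint_0_0. }
    rewrite E, E0. replace (sin (PI * x) / (2 * x) / (PI / 2)) with (sin (PI * x) / (PI * x)) by (field; lra).
    split; [apply Rdiv_lt_0_compat; nra|]. simpl. ring.
  - assert (H := wint_even_ratio x m).
    assert (H0 := wint_even_ratio 0 m).
    assert (W0 := wint_0_pos m). assert (W1 := wint_0_pos (S m)).
    assert (Hn : 1 <= INR (S m)) by (apply (le_INR 1); lia).
    assert (Hm := pos_INR m).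
    set (n := INR (S m)) in *.
    assert (Hu : 0 < 1 - x ^ 2 / n ^ 2).
    { assert (x ^ 2 / n ^ 2 < 1); [|lra]. apply Rlt_div_l; [nra|]. nra. }
    assert (E : wint x (2 * S m) / wint 0 (2 * S m) = wint x (2 * m) / wint 0 (2 * m) / (1 - x ^ 2 / n ^ 2)).
    { assert (E1 : wint x (2 * S m) = n * (INR m + 1 / 2) * wint x (2 * m) / (n ^ 2 - x ^ 2)).
      { rewrite <- H. field. nra. }
      assert (E2 : wint 0 (2 * S m) = n * (INR m + 1 / 2) * wint 0 (2 * m) / n ^ 2).
      { rewrite <- H0. field. lra. }
      rewrite E1, E2. field. repeat split; nra. }
    rewrite E. split; [apply Rdiv_lt_0_compat; lra|].
    rewrite ln_div by lra. rewrite IH.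
    change (rsum (fun k => ln (1 - x ^ 2 / INR (S k) ^ 2)) (S m))
      with (rsum (fun k => ln (1 - x ^ 2 / INR (S k) ^ 2)) m + ln (1 - x ^ 2 / n ^ 2)). ring.
Qed.

Lemma sine_product_approx x m : 0 < x <= 1 / 2 ->
  Rabs (rsum (fun k => ln (1 - x ^ 2 / INR (S k) ^ 2)) (S m) - ln (sin (PI * x) / (PI * x))) <= / INR (S m).
Proof.
  intros Hx. destruct (wint_product x (S m) ltac:(lra)) as [Hp HE].
  assert (HB := wint_ratio_bounds x m ltac:(lra)). assert (W := wint_0_pos (S m)). assert (Hm := pos_INR m).
  set (rho := wint x (2 * S m) / wint 0 (2 * S m)) in *.
  assert (Er : wint x (2 * S m) = wint 0 (2 * S m) * rho) by (unfold rho; field; lra).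
  rewrite Er in HB.
  set (u := 2 * x ^ 2 / (2 * INR m + 1)) in *.
  (* [x <= 1 / 2] makes 2 x^2 at most 1/2, hence u <= 1/2, where 1 / (1 - u) <= 1 + 2 u. *)
  assert (Hu : 0 <= u <= / (2 * (2 * INR m + 1))).
  { unfold u. split; [apply Rdiv_le_0_compat; nra|]. rewrite Rinv_mult.
    apply Rmult_le_compat_r; [left; apply Rinv_0_lt_compat; lra|nra]. }
  assert (Hu2 : / (2 * (2 * INR m + 1)) <= / 2) by (apply Rinv_le_contravar; lra).
  assert (R1 : 1 - u <= rho) by (apply Rmult_le_reg_l with (wint 0 (2 * S m)); lra).
  assert (R2 : rho <= 1) by (apply Rmult_le_reg_l with (wint 0 (2 * S m)); lra).
  assert (L1 : ln rho <= 0) by (generalize (ln_le_sub_1 rho ltac:(lra)); lra).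
  assert (L2 : - (2 * u) <= ln rho).
  { assert (H := ln_le_sub_1 (/ rho) ltac:(apply Rinv_0_lt_compat; lra)). rewrite ln_Rinv in H by lra.
    assert (/ rho <= 1 + 2 * u); [|lra].
    apply Rmult_le_reg_l with rho; [lra|]. rewrite Rinv_r by lra. nra. }
  assert (L3 : 2 * u <= / INR (S m)).
  { apply Rle_trans with (2 * / (2 * (2 * INR m + 1))); [lra|].
    rewrite Rinv_mult, <- Rmult_assoc, Rinv_r, Rmult_1_l by lra. rewrite S_INR.
    apply Rinv_le_contravar; lra. }
  rewrite HE in L1, L2. apply Rabs_le. assert (0 < / INR (S m)) by (apply Rinv_0_lt_compat, lt_0_INR; lia). lra.
Qed.

(** * The value of the logarithmic series *)

Lemma ln_fact n : ln (INR (fact n)) = rsum (fun k => ln (INR (S k))) n.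
Proof.
  induction n as [|n IH]; [simpl; apply ln_1|].
  change (rsum (fun k => ln (INR (S k))) (S n)) with (rsum (fun k => ln (INR (S k))) n + ln (INR (S n))).
  rewrite <- IH, fact_simpl, mult_INR, ln_mult; [ring|apply lt_0_INR; lia|apply INR_fact_lt_0].
Qed.

(** The sum over k + 1/3 comes from Gauss's limit. The sine product at 1/3 plays the part of the
    reflection formula: it gives the sum of both families, so Gamma (2/3) never appears. *)
Lemma ln_ratio_sum_approx n : (0 < n)%nat ->
  Rabs (rsum (fun k => ln (INR k + 2 / 3) - ln (INR k + 1 / 3)) n - 1 / 3 * ln (INR n)
        - (2 * ln (Gamma (1 / 3)) + 1 / 2 * ln 3 - ln (2 * PI))) <= 4 / INR n.
Proof.
  intros Hn. assert (HG := ln_Gamma_approx (1 / 3) n ltac:(lra) Hn).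
  destruct n as [|m]; [lia|]. assert (HS := sine_product_approx (1 / 3) m ltac:(lra)).
  set (n := S m) in *. assert (HP := PI_RGT_0).
  assert (Hn1 : 1 <= INR n) by (apply (le_INR 1); lia).
  (* Each factor is (k + 2/3) (k + 4/3) / (k + 1)^2. Shifting the numbers k + 4/3 back to k + 1/3
     adds the last term and removes the first. *)
  assert (E : rsum (fun k => ln (1 - (1 / 3) ^ 2 / INR (S k) ^ 2)) n =
    rsum (fun k => ln (INR k + 2 / 3)) n + (rsum (fun k => ln (INR k + 1 / 3)) n + ln (INR n + 1 / 3) - ln (1 / 3))
      - 2 * ln (INR (fact n))).
  { assert (E1 : rsum (fun k => ln (INR k + 1 / 3)) n + ln (INR n + 1 / 3) - ln (1 / 3)
      = rsum (fun k => ln (INR (S k) + 1 / 3)) n).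
    { assert (E2 := rsum_succ_l (fun k => ln (INR k + 1 / 3)) n). simpl (INR 0) in E2.
      change (rsum (fun k => ln (INR k + 1 / 3)) (S n))
        with (rsum (fun k => ln (INR k + 1 / 3)) n + ln (INR n + 1 / 3)) in E2.
      rewrite E2, Rplus_0_l. ring. }
    rewrite E1, ln_fact, <- rsum_scal, <- rsum_plus, <- rsum_minus. apply rsum_ext. intros k _.
    assert (Hk := pos_INR k). rewrite S_INR.
    replace (1 - (1 / 3) ^ 2 / (INR k + 1) ^ 2)
      with ((INR k + 2 / 3) * (INR k + 1 + 1 / 3) / ((INR k + 1) * (INR k + 1))) by (field; lra).
    rewrite ln_div, !ln_mult by nra. ring. }
  rewrite E in HS.
  assert (Es : ln (sin (PI * (1 / 3)) / (PI * (1 / 3))) = ln 3 + 1 / 2 * ln 3 - ln (2 * PI)).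
  { replace (PI * (1 / 3)) with (PI / 3) by field. rewrite sin_PI3.
    assert (H3 := sqrt_lt_R0 3 ltac:(lra)).
    replace (sqrt 3 / 2 / (PI / 3)) with (3 * sqrt 3 / (2 * PI)) by (field; lra).
    rewrite ln_div, ln_mult by lra.
    assert (ln 3 = 2 * ln (sqrt 3)); [|lra].
    rewrite <- (sqrt_sqrt 3) at 1 by lra. rewrite ln_mult by auto. ring. }
  rewrite Es in HS.
  assert (El : ln (1 / 3) = - ln 3) by (rewrite ln_div, ln_1 by lra; ring). rewrite El in HS.
  assert (L : 0 <= ln (INR n + 1 / 3) - ln (INR n) <= / INR n / 3).
  { split.
    - assert (ln (INR n) < ln (INR n + 1 / 3)) by (apply ln_increasing; lra). lra.
    - assert (H := ln_le_sub_1 ((INR n + 1 / 3) / INR n) ltac:(apply Rdiv_lt_0_compat; lra)).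
      rewrite ln_div in H by lra. replace ((INR n + 1 / 3) / INR n - 1) with (/ INR n / 3) in H by (field; lra). lra. }
  rewrite rsum_minus. apply Rabs_le_between in HS. apply Rabs_le. unfold Rdiv in *.
  assert (0 < / INR n) by (apply Rinv_0_lt_compat; lra). lra.
Qed.

(** Minus the derivative at e = 0 of [power_term e k] below, so its sum is the sought difference of
    first Stieltjes constants. *)
Definition log_term (k : nat) : R :=
  ln (INR k + 1 / 3) / (INR k + 1 / 3) - ln (INR k + 2 / 3) / (INR k + 2 / 3).

Lemma log_term_sum J : rsum log_term J = 3 * chi_log_sum J - 3 * ln 3 * chi_inv_sum J.
Proof.
  unfold chi_log_sum, chi_inv_sum. rewrite <- !rsum_scal, <- rsum_minus.
  apply rsum_ext. intros k _. unfold log_term, nat1, nat2. assert (Hk := pos_INR k).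
  replace (INR k + 1 / 3) with ((3 * INR k + 1) / 3) by field.
  replace (INR k + 2 / 3) with ((3 * INR k + 2) / 3) by field.
  rewrite !ln_div by lra. field. lra.
Qed.

Lemma log_term_sum_approx j :
  Rabs (rsum log_term (4 ^ j) -
        - (PI / (2 * sqrt 3)) * (2 * euler_gamma - ln 3 + 8 * ln (2 * PI) - 12 * ln (Gamma (1 / 3))))
  <= 200 / 2 ^ j.
Proof.
  assert (H1 := chi_log_sum_approx j).
  assert (HJ : (0 < 4 ^ j)%nat) by (apply Nat.neq_0_lt_0, Nat.pow_nonzero; lia).
  assert (HN : (0 < 2 ^ j)%nat) by (apply Nat.neq_0_lt_0, Nat.pow_nonzero; lia).
  assert (H2 := chi_inv_sum_approx (4 ^ j) HJ). assert (H3 := ln_ratio_sum_approx (2 ^ j) HN).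
  set (x := 2 ^ j) in *. assert (Hx : 1 <= x) by (apply pow_R1_Rle; lra).
  assert (EN : INR (2 ^ j) = x) by (rewrite pow_INR; reflexivity).
  assert (EJ : INR (4 ^ j) = x * x).
  { rewrite pow_INR. unfold x. rewrite <- Rpow_mult_distr. f_equal. simpl. ring. }
  rewrite EN in H3. rewrite EJ in H2. assert (HP := PI_RGT_0). assert (HP4 := PI_4).
  destruct sqrt3_bounds as [Hs _].
  rewrite log_term_sum. rewrite (ln_mult (2 * PI)) in H1 by lra.
  set (D := rsum _ (2 ^ j)) in *. set (G := ln (Gamma (1 / 3))) in *.
  set (A := chi_log_sum (4 ^ j)) in *. set (B := chi_inv_sum (4 ^ j)) in *.
  (* The errors of the three approximations. They enter with factors 3, 3 PI / sqrt 3 <= 8 and 3 ln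
     3 <= 6, giving at most 150 + 32 + 12 < 200 over 2^j. *)
  set (r1 := A + _ - _) in H1. set (r3 := D - _ - _) in H3. set (r2 := B - _) in H2.
  match goal with |- Rabs ?y <= _ =>
    replace y with (3 * r1 + 3 * (PI / sqrt 3) * r3 - 3 * ln 3 * r2) by (unfold r1, r2, r3; field; lra) end.
  assert (Hi : 0 < / x <= 1).
  { split; [apply Rinv_0_lt_compat; lra|]. rewrite <- Rinv_1. apply Rinv_le_contravar; lra. }
  assert (Hq : 0 < PI / sqrt 3 <= 8 / 3).
  { split; [apply Rdiv_lt_0_compat; lra|]. apply Rle_div_l; lra. }
  assert (Hl3 : 0 <= ln 3 <= 2).
  { split; [rewrite <- ln_1; left; apply ln_increasing; lra|]. generalize (ln_le_sub_1 3). lra. }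
  assert (B2 : 2 / (x * x) <= 2 * / x).
  { unfold Rdiv. rewrite Rinv_mult. nra. }
  unfold Rdiv in H1, H3 |- *.
  assert (M3 : Rabs (3 * (PI * / sqrt 3) * r3) <= 32 * / x).
  { rewrite Rabs_mult, Rabs_right by (unfold Rdiv in Hq; lra). assert (Hp := Rabs_pos r3). unfold Rdiv in Hq. nra. }
  assert (M2 : Rabs (3 * ln 3 * r2) <= 12 * / x).
  { rewrite Rabs_mult, Rabs_right by lra. assert (Hp := Rabs_pos r2). nra. }
  apply Rabs_le_between in H1, M2, M3. apply Rabs_le. lra.
Qed.

(** The estimate is available only at the indices 4^j, so the limit is assumed to exist and its
    value is read off along this subsequence; existence is [ex_finite_lim_log_term]. *)
Lemma log_term_sum_limit (l : R) : is_lim_seq (rsum log_term) l ->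
  l = - (PI / (2 * sqrt 3)) * (2 * euler_gamma - ln 3 + 8 * ln (2 * PI) - 12 * ln (Gamma (1 / 3))).
Proof.
  intros Hl. set (v := - (PI / (2 * sqrt 3)) * _).
  assert (H1 : is_lim_seq (fun j => rsum log_term (4 ^ j)) l).
  { apply (is_lim_seq_subseq (rsum log_term) l (fun j => (4 ^ j)%nat)); auto.
    apply eventually_subseq. intros j. apply Nat.pow_lt_mono_r; lia. }
  assert (Hz : is_lim_seq (fun j => 200 / 2 ^ j) 0).
  { apply is_lim_seq_ext with (fun j => 200 * (/ 2) ^ j); [intros j; rewrite pow_inv; reflexivity|].
    replace (Finite 0) with (Rbar_mult 200 0) by (simpl; f_equal; ring).
    apply is_lim_seq_scal_l, is_lim_seq_geom. rewrite Rabs_right; lra. }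
  assert (H2 : is_lim_seq (fun j => rsum log_term (4 ^ j)) v).
  { apply is_lim_seq_le_le with (u := fun j => v - 200 / 2 ^ j) (w := fun j => v + 200 / 2 ^ j).
    - intros j. assert (H := log_term_sum_approx j). apply Rabs_le_between in H. fold v in H. lra.
    - replace (Finite v) with (Finite (v - 0)) by (f_equal; ring).
      apply is_lim_seq_minus'; [apply is_lim_seq_const|exact Hz].
    - replace (Finite v) with (Finite (v + 0)) by (f_equal; ring).
      apply is_lim_seq_plus'; [apply is_lim_seq_const|exact Hz]. }
  apply is_lim_seq_unique in H1, H2. rewrite H1 in H2. now injection H2.
Qed.

(** * First Laurent coefficients *)

(* Chosen so that - log_majorant' = (3 ln^2 + 2) / x^2 dominates the second-order
   remainder of x^(-1-eps) in eps: the remainders then telescope over k. *)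
Definition log_majorant (x : R) : R := (3 * ln x ^ 2 + 6 * ln x + 8) / x.

Lemma is_derive_log_majorant x : 0 < x ->
  is_derive log_majorant x (- ((3 * ln x ^ 2 + 2) / x ^ 2)).
Proof. intros Hx. unfold log_majorant. auto_derive; [lra|]. field. lra. Qed.

Lemma log_majorant_pos x : 0 < x -> 0 < log_majorant x.
Proof. intros Hx. apply Rdiv_lt_0_compat; auto. nra. Qed.

Lemma log_majorant_antitone x y : 0 < x <= y -> log_majorant y <= log_majorant x.
Proof.
  intros Hxy. assert (H := nondecreasing_of_derive (fun x => - log_majorant x) (fun x => (3 * ln x ^ 2 + 2) / x ^ 2) x y (proj2 Hxy)).
  assert (- log_majorant x <= - log_majorant y); [|lra]. apply H.
  - intros c Hc. rewrite <- (Ropp_involutive ((3 * ln c ^ 2 + 2) / c ^ 2)).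
    apply (is_derive_opp log_majorant). apply is_derive_log_majorant. lra.
  - intros c Hc. apply Rdiv_le_0_compat; nra.
Qed.

Lemma Rabs_increment_le_log_majorant (f f' : R -> R) c x y : 0 < x <= y ->
  (forall t, x <= t <= y -> is_derive f t (f' t)) ->
  (forall t, x <= t <= y -> Rabs (f' t) <= c * ((3 * ln t ^ 2 + 2) / t ^ 2)) ->
  Rabs (f y - f x) <= c * (log_majorant x - log_majorant y).
Proof.
  intros Hxy Hf Hb.
  replace (c * (log_majorant x - log_majorant y)) with (- c * log_majorant y - - c * log_majorant x) by ring.
  apply (Rabs_increment_le_of_derive f f' (fun x => - c * log_majorant x) (fun t => - c * - ((3 * ln t ^ 2 + 2) / t ^ 2))); try lra; auto.
  - intros t Ht. apply is_derive_scal, is_derive_log_majorant. lra.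
  - intros t Ht. rewrite Rmult_opp_opp. apply Hb. lra.
Qed.

(** Applied to y = e ln t with e <= 1/4 and t >= 1/3, where ln t >= -2; this is where the range -1/2
    <= y comes from. *)
Lemma exp_opp_taylor y : -1 / 2 <= y -> 0 <= exp (- y) - 1 + y <= 2 * y ^ 2.
Proof.
  intros Hy. assert (H1 := exp_ge_1_add (- y)). split; [lra|].
  assert (H2 := exp_ge_1_add y). rewrite exp_Ropp.
  assert (/ exp y <= / (1 + y)) by (apply Rinv_le_contravar; lra).
  assert (/ (1 + y) <= 1 - y + 2 * y ^ 2); [|lra].
  apply Rmult_le_reg_r with (1 + y); [lra|]. rewrite Rinv_l by lra. nra.
Qed.

(** What x^(-1-e) leaves after its first-order expansion in e. Its increments in x are what gets
    bounded: they are O(e^2 ln^2 x / x^2) per unit step and summable, unlike the bound e^2 ln^2 x /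
    x for single values. *)
Definition power_remainder (e x : R) : R := exp (- ((1 + e) * ln x)) - / x + e * (ln x / x).

Lemma power_remainder_increment e x y : 0 < e <= 1 / 4 -> 1 / 3 <= x <= y ->
  Rabs (power_remainder e y - power_remainder e x) <= e ^ 2 * (log_majorant x - log_majorant y).
Proof.
  intros He Hxy.
  apply (Rabs_increment_le_log_majorant _ (fun t => / t ^ 2 * ((1 + e) * (1 - exp (- (e * ln t))) - e * ln t))); [lra| |].
  - intros t Ht. unfold power_remainder. auto_derive; [lra|].
    replace (- ((1 + e) * ln t)) with (- ln t + - (e * ln t)) by ring.
    rewrite exp_plus, exp_Ropp, exp_ln by lra. field. lra.
  - intros t Ht. set (L := ln t).
    assert (HL : -2 <= L).
    { assert (H := ln_le_sub_1 (/ t) ltac:(apply Rinv_0_lt_compat; lra)). rewrite ln_Rinv in H by lra.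
      assert (/ t <= / (1 / 3)) by (apply Rinv_le_contravar; lra).
      replace (/ (1 / 3)) with 3 in * by field. unfold L. lra. }
    assert (HT := exp_opp_taylor (e * L) ltac:(nra)).
    set (E := exp (- (e * L))) in *.
    rewrite Rabs_mult, Rabs_right by (left; apply Rinv_0_lt_compat; nra).
    replace (e ^ 2 * ((3 * L ^ 2 + 2) / t ^ 2)) with (/ t ^ 2 * (e ^ 2 * (3 * L ^ 2 + 2))) by (field; lra).
    apply Rmult_le_compat_l; [left; apply Rinv_0_lt_compat; nra|].
    (* The first-order terms in e cancel. The Taylor part is at most 2 (1 + e) e^2 L^2 <= (5/2) e^2
       L^2, and |L| <= (L^2 + 1) / 2 adds the rest, which explains the coefficient 3 in
       [log_majorant]. *)
    replace ((1 + e) * (1 - E) - e * L) with (e ^ 2 * L - (1 + e) * (E - 1 + e * L)) by ring.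
    rewrite Rpow_mult_distr in HT.
    assert (HZ : 0 <= (1 + e) * (E - 1 + e * L) <= 5 / 2 * (e ^ 2 * L ^ 2)) by (split; nra).
    assert (He2 : 0 < e ^ 2) by nra.
    assert (HLb : - (1 / 2 * L ^ 2 + 1 / 2) <= L <= 1 / 2 * L ^ 2 + 1 / 2) by (generalize (pow2_ge_0 (L + 1)) (pow2_ge_0 (L - 1)); split; nra).
    assert (e ^ 2 * - (1 / 2 * L ^ 2 + 1 / 2) <= e ^ 2 * L <= e ^ 2 * (1 / 2 * L ^ 2 + 1 / 2)).
    { split; apply Rmult_le_compat_l; lra. }
    apply Rabs_le. split; nra.
Qed.

(** Since |1 - ln t| <= 3 ln^2 t + 2, the majorant built for the remainders also controls the sum of
    [log_term]. *)
Lemma log_over_increment x y : 0 < x <= y ->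
  Rabs (ln y / y - ln x / x) <= log_majorant x - log_majorant y.
Proof.
  intros Hxy. rewrite <- (Rmult_1_l (log_majorant x - log_majorant y)).
  apply (Rabs_increment_le_log_majorant (fun t => ln t / t) (fun t => / t ^ 2 * (1 - ln t))); auto.
  - intros t Ht. auto_derive; [lra|]. field. lra.
  - intros t Ht. rewrite Rabs_mult, Rabs_right by (left; apply Rinv_0_lt_compat; nra).
    replace (1 * ((3 * ln t ^ 2 + 2) / t ^ 2)) with (/ t ^ 2 * (3 * ln t ^ 2 + 2)) by (field; lra).
    apply Rmult_le_compat_l; [left; apply Rinv_0_lt_compat; nra|]. apply Rabs_le. split; nra.
Qed.

(** The step runs to k + 4/3 and not just to k + 2/3, so that consecutive steps telescope;
    monotonicity of the majorant allows the enlargement. *)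
Definition majorant_step (k : nat) : R :=
  log_majorant (INR k + 1 / 3) - log_majorant (INR (S k) + 1 / 3).

Lemma majorant_step_bounds k :
  0 <= majorant_step k /\
  log_majorant (INR k + 1 / 3) - log_majorant (INR k + 2 / 3) <= majorant_step k.
Proof.
  unfold majorant_step. rewrite S_INR. assert (Hk := pos_INR k).
  assert (H1 := log_majorant_antitone (INR k + 1 / 3) (INR k + 2 / 3) ltac:(lra)).
  assert (H2 := log_majorant_antitone (INR k + 2 / 3) (INR k + 1 + 1 / 3) ltac:(lra)). lra.
Qed.

Lemma majorant_step_sum n : rsum majorant_step n <= log_majorant (1 / 3).
Proof.
  unfold majorant_step. rewrite (rsum_telescope (fun k => log_majorant (INR k + 1 / 3))).
  simpl (INR 0). rewrite Rplus_0_l. assert (H := log_majorant_pos (INR n + 1 / 3) ltac:(generalize (pos_INR n); lra)). lra.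
Qed.

(** Both [majorant_step] and [log_term + majorant_step] are nonnegative with bounded sums, so
    monotone convergence applies to each and the difference converges. *)
Lemma ex_finite_lim_log_term : ex_finite_lim_seq (rsum log_term).
Proof.
  assert (HB : forall k, Rabs (log_term k) <= majorant_step k).
  { intros k. assert (Hk := pos_INR k). unfold log_term. rewrite Rabs_minus_sym.
    apply Rle_trans with (2 := proj2 (majorant_step_bounds k)). apply log_over_increment. lra. }
  assert (H1 : ex_finite_lim_seq (rsum majorant_step)).
  { apply ex_finite_lim_seq_incr with (log_majorant (1 / 3)).
    - intros n. simpl. generalize (proj1 (majorant_step_bounds n)). lra.
    - apply majorant_step_sum. }
  assert (H2 : ex_finite_lim_seq (fun n => rsum log_term n + rsum majorant_step n)).
  { apply ex_finite_lim_seq_incr with (2 * log_majorant (1 / 3)).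
    - intros n. simpl. assert (H := HB n). apply Rabs_le_between in H. lra.
    - intros n. assert (H := majorant_step_sum n).
      assert (H3 := Rabs_rsum_le log_term majorant_step n (fun k _ => HB k)). apply Rabs_le_between in H3. lra. }
  destruct H1 as [l1 H1]. destruct H2 as [l2 H2]. exists (l2 - l1).
  apply is_lim_seq_ext with (fun n => rsum log_term n + rsum majorant_step n - rsum majorant_step n); [intros; ring|].
  now apply is_lim_seq_minus'.
Qed.

Lemma is_lim_seq_chi_inv_sum : is_lim_seq chi_inv_sum (PI / (3 * sqrt 3)).
Proof.
  apply is_lim_seq_incr_1.
  assert (Hz : is_lim_seq (fun n => 2 * / INR (S n)) 0).
  { replace (Finite 0) with (Rbar_mult 2 0) by (simpl; f_equal; ring). apply is_lim_seq_scal_l, is_lim_seq_inv_INR_S. }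
  set (v := PI / (3 * sqrt 3)).
  apply is_lim_seq_le_le with (u := fun n => v - 2 * / INR (S n)) (w := fun n => v + 2 * / INR (S n)).
  - intros n. assert (H := chi_inv_sum_approx (S n) ltac:(lia)). apply Rabs_le_between in H. fold v in H. unfold Rdiv in H. lra.
  - replace (Finite v) with (Finite (v - 0)) by (f_equal; ring).
    apply is_lim_seq_minus'; [apply is_lim_seq_const|exact Hz].
  - replace (Finite v) with (Finite (v + 0)) by (f_equal; ring).
    apply is_lim_seq_plus'; [apply is_lim_seq_const|exact Hz].
Qed.

Definition power_term (e : R) (k : nat) : R :=
  exp (- ((1 + e) * ln (INR k + 1 / 3))) - exp (- ((1 + e) * ln (INR k + 2 / 3))).

(** The first-order expansion of zeta(1+e, 1/3) - zeta(1+e, 2/3). The partial sums obey the e^2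
    bound uniformly in n by telescoping, so it passes to the limit; the constant term is 3 L(1, chi)
    = PI / sqrt 3. *)
Lemma power_term_sum_expansion (e l B : R) : 0 < e <= 1 / 4 ->
  is_lim_seq (rsum (power_term e)) l -> is_lim_seq (rsum log_term) B ->
  Rabs (l - PI / sqrt 3 + e * B) <= log_majorant (1 / 3) * e ^ 2.
Proof.
  intros He Hl HB.
  assert (HL : is_lim_seq (fun n => rsum (power_term e) n - 3 * chi_inv_sum n + e * rsum log_term n) (l - PI / sqrt 3 + e * B)).
  { destruct sqrt3_bounds as [Hs _].
    replace (PI / sqrt 3) with (3 * (PI / (3 * sqrt 3))) by (field; lra).
    apply is_lim_seq_plus'; [apply is_lim_seq_minus'; [exact Hl|]|].
    - apply (is_lim_seq_scal_l chi_inv_sum 3 _ is_lim_seq_chi_inv_sum).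
    - apply (is_lim_seq_scal_l (rsum log_term) e _ HB). }
  assert (HA := is_lim_seq_abs _ _ HL).
  refine (is_lim_seq_le _ (fun _ => log_majorant (1 / 3) * e ^ 2) _ (log_majorant (1 / 3) * e ^ 2) _ HA (is_lim_seq_const _)).
  intros n. unfold chi_inv_sum. rewrite <- !rsum_scal, <- rsum_minus, <- rsum_plus.
  apply Rle_trans with (rsum (fun k => e ^ 2 * majorant_step k) n).
  - apply Rabs_rsum_le. intros k _. assert (Hk := pos_INR k).
    assert (H := power_remainder_increment e (INR k + 1 / 3) (INR k + 2 / 3) He ltac:(lra)).
    apply Rle_trans with (e ^ 2 * (log_majorant (INR k + 1 / 3) - log_majorant (INR k + 2 / 3))).
    + eapply Rle_trans; [|exact H]. rewrite Rabs_minus_sym. right. f_equal.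
      unfold power_remainder, power_term, log_term, nat1, nat2. field. lra.
    + apply Rmult_le_compat_l; [nra|]. apply majorant_step_bounds.
  - rewrite rsum_scal, Rmult_comm. apply Rmult_le_compat_r; [nra|]. apply majorant_step_sum.
Qed.

(** [F] is controlled only for h > 0, the side on which the Dirichlet series converges. One-sided
    information is enough because the power series is differentiable at 0. *)
Lemma pseries_coeff_1_unique (b : nat -> R) (F : R -> R) (r A D C : R) :
  0 < r -> 0 <= C -> (forall h, 0 < h < r -> is_pseries b h (F h)) ->
  (forall h, 0 < h < r -> Rabs (F h - A - D * h) <= C * h ^ 2) -> b 1%nat = D.
Proof.
  intros Hr HC Hb HF.
  (* Convergence at r/2 forces the terms there to 0, so the radius of convergence is at least
     r/2. *)
  assert (HR : Rbar_lt (Rabs 0) (CV_radius b)).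
  { apply Rbar_lt_le_trans with (Rabs (r / 2)).
    - simpl. rewrite Rabs_R0, Rabs_right; lra.
    - apply Rbar_not_lt_le. intros H. apply (CV_disk_outside b (r / 2) H).
      apply is_lim_seq_ext with (fun n => scal (pow_n (r / 2) n) (b n)).
      + intros n. rewrite pow_n_pow. apply Rmult_comm.
      + apply ex_series_lim_0. eexists. apply (Hb (r / 2)). lra. }
  assert (HD := is_derive_PSeries b 0 HR). rewrite PSeries_0 in HD.
  apply is_derive_Reals in HD. unfold PS_derive in HD. simpl INR in HD. rewrite Rmult_1_l in HD.
  assert (K : forall eta, 0 < eta -> exists d, 0 < d /\ forall h, 0 < h < d ->
    Rabs ((A - b 0%nat) + (D - b 1%nat) * h) <= eta * h + C * h ^ 2).
  { intros eta Heta. destruct (HD eta Heta) as [d Hd]. exists (Rmin d r).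
    split; [apply Rmin_pos; auto; apply cond_pos|]. intros h Hh.
    assert (h < d) by (apply Rlt_le_trans with (1 := proj2 Hh), Rmin_l).
    assert (h < r) by (apply Rlt_le_trans with (1 := proj2 Hh), Rmin_r).
    specialize (Hd h ltac:(lra) ltac:(rewrite Rabs_right; lra)).
    rewrite Rplus_0_l, PSeries_0, (is_pseries_unique _ _ _ (Hb h ltac:(lra))) in Hd.
    assert (H1 := HF h ltac:(lra)).
    assert (H2 : Rabs (F h - b 0%nat - b 1%nat * h) <= eta * h).
    { replace (F h - b 0%nat - b 1%nat * h) with (((F h - b 0%nat) / h - b 1%nat) * h) by (field; lra).
      rewrite Rabs_mult, (Rabs_right h) by lra. apply Rmult_le_compat_r; lra. }
    apply Rabs_le_between in H1, H2. apply Rabs_le. lra. }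
  (* Letting h tend to 0 in [K] first matches the constant terms; only then can the inequality be
     divided by h to match the linear ones. *)
  assert (E0 : A = b 0%nat).
  { apply cond_eq. intros eps Heps. destruct (K 1 Rlt_0_1) as [d [Hd H]].
    set (M := 1 + C + Rabs (D - b 1%nat)). assert (HM : 1 <= M) by (unfold M; generalize (Rabs_pos (D - b 1%nat)); lra).
    set (h := Rmin (d / 2) (Rmin 1 (eps / M / 2))).
    assert (HeM : 0 < eps / M) by (apply Rdiv_lt_0_compat; lra).
    assert (Hh0 : 0 < h) by (unfold h; repeat apply Rmin_pos; lra).
    assert (Hh1 : h <= d / 2) by apply Rmin_l.
    assert (Hh2 : h <= 1) by (apply Rle_trans with (1 := Rmin_r _ _), Rmin_l).
    assert (Hh3 : h <= eps / M / 2) by (apply Rle_trans with (1 := Rmin_r _ _), Rmin_r).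
    specialize (H h ltac:(lra)).
    assert (Ht : Rabs (A - b 0%nat) <= M * h).
    { replace (A - b 0%nat) with ((A - b 0%nat + (D - b 1%nat) * h) - (D - b 1%nat) * h) by ring.
      apply Rle_trans with (1 := Rabs_triang _ _). rewrite Rabs_Ropp, Rabs_mult, (Rabs_right h) by lra.
      assert (C * h ^ 2 <= C * h) by (apply Rmult_le_compat_l; nra). unfold M. lra. }
    assert (M * h <= M * (eps / M / 2)) by (apply Rmult_le_compat_l; lra).
    replace (M * (eps / M / 2)) with (eps / 2) in * by (field; lra). lra. }
  symmetry. apply cond_eq. intros eps Heps. destruct (K (eps / 2) ltac:(lra)) as [d [Hd H]].
  set (h := Rmin (d / 2) (eps / (C + 1) / 4)).
  assert (HeM : 0 < eps / (C + 1)) by (apply Rdiv_lt_0_compat; lra).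
  assert (Hh0 : 0 < h) by (unfold h; repeat apply Rmin_pos; lra).
  assert (Hh1 : h <= d / 2) by apply Rmin_l. assert (Hh3 : h <= eps / (C + 1) / 4) by apply Rmin_r.
  specialize (H h ltac:(lra)). rewrite E0, Rminus_diag, Rplus_0_l, Rabs_mult, (Rabs_right h) in H by lra.
  assert (Rabs (D - b 1%nat) <= eps / 2 + C * h).
  { apply Rmult_le_reg_r with h; auto. lra. }
  assert ((C + 1) * h <= (C + 1) * (eps / (C + 1) / 4)) by (apply Rmult_le_compat_l; lra).
  replace ((C + 1) * (eps / (C + 1) / 4)) with (eps / 4) in * by (field; lra). nra.
Qed.

(** * From complex series at real points to real and imaginary parts *)

Lemma is_series_C_fst (a : nat -> C) (l : C) :
  is_series (K := C_AbsRing) (V := C_NormedModule) a l -> is_series (fun n => fst (a n)) (fst l).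
Proof.
  intros H.
  assert (E : forall n, fst (sum_n (G := C_NormedModule) a n) = sum_n (fun n => fst (a n)) n).
  { induction n as [|n IH]; [now rewrite !sum_O|]. rewrite !sum_Sn, <- IH. reflexivity. }
  apply filterlim_ext with (fun n => fst (sum_n (G := C_NormedModule) a n)); auto.
  intros P [eps HP]. apply (H (fun z => P (fst z))).
  exists eps. intros y Hy. apply HP. exact (proj1 Hy).
Qed.

Lemma is_series_C_snd (a : nat -> C) (l : C) :
  is_series (K := C_AbsRing) (V := C_NormedModule) a l -> is_series (fun n => snd (a n)) (snd l).
Proof.
  intros H.
  assert (E : forall n, snd (sum_n (G := C_NormedModule) a n) = sum_n (fun n => snd (a n)) n).
  { induction n as [|n IH]; [now rewrite !sum_O|]. rewrite !sum_Sn, <- IH. reflexivity. }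
  apply filterlim_ext with (fun n => snd (sum_n (G := C_NormedModule) a n)); auto.
  intros P [eps HP]. apply (H (fun z => P (snd z))).
  exists eps. intros y Hy. apply HP. exact (proj2 Hy).
Qed.

Lemma pow_n_RtoC (h : R) k : pow_n (K := AbsRing.Ring C_AbsRing) (RtoC h) k = RtoC (h ^ k).
Proof.
  induction k as [|k IH]; [reflexivity|]. simpl. rewrite IH.
  change (RtoC h * RtoC (h ^ k) = RtoC (h * h ^ k))%C. now rewrite RtoC_mult.
Qed.

(** The real factor [c p] and the real point h keep the two components of [g p] apart. *)
Lemma is_pseries_C_components (c : nat -> R) (g : nat -> C) (h : R) (l : C) :
  is_pseries (K := C_AbsRing) (V := C_NormedModule) (fun p => (RtoC (c p) * g p)%C) (RtoC h) l ->
  is_pseries (fun p => c p * fst (g p)) h (fst l) /\ is_pseries (fun p => c p * snd (g p)) h (snd l).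
Proof.
  intros H. split.
  - apply is_series_ext with (2 := is_series_C_fst _ _ H).
    intros n. rewrite (pow_n_RtoC h n).
    change (pow_n (K := AbsRing.Ring R_AbsRing) h n) with (pow_n (K := R_Ring) h n).
    rewrite (pow_n_pow h n).
    change (fst (RtoC (h ^ n) * (RtoC (c n) * g n))%C = h ^ n * (c n * fst (g n))). simpl. ring.
  - apply is_series_ext with (2 := is_series_C_snd _ _ H).
    intros n. rewrite (pow_n_RtoC h n).
    change (pow_n (K := AbsRing.Ring R_AbsRing) h n) with (pow_n (K := R_Ring) h n).
    rewrite (pow_n_pow h n).
    change (snd (RtoC (h ^ n) * (RtoC (c n) * g n))%C = h ^ n * (c n * snd (g n))). simpl. ring.
Qed.

Lemma is_series_rsum (f : nat -> R) (l : R) : is_series f l -> is_lim_seq (rsum f) l.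
Proof.
  intros H. apply is_lim_seq_incr_1.
  apply is_lim_seq_ext with (sum_n f); [apply sum_n_rsum|exact H].
Qed.

Lemma hurwitz_real_series (zeta : C -> R -> C) (u h : R) :
  is_hurwitz_zeta zeta -> 0 < u -> 0 < h ->
  is_series (fun n => exp (- ((1 + h) * ln (INR n + u)))) (fst (zeta (RtoC (1 + h)) u)) /\
  snd (zeta (RtoC (1 + h)) u) = 0.
Proof.
  intros Hz Hu Hh. destruct (Hz u Hu) as [_ H]. specialize (H (RtoC (1 + h)) ltac:(simpl; lra)).
  split.
  - apply is_series_ext with (2 := is_series_C_fst _ _ H).
    intros n. simpl. rewrite Ropp_0, Rmult_0_l, cos_0, Rmult_1_r. f_equal. ring.
  - assert (H1 := is_series_rsum _ _ (is_series_C_snd _ _ H)).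
    apply is_lim_seq_ext with (v := fun _ => 0) in H1.
    + apply is_lim_seq_unique in H1. rewrite Lim_seq_const in H1. now injection H1.
    + intros n. rewrite (rsum_ext _ (fun _ => 0)); [rewrite rsum_const; ring|].
      intros k _. simpl. rewrite Ropp_0, Rmult_0_l, sin_0. ring.
Qed.

Lemma stieltjes_components (zeta : C -> R -> C) (gamma_ : nat -> R -> C) (u : R) :
  is_stieltjes zeta gamma_ -> 0 < u ->
  exists r, 0 < r /\ forall h, 0 < h < r ->
    is_pseries (fun p => (-1) ^ p / INR (fact p) * fst (gamma_ p u)) h
      (fst (zeta (RtoC (1 + h)) u) - fst (/ RtoC h)%C) /\
    is_pseries (fun p => (-1) ^ p / INR (fact p) * snd (gamma_ p u)) h
      (snd (zeta (RtoC (1 + h)) u) - snd (/ RtoC h)%C).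
Proof.
  intros Hs Hu. destruct (Hs u Hu) as [r [Hr H]]. exists r. split; auto.
  intros h Hh.
  assert (E : (RtoC (1 + h) - RtoC 1)%C = RtoC h) by (rewrite <- RtoC_minus; f_equal; ring).
  specialize (H (RtoC (1 + h))). rewrite E in H.
  apply is_pseries_C_components with (1 := H ltac:(intros E1; injection E1; lra) ltac:(rewrite Cmod_R, Rabs_right; lra)).
Qed.

Theorem mainTheorem6 :
  forall (zeta : C -> R -> C) (gamma_ : nat -> R -> C),
    is_hurwitz_zeta zeta ->
    is_stieltjes zeta gamma_ ->
    (gamma_ 1%nat (1 / 3)%R - gamma_ 1%nat (2 / 3)%R)%C =
    RtoC (- (PI / (2 * sqrt 3)) *
          (2 * euler_gamma - ln 3 + 8 * ln (2 * PI)
           - 12 * ln (Gamma (1 / 3)))).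
Proof.
  intros zeta gamma_ Hz Hs.
  destruct ex_finite_lim_log_term as [B HB].
  rewrite <- (log_term_sum_limit B HB).
  destruct (stieltjes_components zeta gamma_ (1 / 3) Hs ltac:(lra)) as [r1 [Hr1 H1]].
  destruct (stieltjes_components zeta gamma_ (2 / 3) Hs ltac:(lra)) as [r2 [Hr2 H2]].
  set (r := Rmin (1 / 4) (Rmin r1 r2)).
  assert (Hr : 0 < r) by (unfold r; repeat apply Rmin_pos; lra).
  assert (Hle : forall h, 0 < h < r -> 0 < h <= 1 / 4 /\ 0 < h < r1 /\ 0 < h < r2).
  { intros h Hh. assert (r <= 1 / 4) by apply Rmin_l.
    assert (r <= r1) by (apply Rle_trans with (1 := Rmin_r _ _), Rmin_l).
    assert (r <= r2) by (apply Rle_trans with (1 := Rmin_r _ _), Rmin_r). lra. }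
  (* Both zeta values have the same polar part 1/h, which cancels in this difference and leaves the
     sum of [power_term h]. *)
  assert (Hfst := pseries_coeff_1_unique
    (PS_minus (fun p => (-1) ^ p / INR (fact p) * fst (gamma_ p (1 / 3)))
              (fun p => (-1) ^ p / INR (fact p) * fst (gamma_ p (2 / 3))))
    (fun h => (fst (zeta (RtoC (1 + h)) (1 / 3)) - fst (/ RtoC h)%C) - (fst (zeta (RtoC (1 + h)) (2 / 3)) - fst (/ RtoC h)%C))
    r (PI / sqrt 3) (- B) (log_majorant (1 / 3)) Hr).
  (* At real points the zeta values are real, so this difference is identically 0 and all three data
     A, D, C can be taken to be 0. *)
  assert (Hsnd := pseries_coeff_1_unique
    (PS_minus (fun p => (-1) ^ p / INR (fact p) * snd (gamma_ p (1 / 3)))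
              (fun p => (-1) ^ p / INR (fact p) * snd (gamma_ p (2 / 3))))
    (fun h => (snd (zeta (RtoC (1 + h)) (1 / 3)) - snd (/ RtoC h)%C) - (snd (zeta (RtoC (1 + h)) (2 / 3)) - snd (/ RtoC h)%C))
    r 0 0 0 Hr).
  assert (Hm := log_majorant_pos (1 / 3) ltac:(lra)).
  (* The coefficient of index 1 carries (-1)^1 / 1! = -1, so the constants appear negated. *)
  assert (E1 : - fst (gamma_ 1%nat (1 / 3)) + fst (gamma_ 1%nat (2 / 3)) = - B).
  { rewrite <- Hfst; [|lra| |].
    - unfold PS_minus, PS_plus, PS_opp, plus, opp; simpl. field.
    - intros h Hh. destruct (Hle h Hh) as (Ha & Hb & Hc).
      apply (is_pseries_minus (K := R_AbsRing) (V := R_NormedModule)); [apply H1|apply H2]; auto.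
    - intros h Hh. destruct (Hle h Hh) as (Ha & Hb & Hc).
      destruct (hurwitz_real_series zeta (1 / 3) h Hz ltac:(lra) ltac:(lra)) as [S1 _].
      destruct (hurwitz_real_series zeta (2 / 3) h Hz ltac:(lra) ltac:(lra)) as [S2 _].
      match goal with |- Rabs ?y <= _ => replace y with
        (fst (zeta (RtoC (1 + h)) (1 / 3)) - fst (zeta (RtoC (1 + h)) (2 / 3)) - PI / sqrt 3 + h * B) by ring end.
      apply power_term_sum_expansion; auto.
      apply is_lim_seq_ext with (fun n => rsum (fun n => exp (- ((1 + h) * ln (INR n + 1 / 3)))) n -
                                          rsum (fun n => exp (- ((1 + h) * ln (INR n + 2 / 3)))) n).
      + intros n. now rewrite <- rsum_minus.
      + apply is_lim_seq_minus'; now apply is_series_rsum. }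
  assert (E2 : - snd (gamma_ 1%nat (1 / 3)) + snd (gamma_ 1%nat (2 / 3)) = 0).
  { rewrite <- Hsnd; [|lra| |].
    - unfold PS_minus, PS_plus, PS_opp, plus, opp; simpl. field.
    - intros h Hh. destruct (Hle h Hh) as (Ha & Hb & Hc).
      apply (is_pseries_minus (K := R_AbsRing) (V := R_NormedModule)); [apply H1|apply H2]; auto.
    - intros h Hh. destruct (hurwitz_real_series zeta (1 / 3) h Hz ltac:(lra) ltac:(lra)) as [_ S1].
      destruct (hurwitz_real_series zeta (2 / 3) h Hz ltac:(lra) ltac:(lra)) as [_ S2].
      rewrite S1, S2. rewrite Rmult_0_l, Rmult_0_l. right.
      match goal with |- Rabs ?y = _ => replace y with 0 by ring end. apply Rabs_R0. }
  apply injective_projections; simpl; lra.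
Qed.
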